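(* Let $p\ge2$ be an integer and $f(u)=\frac1p u^p$. Assume that the Fornberg-Whitham type equation $u_t+f(u)_x+(1-\partial_x^2)^{-1}u_x=0$ on $I=(a,b)$ with periodic boundary condition has a sufficiently smooth exact solution $u$. Let the numerical solution $u_h$ (with auxiliary $v_h,q_h$) satisfy the semi-discrete LDG scheme described in the context. Then, for regular partitions of $I=(a,b)$ and the finite element space $V_h^k$, the following error estimates hold for small enough $h$ (for times $t\in[0,T]$, $T$ the final time): (i) for Scheme $\mathcal{D}1$ and $k\ge1$, $$\|u-u_h\|_{L^2(I)}\le Ch^{k+1}\ \text{ if } p \text{ is odd},\qquad \|u-u_h\|_{L^2(I)}\le Ch^{k+\frac12}\ \text{ if } p\text{ is even};$$ (ii) for Scheme $\mathcal{C}1$ and $k\ge2$, $$\|u-u_h\|_{L^2(I)}\le Ch^{k}.$$ The constant $C$ is independent of $h$; it depends on the final time $T$, on $k$, on $\|u\|_{k+2}$ (the maximum over $[0,T]$ of the standard Sobolev $(k+2)$-norm of $u$) and on the bounds of the derivatives up to second order of the nonlinear term $f(u)$.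
   Context: Mesh and space: $a=x_{1/2}<x_{3/2}<\dots<x_{N+1/2}=b$, $I_j=[x_{j-1/2},x_{j+1/2}]$, $\Delta x_j=x_{j+1/2}-x_{j-1/2}$, $h=\max_j\Delta x_j$; regular partitions means, as usual, that $h/\min_j\Delta x_j$ stays bounded as $h\to0$. $V_h^k=\{v: v|_{I_j}\in P^k(I_j),\ 1\le j\le N\}$, where $P^k(I_j)$ is the set of polynomials of degree at most $k$ on $I_j$. $u^-_{j+1/2}$, $u^+_{j+1/2}$ are the traces at $x_{j+1/2}$ from $I_j$ and $I_{j+1}$ (with periodic identification). Jump: $[u]=u^+-u^-$; average: $\{u\}=\frac12(u^++u^-)$. Also $(u,v)_{I_j}=\int_{I_j}uv\,dx$ and $\langle\hat u,v\rangle_{I_j}=\hat u_{j+1/2}v^-_{j+1/2}-\hat u_{j-1/2}v^+_{j-1/2}$. LDG scheme: find $u_h,v_h,q_h\in V_h^k$ (depending on $t$) such that for all $j$ and all $\phi,\varphi,\psi\in V_h^k$, $$((u_h)_t,\phi)_{I_j}+\langle\widehat{f(u_h)},\phi\rangle_{I_j}-(f(u_h),\phi_x)_{I_j}+(v_h,\phi)_{I_j}=0,$$ $$(v_h,\varphi)_{I_j}-\langle\widehat{q_h},\varphi\rangle_{I_j}+(q_h,\varphi_x)_{I_j}=\langle\widehat{u_h},\varphi\rangle_{I_j}-(u_h,\varphi_x)_{I_j},$$ $$(q_h,\psi)_{I_j}=\langle\widehat{v_h},\psi\rangle_{I_j}-(v_h,\psi_x)_{I_j}.$$ Scheme $\mathcal{D}1$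 uses the Godunov flux $\widehat{f(u_h)}=\min_{u_h^-\le w\le u_h^+}f(w)$ if $u_h^-<u_h^+$ and $\widehat{f(u_h)}=\max_{u_h^+\le w\le u_h^-}f(w)$ if $u_h^+\le u_h^-$, together with $\widehat{q_h}=q_h^-$, $\widehat{v_h}=v_h^+$, $\widehat{u_h}=u_h^-$. Scheme $\mathcal{C}1$ uses $\widehat{f(u_h)}=[F(u_h)]/[u_h]$ if $[u_h]\ne0$ and $\widehat{f(u_h)}=f(\{u_h\})$ if $[u_h]=0$, where $F(u)=\int^u f(\tau)\,d\tau$ (equivalently $\widehat{f(u_h)}=\frac{1}{p(p+1)}\sum_{m=0}^p (u_h^+)^{p-m}(u_h^-)^m$), together with $\widehat{q_h}=\{q_h\}$, $\widehat{v_h}=\{v_h\}$, $\widehat{u_h}=\{u_h\}$. Standing assumption: for any $t\in[0,T]$ the exact solution and its spatial derivatives are all bounded.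
   Formalization: The statement leaves the initial value of u_h free, and is then false (u=0, u_h=1, v_h=q_h=0 solves both schemes); the formal theorem adds that the initial L2 error is at most C_0 h^{k+1}, and C may also depend on C_0. *)

(* Defs.v *)
From Stdlib Require Import Reals List Arith.
From Coquelicot Require Import Coquelicot.
Local Open Scope R_scope.

(** The node x_{j+1/2} is [node j], 0 <= j <= N, and the cell
    [[node j, node (S j)]], 0 <= j < N, is numbered j. *)
Record mesh (a b : R) := Mesh {
  ncell : nat;
  node : nat -> R;
  ncell_pos : (0 < ncell)%nat;
  node_first : node 0%nat = a;
  node_last : node ncell = b;
  node_incr : forall j, (j < ncell)%nat -> node j < node (S j)
}.
Arguments ncell {a b} _.
Arguments node {a b} _ _.

Definition widths {a b} (m : mesh a b) : list R :=
  map (fun j => node m (S j) - node m j) (seq 0 (ncell m)).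
Definition hmax {a b} (m : mesh a b) : R := RList.MaxRlist (widths m).
Definition hmin {a b} (m : mesh a b) : R := RList.MinRlist (widths m).

(** A piecewise polynomial is a family [v] of functions indexed by the cells.
    Each [v j] is a polynomial function on the whole line, of which only the
    values on cell j matter, so that two-sided traces are plain evaluations. *)
Definition is_poly (k : nat) (g : R -> R) : Prop :=
  exists c : nat -> R, forall x, g x = sum_n (fun i => c i * x ^ i) k.

Definition Vh {a b} (m : mesh a b) (k : nat) (v : nat -> R -> R) : Prop :=
  forall j, (j < ncell m)%nat -> is_poly k (v j).

(** Traces at [node i], 0 <= i <= N; the nodes 0 and N are identified. *)
Definition trace_minus {a b} (m : mesh a b) (v : nat -> R -> R) (i : nat) : R :=
  match i with
  | O => v (pred (ncell m)) (node m (ncell m))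
  | S j => v j (node m i)
  end.
Definition trace_plus {a b} (m : mesh a b) (v : nat -> R -> R) (i : nat) : R :=
  if Nat.eq_dec i (ncell m) then v 0%nat (node m 0) else v i (node m i).

Definition cell_int {a b} (m : mesh a b) (j : nat) (g : R -> R) : R :=
  RInt g (node m j) (node m (S j)).

(** <hat, phi>_{I_j} *)
Definition bracket {a b} (m : mesh a b) (hat : nat -> R)
    (phi : nat -> R -> R) (j : nat) : R :=
  hat (S j) * trace_minus m phi (S j) - hat j * trace_plus m phi j.

(** Every numerical flux is a function of the traces (u^-, u^+). *)
Record fluxes := Fluxes {
  fhat : R -> R -> R;
  qhat : R -> R -> R;
  vhat : R -> R -> R;
  uhat : R -> R -> R
}.

Definition at_nodes {a b} (m : mesh a b) (g : R -> R -> R)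
    (v : nat -> R -> R) (i : nat) : R :=
  g (trace_minus m v i) (trace_plus m v i).

(** For continuous [f] these are the attained minimum and maximum. *)
Definition min_on (f : R -> R) (c d : R) : R :=
  real (Glb_Rbar (fun y => exists w, c <= w <= d /\ y = f w)).
Definition max_on (f : R -> R) (c d : R) : R :=
  real (Lub_Rbar (fun y => exists w, c <= w <= d /\ y = f w)).

Definition godunov (f : R -> R) (um up : R) : R :=
  if Rlt_dec um up then min_on f um up else max_on f up um.

Definition average (um up : R) : R := / 2 * (up + um).

Definition conservative (f : R -> R) (um up : R) : R :=
  if Req_EM_T up um then f (average um up)
  else (RInt f 0 up - RInt f 0 um) / (up - um).

Definition schemeD1 (f : R -> R) : fluxes :=
  {| fhat := godunov f;
     qhat := fun qm _ => qm;
     vhat := fun _ vp => vp;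
     uhat := fun um _ => um |}.

Definition schemeC1 (f : R -> R) : fluxes :=
  {| fhat := conservative f;
     qhat := average;
     vhat := average;
     uhat := average |}.

Definition ldg_equations {a b} (m : mesh a b) (k : nat) (f : R -> R)
    (F : fluxes) (uht uh vh qh : nat -> R -> R) : Prop :=
  forall j, (j < ncell m)%nat ->
    (forall phi, Vh m k phi ->
       cell_int m j (fun x => uht j x * phi j x)
       + bracket m (at_nodes m (fhat F) uh) phi j
       - cell_int m j (fun x => f (uh j x) * Derive (phi j) x)
       + cell_int m j (fun x => vh j x * phi j x) = 0) /\
    (forall phi, Vh m k phi ->
       cell_int m j (fun x => vh j x * phi j x)
       - bracket m (at_nodes m (qhat F) qh) phi j
       + cell_int m j (fun x => qh j x * Derive (phi j) x)
       = bracket m (at_nodes m (uhat F) uh) phi j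
         - cell_int m j (fun x => uh j x * Derive (phi j) x)) /\
    (forall psi, Vh m k psi ->
       cell_int m j (fun x => qh j x * psi j x)
       = bracket m (at_nodes m (vhat F) vh) psi j
         - cell_int m j (fun x => vh j x * Derive (psi j) x)).

(** [uh t j x]: time, cell, space.  The time derivative is only required on
    the open interval, with continuity up to t = 0 and t = T. *)
Definition ldg_solution {a b} (m : mesh a b) (k : nat) (T : R) (f : R -> R)
    (F : fluxes) (uh vh qh : R -> nat -> R -> R) : Prop :=
  (forall t, 0 <= t <= T -> Vh m k (uh t) /\ Vh m k (vh t) /\ Vh m k (qh t)) /\
  (forall j x, (j < ncell m)%nat ->
     continuous_on (fun t => 0 <= t <= T) (fun t => uh t j x)) /\
  (forall t j x, 0 < t < T -> (j < ncell m)%nat ->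
     ex_derive (fun s => uh s j x) t) /\
  (forall t, 0 < t < T ->
     ldg_equations m k f F
       (fun j x => Derive (fun s => uh s j x) t) (uh t) (vh t) (qh t)).

Definition L2_error {a b} (m : mesh a b) (w : R -> R) (v : nat -> R -> R) : R :=
  sqrt (sum_n (fun j => cell_int m j (fun x => (w x - v j x) ^ 2))
              (pred (ncell m))).

Definition sobolev_norm (a b : R) (n : nat) (w : R -> R) : R :=
  sqrt (sum_n (fun i => RInt (fun x => (Derive_n w i x) ^ 2) a b) n).

Definition periodic (L : R) (w : R -> R) : Prop := forall x, w (x + L) = w x.

(** [w] is (1 - d^2/dx^2)^{-1} g on L-periodic functions. *)
Definition helmholtz_inverse (L : R) (g w : R -> R) : Prop :=
  periodic L w /\
  (forall n x, (n <= 2)%nat -> ex_derive_n w n x) /\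
  (forall x, w x - Derive_n w 2 x = g x).

(** [u t x]; a function on I with periodic boundary condition is represented
    by its (b - a)-periodic extension. [r] is the order of spatial smoothness. *)
Definition smooth_bounded (a b T : R) (r : nat) (u : R -> R -> R) : Prop :=
  (forall t, 0 <= t <= T -> periodic (b - a) (u t)) /\
  (forall t n x, 0 <= t <= T -> (n <= r)%nat ->
     ex_derive_n (u t) n x /\ continuous (Derive_n (u t) n) x) /\
  (exists B, forall t n x, 0 <= t <= T -> (n <= r)%nat ->
     Rabs (Derive_n (u t) n x) <= B) /\
  (forall x, continuous_on (fun t => 0 <= t <= T) (fun t => u t x)) /\
  (forall t x, 0 < t < T -> ex_derive (fun s => u s x) t).

Definition fornberg_whitham (a b T : R) (f : R -> R) (u : R -> R -> R) : Prop :=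
  forall t, 0 < t < T ->
    exists w, helmholtz_inverse (b - a) (Derive (u t)) w /\
      forall x, Derive (fun s => u s x) t
                + Derive (fun y => f (u t y)) x + w x = 0.

Definition power_flux (p : nat) (u : R) : R := / INR p * u ^ p.

(* Main.v *)
Require Import Defs.
From Stdlib Require Import Reals Lra Lia List Arith.
From Coquelicot Require Import Coquelicot.
Local Open Scope R_scope.

(** The proof is an energy argument. On every cell the exact functions are replaced by
    Gauss-Radau projections ([radau_exists]), and the difference xi between the numerical
    solution and the projection of u is used as a test function. The remaining projection
    error eta is explicit: its values are O(h^(k+1/2)) times the local L2 norm of the
    derivative of order k+1, and its integral against derivatives of test functions
    vanishes.

    The elliptic part is stable by duality. With the two linear fluxes adjoint to each
    other, the first-order systems tested with the errors of v, q and u lose all their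
    derivatives ([elliptic_stability]), so that the nonlocal term contributes only
    multiples of the energy E, the square of the L2 norm of xi.

    For the nonlinear part let F be a primitive of f and consider the relative entropy
    F(u + xi) - F(u) - f(u) xi. Its space derivative contains the dangerous product
    (f(u + xi) - f(u)) xi_x, so that this product turns into boundary values plus terms
    quadratic in xi ([interior_cell]); no smallness of xi / h is needed, only that xi stays
    below 1. The boundary values combine with the numerical flux at each node into the
    integral of the flux value minus f between the two traces of u + xi. For a monotone or
    conservative flux that integral would have a sign, were the flux evaluated at those
    traces; it is evaluated at traces shifted by eta ([node_term_le]).
    - For p odd, f is nondecreasing, the Godunov flux reads the left trace only, and the
      projection makes the left shift vanish: nothing is lost ([node_upwind]).
    - For the Godunov flux in general the shift on the right enters, multiplied by |f'| up
      to quadratic terms. The dissipation of the flux carries the same weight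
      ([godunov_dissipation]) and absorbs it, at the price of the sum over the nodes of
      eta^2, which is of order h^(2k+1) ([node_godunov]).
    - The conservative flux has no dissipation, and Young's inequality with weight h
      costs another factor 1/h ([node_conservative]); the same loss occurs in the central
      fluxes of the elliptic part ([ddx_residual]).
    Altogether E' <= C (E + (kappa + h) h^(2k+1)) with kappa = 0, 1 or 1/h
    ([energy_rate]), and the squared error has the order of the source term.

    That xi stays below 1 follows by continuation: the inverse inequality reduces it to an
    energy of order h, and Gronwall's inequality gives order h^2 ([gronwall_barrier],
    [scheme_estimate]).

    The constants depend on u through K only: Sobolev's inequality, the product rule and
    elliptic regularity bound all norms that occur, including those of the time derivative,
    for which the equation is used ([exact_regularity]). The time derivative is given
    pointwise; that projections may be differentiated in time is seen from the equation
    as well ([time_regularity]). *)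

(** * Finite sums and integrals of continuous functions *)

Fixpoint bigsum (n : nat) (F : nat -> R) : R :=
  match n with O => 0 | S n' => bigsum n' F + F n' end.

Lemma bigsum_S n F : bigsum (S n) F = bigsum n F + F n.
Proof. reflexivity. Qed.

Lemma sum_n_bigsum (F : nat -> R) n : sum_n F n = bigsum (S n) F.
Proof.
induction n as [|n IH].
- rewrite sum_O; simpl; ring.
- rewrite sum_Sn, IH; reflexivity.
Qed.

Lemma bigsum_ext n F G :
  (forall i, (i < n)%nat -> F i = G i) -> bigsum n F = bigsum n G.
Proof.
induction n as [|n IH]; intros H; simpl; [reflexivity|].
rewrite IH by (intros; apply H; lia). rewrite H by lia. reflexivity.
Qed.

Lemma bigsum_le n F G :
  (forall i, (i < n)%nat -> F i <= G i) -> bigsum n F <= bigsum n G.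
Proof.
induction n as [|n IH]; intros H; simpl; [lra|].
assert (H1 := H n ltac:(lia)).
assert (bigsum n F <= bigsum n G) by (apply IH; intros; apply H; lia). lra.
Qed.

Lemma bigsum_plus n F G : bigsum n (fun i => F i + G i) = bigsum n F + bigsum n G.
Proof. induction n as [|n IH]; simpl; [ring|rewrite IH; ring]. Qed.

Lemma bigsum_minus n F G : bigsum n (fun i => F i - G i) = bigsum n F - bigsum n G.
Proof. induction n as [|n IH]; simpl; [ring|rewrite IH; ring]. Qed.

Lemma bigsum_scal n c F : bigsum n (fun i => c * F i) = c * bigsum n F.
Proof. induction n as [|n IH]; simpl; [ring|rewrite IH; ring]. Qed.

Lemma bigsum_zero n F : (forall i, (i < n)%nat -> F i = 0) -> bigsum n F = 0.
Proof.
intros H; rewrite (bigsum_ext n F (fun _ => 0 * 0)) by (intros; rewrite H by auto; ring).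
rewrite bigsum_scal; ring.
Qed.

Lemma bigsum_nonneg n F : (forall i, (i < n)%nat -> 0 <= F i) -> 0 <= bigsum n F.
Proof.
intros H. rewrite <- (bigsum_zero n (fun _ => 0)) by auto. now apply bigsum_le.
Qed.

Lemma bigsum_const n c : bigsum n (fun _ => c) = INR n * c.
Proof.
induction n as [|n IH]; [simpl; ring|]. rewrite S_INR; simpl; rewrite IH; ring.
Qed.

Lemma bigsum_term_le n F i :
  (forall j, (j < n)%nat -> 0 <= F j) -> (i < n)%nat -> F i <= bigsum n F.
Proof.
induction n as [|n IH]; intros H Hi; [lia|simpl].
assert (0 <= F n) by (apply H; lia).
assert (0 <= bigsum n F) by (apply bigsum_nonneg; intros; apply H; lia).
destruct (Nat.eq_dec i n) as [->|Hne]; [lra|].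
assert (F i <= bigsum n F) by (apply IH; [intros; apply H; lia|lia]). lra.
Qed.

Lemma bigsum_single n F i :
  (i < n)%nat -> (forall j, (j < n)%nat -> j <> i -> F j = 0) -> bigsum n F = F i.
Proof.
induction n as [|n IH]; intros Hi H; [lia|simpl].
destruct (Nat.eq_dec i n) as [->|Hne].
- rewrite bigsum_zero; [ring|]. intros j Hj; apply H; lia.
- rewrite IH; [|lia|intros; apply H; lia]. rewrite (H n) by lia. ring.
Qed.

Lemma bigsum_Abs n F : Rabs (bigsum n F) <= bigsum n (fun i => Rabs (F i)).
Proof.
induction n as [|n IH]; simpl; [rewrite Rabs_R0; lra|].
eapply Rle_trans; [apply Rabs_triang|lra].
Qed.

Lemma bigsum_recl n F : bigsum (S n) F = F 0%nat + bigsum n (fun i => F (S i)).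
Proof. induction n as [|n IH]; [simpl; ring|]. simpl in *; rewrite IH; ring. Qed.

Lemma bigsum_shift n F :
  F n = F 0%nat -> bigsum n (fun i => F (S i)) = bigsum n F.
Proof.
intros H. assert (H1 := bigsum_recl n F). simpl in H1. lra.
Qed.

Lemma bigsum_mulr n c F : bigsum n F * c = bigsum n (fun i => F i * c).
Proof. induction n as [|n IH]; simpl; [ring|rewrite <- IH; ring]. Qed.

Lemma is_derive_bigsum n (F : nat -> R -> R) (dF : nat -> R) t :
  (forall i, (i < n)%nat -> is_derive (F i) t (dF i)) ->
  is_derive (fun s => bigsum n (fun i => F i s)) t (bigsum n dF).
Proof.
induction n as [|n IH]; intros H; simpl.
- exact (is_derive_const 0 t).
- apply (is_derive_plus (fun s => bigsum n (fun i => F i s)) (F n)).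
  + apply IH; intros; apply H; lia.
  + apply H; lia.
Qed.

(** Continuity at every point; on the real line this is all the regularity
    that integration over cells asks for. *)
Definition cont (g : R -> R) : Prop := forall x, continuous g x.

Lemma cont_const c : cont (fun _ => c).
Proof. intros x; apply continuous_const. Qed.
Lemma cont_id : cont (fun x => x).
Proof. intros x; apply continuous_id. Qed.
Lemma cont_plus g h : cont g -> cont h -> cont (fun x => g x + h x).
Proof. intros Hg Hh x; apply (continuous_plus g h); auto. Qed.
Lemma cont_minus g h : cont g -> cont h -> cont (fun x => g x - h x).
Proof. intros Hg Hh x; apply (continuous_minus g h); auto. Qed.
Lemma cont_mult g h : cont g -> cont h -> cont (fun x => g x * h x).
Proof. intros Hg Hh x; apply (continuous_mult g h); auto. Qed.
Lemma cont_opp g : cont g -> cont (fun x => - g x).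
Proof. intros Hg x; apply (continuous_opp g); auto. Qed.
Lemma cont_abs g : cont g -> cont (fun x => Rabs (g x)).
Proof.
intros Hg x; apply (continuous_comp g Rabs); auto. apply continuous_Rabs.
Qed.
Lemma cont_pow g n : cont g -> cont (fun x => g x ^ n).
Proof.
intros Hg; induction n as [|n IH]; simpl; [apply cont_const|].
apply cont_mult; auto.
Qed.
Lemma cont_comp g h : cont g -> cont h -> cont (fun x => g (h x)).
Proof. intros Hg Hh x; apply (continuous_comp h g); auto. Qed.
Lemma cont_bigsum n (F : nat -> R -> R) :
  (forall i, (i < n)%nat -> cont (F i)) -> cont (fun x => bigsum n (fun i => F i x)).
Proof.
induction n as [|n IH]; intros H; simpl; [apply cont_const|].
apply cont_plus; [apply IH; intros; apply H; lia|apply H; lia].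
Qed.
Lemma cont_ext g h : (forall x, g x = h x) -> cont g -> cont h.
Proof. intros E Hg x; apply (continuous_ext g h); auto. Qed.
Lemma cont_ex_derive g : (forall x, ex_derive g x) -> cont g.
Proof. intros H x; apply (ex_derive_continuous g); auto. Qed.

Ltac nonneg :=
  first [ assumption | lra
        | lazymatch goal with
          | |- 0 <= _ * _ => apply Rmult_le_pos; nonneg
          | |- 0 <= _ + _ => apply Rplus_le_le_0_compat; nonneg
          | |- 0 <= _ ^ 2 => apply pow2_ge_0
          | |- 0 <= Rabs _ => apply Rabs_pos
          | |- 0 <= ?v => unfold v; nonneg
          end ].

Ltac cont_tac :=
  lazymatch goal with
  | |- cont (fun _ => ?c) => apply cont_const
  | |- cont (fun x => x) => apply cont_id
  | |- cont (fun x => @?f x + @?g x) => apply (cont_plus f g); cont_tac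
  | |- cont (fun x => @?f x - @?g x) => apply (cont_minus f g); cont_tac
  | |- cont (fun x => @?f x * @?g x) => apply (cont_mult f g); cont_tac
  | |- cont (fun x => - @?f x) => apply (cont_opp f); cont_tac
  | |- cont (fun x => Rabs (@?f x)) => apply (cont_abs f); cont_tac
  | |- cont (fun x => (@?f x) ^ ?n) => apply (cont_pow f n); cont_tac
  | |- cont _ => first [assumption | solve [auto]]
  | _ => idtac
  end.

(* Integrals are typed in the carrier of a normed module, where ring does not see R. *)
Ltac eq_in_R := lazymatch goal with |- ?a = ?b => change (@eq R a b) end.

Lemma ex_RInt_cont g c d : cont g -> ex_RInt g c d.
Proof. intros H; apply (ex_RInt_continuous g); auto. Qed.

Lemma RInt_plus_cont g h c d : cont g -> cont h ->
  RInt (fun x => g x + h x) c d = RInt g c d + RInt h c d.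
Proof. intros; apply (RInt_plus g h); now apply ex_RInt_cont. Qed.
Lemma RInt_minus_cont g h c d : cont g -> cont h ->
  RInt (fun x => g x - h x) c d = RInt g c d - RInt h c d.
Proof. intros; apply (RInt_minus g h); now apply ex_RInt_cont. Qed.
Lemma RInt_scal_cont l g c d : cont g ->
  RInt (fun x => l * g x) c d = l * RInt g c d.
Proof. intros; apply (RInt_scal g c d l); now apply ex_RInt_cont. Qed.
Lemma RInt_const_R c d l : RInt (fun _ => l) c d = (d - c) * l.
Proof. rewrite RInt_const; reflexivity. Qed.
Lemma RInt_ext_R (g h : R -> R) c d : (forall x, g x = h x) -> RInt g c d = RInt h c d.
Proof. intros H; apply RInt_ext; auto. Qed.
Lemma RInt_le_cont g h c d : c <= d -> cont g -> cont h ->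
  (forall x, c < x < d -> g x <= h x) -> RInt g c d <= RInt h c d.
Proof. intros; apply RInt_le; auto; now apply ex_RInt_cont. Qed.
Lemma RInt_nonneg_cont g c d : c <= d -> cont g ->
  (forall x, c < x < d -> 0 <= g x) -> 0 <= RInt g c d.
Proof.
intros Hcd Hg H. rewrite <- (Rmult_0_r (d - c)), <- RInt_const_R.
apply RInt_le_cont; auto; apply cont_const.
Qed.
Lemma RInt_sqr_nonneg g c d : c <= d -> cont g -> 0 <= RInt (fun x => g x ^ 2) c d.
Proof. intros; apply RInt_nonneg_cont; [auto|cont_tac|intros; apply pow2_ge_0]. Qed.
Lemma RInt_Abs_cont g h c d : c <= d -> cont g -> cont h ->
  (forall x, c < x < d -> Rabs (g x) <= h x) -> Rabs (RInt g c d) <= RInt h c d.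
Proof.
intros Hcd Hg Hh H. eapply Rle_trans; [apply abs_RInt_le; auto; now apply ex_RInt_cont|].
apply RInt_le_cont; auto. now apply cont_abs.
Qed.
Lemma RInt_Chasles_cont g c d e : cont g -> RInt g c d + RInt g d e = RInt g c e.
Proof. intros; apply (RInt_Chasles g); now apply ex_RInt_cont. Qed.
Lemma RInt_bigsum n (F : nat -> R -> R) c d : (forall i, (i < n)%nat -> cont (F i)) ->
  RInt (fun x => bigsum n (fun i => F i x)) c d = bigsum n (fun i => RInt (F i) c d).
Proof.
induction n as [|n IH]; intros H; simpl.
- rewrite RInt_const_R; ring.
- rewrite RInt_plus_cont; [|apply cont_bigsum; intros; apply H; lia|apply H; lia].
  rewrite IH by (intros; apply H; lia). reflexivity.
Qed.

Lemma cont_locally_close g x e : cont g -> 0 < e ->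
  exists d, 0 < d /\ forall y, Rabs (y - x) < d -> Rabs (g y - g x) < e.
Proof.
intros Hg He. destruct (proj1 (filterlim_locally _ _) (Hg x) (mkposreal e He)) as [d Hd].
exists d; split; [apply cond_pos|]. intros y Hy. apply Hd, Hy.
Qed.

(** If g were positive at one point it would stay above half that value nearby. *)
Lemma RInt_zero_nonneg g c d : c < d -> cont g ->
  (forall x, c < x < d -> 0 <= g x) -> RInt g c d = 0 ->
  forall x, c < x < d -> g x = 0.
Proof.
intros Hcd Hg Hpos Hint x Hx.
destruct (Req_dec (g x) 0) as [H0|H0]; [exact H0|exfalso].
assert (Hgx : 0 < g x) by (specialize (Hpos x Hx); lra).
destruct (cont_locally_close g x (g x / 2) Hg ltac:(lra)) as [e [He Hclose]].
pose (r := Rmin (e / 2) (Rmin ((x - c) / 2) ((d - x) / 2))).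
assert (Hr : 0 < r) by (unfold r; repeat apply Rmin_glb_lt; lra).
assert (Hr1 : r <= e / 2) by apply Rmin_l.
assert (Hr2 : r <= (x - c) / 2) by (eapply Rle_trans; [apply Rmin_r|apply Rmin_l]).
assert (Hr3 : r <= (d - x) / 2) by (eapply Rle_trans; [apply Rmin_r|apply Rmin_r]).
assert (H1 := RInt_Chasles_cont g c (x - r) d Hg).
assert (H2 := RInt_Chasles_cont g (x - r) (x + r) d Hg).
assert (H3 : 0 <= RInt g c (x - r)).
{ apply RInt_nonneg_cont; [lra|auto|intros; apply Hpos; lra]. }
assert (H4 : 0 <= RInt g (x + r) d).
{ apply RInt_nonneg_cont; [lra|auto|intros; apply Hpos; lra]. }
assert (H5 : (2 * r) * (g x / 2) <= RInt g (x - r) (x + r)).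
{ replace (2 * r) with (x + r - (x - r)) by ring. rewrite <- RInt_const_R.
  apply RInt_le_cont; auto; [lra|apply cont_const|].
  intros y Hy. assert (H := Hclose y ltac:(apply Rabs_def1; lra)).
  apply Rabs_def2 in H; lra. }
assert (0 < 2 * r * (g x / 2)) by (apply Rmult_lt_0_compat; lra).
lra.
Qed.

Lemma RInt_rescale g c d : cont g ->
  RInt g c d = (d - c) * RInt (fun s => g (c + (d - c) * s)) 0 1.
Proof.
intros Hg.
assert (H : RInt (fun s => (d - c) * g ((d - c) * s + c)) 0 1 = RInt g c d).
{ eapply eq_trans; [apply (RInt_comp_lin g (d - c) c 0 1); now apply ex_RInt_cont|].
  f_equal; ring. }
rewrite <- H, RInt_scal_cont.
- f_equal. apply RInt_ext_R; intros s. f_equal; ring.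
- apply (cont_comp g); cont_tac.
Qed.

Lemma cont_affine g c d : cont g -> cont (fun s => g (c + d * s)).
Proof. intros Hg; apply (cont_comp g); cont_tac. Qed.

(** Cauchy-Schwarz against the constant 1, from the square of g minus its mean. *)
Lemma RInt_sqr_le g c d : c <= d -> cont g ->
  (RInt g c d) ^ 2 <= (d - c) * RInt (fun x => g x ^ 2) c d.
Proof.
intros Hcd Hg. destruct (Req_dec c d) as [->|Hne].
- rewrite RInt_point. unfold zero; simpl. lra.
- set (I := RInt g c d). set (l := I / (d - c)).
  assert (H : 0 <= RInt (fun x => (g x ^ 2 - (2 * l) * g x) + l ^ 2) c d).
  { apply RInt_nonneg_cont; auto; [cont_tac|]. intros x _.
    replace (g x ^ 2 - 2 * l * g x + l ^ 2) with ((g x - l) ^ 2) by ring.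
    apply pow2_ge_0. }
  rewrite RInt_plus_cont, RInt_minus_cont, RInt_scal_cont, RInt_const_R in H by cont_tac.
  fold I in H. unfold l in H.
  replace (I ^ 2) with ((d - c) * (2 * (I / (d - c)) * I - (d - c) * (I / (d - c)) ^ 2))
    by (field; lra).
  apply Rmult_le_compat_l; lra.
Qed.

Lemma RInt_by_parts g h c d :
  (forall x, ex_derive g x) -> (forall x, ex_derive h x) ->
  cont (Derive g) -> cont (Derive h) ->
  RInt (fun x => Derive g x * h x) c d + RInt (fun x => g x * Derive h x) c d
  = g d * h d - g c * h c.
Proof.
intros Hg Hh Cg Ch.
assert (cont g) by now apply cont_ex_derive.
assert (cont h) by now apply cont_ex_derive.
rewrite <- RInt_plus_cont by cont_tac.
assert (HD : forall x, is_derive (fun y => g y * h y) x (Derive g x * h x + g x * Derive h x)).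
{ intros x. assert (H1 := Derive_correct g x (Hg x)). assert (H2 := Derive_correct h x (Hh x)).
  apply (is_derive_mult g h x _ _ H1 H2). intros; apply Rmult_comm. }
assert (H2 : is_RInt (fun x => Derive g x * h x + g x * Derive h x) c d
               (minus (g d * h d) (g c * h c))).
{ apply (is_RInt_derive (fun y => g y * h y)); [auto|]. intros x _.
  apply (cont_plus (fun x => Derive g x * h x) (fun x => g x * Derive h x)); cont_tac. }
exact (is_RInt_unique (V := R_CompleteNormedModule) _ c d _ H2).
Qed.

Lemma RInt_Derive_cont g c d : (forall x, ex_derive g x) -> cont (Derive g) ->
  RInt (Derive g) c d = g d - g c.
Proof. intros; apply RInt_Derive; auto. Qed.

(** * Polynomials *)

Lemma is_poly_ext k g h : (forall x, g x = h x) -> is_poly k g -> is_poly k h.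
Proof. intros E [c Hc]; exists c; intros x; rewrite <- E; apply Hc. Qed.

Lemma is_poly_const k c : is_poly k (fun _ => c).
Proof.
exists (fun i => match i with O => c | _ => 0 end). intros x.
rewrite sum_n_bigsum, bigsum_recl. rewrite bigsum_zero; simpl; [ring|].
intros; ring.
Qed.

Lemma is_poly_plus k g h : is_poly k g -> is_poly k h -> is_poly k (fun x => g x + h x).
Proof.
intros [c Hc] [d Hd]; exists (fun i => c i + d i); intros x.
rewrite Hc, Hd, !sum_n_bigsum, <- bigsum_plus. apply bigsum_ext; intros; ring.
Qed.

Lemma is_poly_scal k l g : is_poly k g -> is_poly k (fun x => l * g x).
Proof.
intros [c Hc]; exists (fun i => l * c i); intros x.
rewrite Hc, !sum_n_bigsum, <- bigsum_scal. apply bigsum_ext; intros; ring.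
Qed.

Lemma is_poly_minus k g h : is_poly k g -> is_poly k h -> is_poly k (fun x => g x - h x).
Proof.
intros Hg Hh. apply (is_poly_ext k (fun x => g x + (-1) * h x)); [intros; ring|].
apply is_poly_plus; auto. now apply is_poly_scal.
Qed.

Lemma is_poly_bigsum k n (F : nat -> R -> R) : (forall i, (i < n)%nat -> is_poly k (F i)) ->
  is_poly k (fun x => bigsum n (fun i => F i x)).
Proof.
induction n as [|n IH]; intros H; simpl; [apply is_poly_const|].
apply is_poly_plus; [apply IH; intros; apply H; lia|apply H; lia].
Qed.

(** Horner's form, by which most facts on polynomials are proved by induction on the
    degree; the form with the leading monomial split off serves where monomials of
    increasing degree have to be adjoined one by one. *)
Lemma is_poly_S k g : is_poly (S k) g <->
  exists c g1, is_poly k g1 /\ forall x, g x = c + x * g1 x.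
Proof.
split.
- intros [c Hc]. exists (c 0%nat), (fun x => sum_n (fun i => c (S i) * x ^ i) k).
  split; [exists (fun i => c (S i)); auto|]. intros x.
  rewrite Hc, !sum_n_bigsum, bigsum_recl, <- bigsum_scal. f_equal; [simpl; ring|].
  apply bigsum_ext; intros; simpl; ring.
- intros [c [g1 [[d Hd] Hg]]].
  exists (fun i => match i with O => c | S i => d i end). intros x.
  rewrite Hg, Hd, !sum_n_bigsum, (bigsum_recl (S k)), <- bigsum_scal.
  f_equal; [simpl; ring|]. apply bigsum_ext; intros; simpl; ring.
Qed.

Lemma is_poly_lead k g : is_poly (S k) g <->
  exists c g1, is_poly k g1 /\ forall x, g x = g1 x + c * x ^ S k.
Proof.
split.
- intros [c Hc]. exists (c (S k)), (fun x => sum_n (fun i => c i * x ^ i) k).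
  split; [exists c; auto|]. intros x. rewrite Hc, sum_Sn; reflexivity.
- intros [c [g1 [[d Hd] Hg]]].
  exists (fun i => if Nat.eq_dec i (S k) then c else d i). intros x.
  rewrite Hg, Hd, sum_Sn. unfold plus; simpl AbelianMonoid.sort; cbv beta.
  destruct (Nat.eq_dec (S k) (S k)) as [_|]; [|lia].
  match goal with |- ?A + ?B = _ => enough (E : A = sum_n
     (fun i => (if Nat.eq_dec i (S k) then c else d i) * x ^ i) k) by (rewrite E; reflexivity) end.
  rewrite !sum_n_bigsum. apply bigsum_ext; intros i Hi.
  destruct (Nat.eq_dec i (S k)); [lia|reflexivity].
Qed.

Lemma is_poly_weaken k g : is_poly k g -> is_poly (S k) g.
Proof.
intros H. apply is_poly_lead. exists 0, g; split; auto. intros; ring.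
Qed.

Lemma is_poly_le k l g : (k <= l)%nat -> is_poly k g -> is_poly l g.
Proof. induction 1; auto. intros; apply is_poly_weaken; auto. Qed.

Lemma is_poly_0 g : is_poly 0 g -> forall x y, g x = g y.
Proof. intros [c Hc] x y; rewrite !Hc, !sum_O; simpl; ring. Qed.

Lemma is_poly_mulX k g : is_poly k g -> is_poly (S k) (fun x => x * g x).
Proof. intros H; apply is_poly_S; exists 0, g; split; auto. intros; ring. Qed.

Lemma is_poly_pow k : is_poly k (fun x => x ^ k).
Proof.
induction k as [|k IH]; simpl; [apply is_poly_const|]. now apply (is_poly_mulX k (fun x => x ^ k)).
Qed.

Lemma is_poly_mul k l g h : is_poly k g -> is_poly l h -> is_poly (k + l) (fun x => g x * h x).
Proof.
revert g; induction k as [|k IH]; intros g Hg Hh.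
- apply (is_poly_ext _ (fun x => g 0 * h x)).
  + intros x; rewrite (is_poly_0 g Hg x 0); ring.
  + now apply is_poly_scal.
- destruct (proj1 (is_poly_S _ _) Hg) as [c [g1 [Hg1 E]]].
  apply (is_poly_ext _ (fun x => c * h x + x * (g1 x * h x))).
  + intros x; rewrite E; ring.
  + apply is_poly_plus.
    * apply is_poly_scal, (is_poly_le l); [lia|auto].
    * now apply (is_poly_mulX (k + l) (fun x => g1 x * h x)), IH.
Qed.

Lemma is_poly_affine k g c d : is_poly k g -> is_poly k (fun s => g (c + d * s)).
Proof.
revert g; induction k as [|k IH]; intros g Hg.
- apply (is_poly_ext _ (fun _ => g 0)); [|apply is_poly_const].
  intros x; apply (is_poly_0 g Hg).
- destruct (proj1 (is_poly_S _ _) Hg) as [e [g1 [Hg1 E]]].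
  apply (is_poly_ext _ (fun s => e + (c * g1 (c + d * s) + s * (d * g1 (c + d * s))))).
  + intros x; rewrite E; ring.
  + apply (is_poly_plus (S k) (fun _ => e)); [apply is_poly_const|].
    apply (is_poly_plus (S k) (fun s => c * g1 (c + d * s))).
    * apply (is_poly_weaken k), is_poly_scal, IH, Hg1.
    * apply (is_poly_mulX k (fun s => d * g1 (c + d * s))), is_poly_scal, IH, Hg1.
Qed.

Lemma is_poly_derive k g : is_poly k g ->
  (forall x, ex_derive g x) /\ is_poly (pred k) (Derive g).
Proof.
revert g; induction k as [|k IH]; intros g Hg.
- assert (E : forall x, is_derive g x 0).
  { intros x. apply (is_derive_ext (fun _ => g 0)); [intros; apply (is_poly_0 g Hg)|].
    apply (is_derive_const (g 0)). }
  split; [intros x; exists 0; apply E|].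
  apply (is_poly_ext _ (fun _ => 0)); [|apply is_poly_const].
  intros x; symmetry; apply is_derive_unique, E.
- destruct (proj1 (is_poly_S _ _) Hg) as [e [g1 [Hg1 E]]].
  destruct (IH g1 Hg1) as [D1 P1].
  assert (HD : forall x, is_derive g x (g1 x + x * Derive g1 x)).
  { intros x. apply (is_derive_ext (fun x => e + x * g1 x)); [intros; now rewrite E|].
    auto_derive; [apply D1|]. change (Derive (fun x0 : R => g1 x0) x) with (Derive g1 x). ring. }
  split; [intros x; eexists; apply HD|]. simpl.
  apply (is_poly_ext _ (fun x => g1 x + x * Derive g1 x)).
  + intros x; symmetry; apply is_derive_unique, HD.
  + apply is_poly_plus; auto. destruct k as [|k].
    * apply (is_poly_ext _ (fun _ => 0)); [|apply is_poly_const].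
      intros x. replace (Derive g1 x) with 0; [ring|].
      symmetry; apply is_derive_unique. apply (is_derive_ext (fun _ => g1 0)).
      { intros; apply (is_poly_0 g1 Hg1). }
      apply (is_derive_const (g1 0)).
    * apply (is_poly_mulX k (Derive g1)), P1.
Qed.

Lemma is_poly_ex_derive k g x : is_poly k g -> ex_derive g x.
Proof. intros H; apply (is_poly_derive k g H). Qed.
Lemma is_poly_cont k g : is_poly k g -> cont g.
Proof. intros H; apply cont_ex_derive; intros; now apply (is_poly_ex_derive k). Qed.
Lemma is_poly_Derive k g : is_poly k g -> is_poly k (Derive g).
Proof. intros H; apply (is_poly_le (pred k)); [lia|]. now apply is_poly_derive. Qed.
Lemma is_poly_cont_Derive k g : is_poly k g -> cont (Derive g).
Proof. intros H; apply (is_poly_cont k), is_poly_Derive, H. Qed.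

Lemma is_poly_primitive k g : is_poly k g ->
  exists G, is_poly (S k) G /\ forall x, is_derive G x (g x).
Proof.
revert g; induction k as [|k IH]; intros g Hg.
- exists (fun x => x * g 0). split.
  + apply (is_poly_mulX 0 (fun _ => g 0)), is_poly_const.
  + intros x. rewrite (is_poly_0 g Hg x 0). auto_derive; auto. ring.
- destruct (proj1 (is_poly_lead _ _) Hg) as [c [g1 [Hg1 E]]].
  destruct (IH g1 Hg1) as [G1 [P1 D1]].
  exists (fun x => G1 x + c / INR (S (S k)) * x ^ S (S k)). split.
  + apply is_poly_plus; [now apply is_poly_weaken|]. apply is_poly_scal, is_poly_pow.
  + intros x. rewrite E. apply (is_derive_plus G1); [apply D1|].
    assert (INR (S (S k)) <> 0) by (apply not_0_INR; lia).
    apply (is_derive_ext (fun x => c / INR (S (S k)) * x ^ S (S k))); [auto|].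
    evar_last. { apply is_derive_scal. apply is_derive_pow, is_derive_id. }
    unfold one; simpl pred; simpl. unfold one; simpl.
    change (match k with O => 1 | S _ => INR k + 1 end + 1) with (INR (S (S k))).
    field; auto.
Qed.

(** A polynomial vanishing on an interval vanishes everywhere: it vanishes at 0 by
    continuity, so x can be factored out. *)
Lemma is_poly_vanish k g : is_poly k g -> (forall x, 0 < x < 1 -> g x = 0) ->
  forall x, g x = 0.
Proof.
revert g; induction k as [|k IH]; intros g Hg H x.
- rewrite (is_poly_0 g Hg x (/ 2)). apply H; lra.
- assert (Hlim0 : forall h, cont h -> (forall x, 0 < x < 1 -> h x = 0) -> h 0 = 0).
  { intros h Hh H0. destruct (Req_dec (h 0) 0) as [|Hne]; auto. exfalso.
    destruct (cont_locally_close h 0 (Rabs (h 0)) Hh (Rabs_pos_lt _ Hne)) as [d [Hd Hc]].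
    pose (y := Rmin (d / 2) (/ 2)).
    assert (0 < y) by (apply Rmin_glb_lt; lra).
    assert (y <= d / 2) by apply Rmin_l. assert (y <= / 2) by apply Rmin_r.
    assert (H4 := Hc y ltac:(rewrite Rminus_0_r, Rabs_pos_eq; lra)).
    rewrite H0 in H4 by lra. rewrite Rminus_0_l, Rabs_Ropp in H4. lra. }
  assert (Hg0 := Hlim0 g (is_poly_cont _ _ Hg) H).
  destruct (proj1 (is_poly_S _ _) Hg) as [c [g1 [Hg1 E]]].
  assert (c = 0) by (rewrite E in Hg0; lra). subst c.
  rewrite E, (IH g1 Hg1); [ring|]. intros y Hy.
  assert (H1 := H y Hy). rewrite E in H1.
  assert (H2 : y * g1 y = 0) by lra. apply Rmult_integral in H2. lra.
Qed.

(** The quotient of g(x) - g(e) by x - e is built along Horner's form. *)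
Lemma is_poly_factor k g e : is_poly (S k) g -> g e = 0 ->
  exists r, is_poly k r /\ forall x, g x = (x - e) * r x.
Proof.
assert (H : forall k g, is_poly k g ->
  exists r, is_poly (pred k) r /\ forall x, g x - g e = (x - e) * r x).
{ clear k g. induction k as [|k IH]; intros g Hg.
  - exists (fun _ => 0). split; [apply is_poly_const|]. intros x.
    rewrite (is_poly_0 g Hg x e); ring.
  - destruct (proj1 (is_poly_S _ _) Hg) as [c [g1 [Hg1 E]]].
    destruct (IH g1 Hg1) as [r1 [P1 E1]]. simpl.
    exists (fun x => g1 x + e * r1 x). split.
    + apply is_poly_plus; auto. apply is_poly_scal, (is_poly_le (pred k)); [lia|auto].
    + intros x. rewrite !E. replace (c + x * g1 x - (c + e * g1 e))
        with ((x - e) * g1 x + e * (g1 x - g1 e)) by ring.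
      rewrite E1; ring. }
intros Hg He. destruct (H _ _ Hg) as [r [P E]]. exists r; split; auto.
intros x. rewrite <- E, He; ring.
Qed.

Fixpoint nodal (k : nat) (x : R) : R :=
  match k with O => 1 | S k' => nodal k' x * (x - INR k') end.

Lemma nodal_poly k : is_poly k (fun x => nodal (S k) x - x ^ S k) /\ is_poly (S k) (nodal (S k)).
Proof.
assert (H : is_poly k (fun x => nodal (S k) x - x ^ S k)).
{ induction k as [|k IH].
  - apply (is_poly_ext _ (fun _ => 0)); [intros; simpl; ring|apply is_poly_const].
  - apply (is_poly_ext _ (fun x => (nodal (S k) x - x ^ S k) * (x - INR (S k))
                                   - INR (S k) * x ^ S k)).
    + intros x. change (nodal (S (S k)) x) with (nodal (S k) x * (x - INR (S k))).
      change (x ^ S (S k)) with (x * x ^ S k). ring.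
    + apply is_poly_minus.
      * replace (S k) with (k + 1)%nat at 1 by lia.
        apply (is_poly_mul k 1 (fun x => nodal (S k) x - x ^ S k) (fun x => x - INR (S k))); auto.
        apply (is_poly_minus 1 (fun x => x)); [|apply is_poly_const].
        apply (is_poly_ext _ (fun x => x ^ 1)); [intros; simpl; ring|apply is_poly_pow].
      * apply is_poly_scal, (is_poly_pow (S k)). }
split; auto.
apply (is_poly_ext _ (fun x => (nodal (S k) x - x ^ S k) + x ^ S k)); [intros; ring|].
apply is_poly_plus; [now apply is_poly_weaken|apply is_poly_pow].
Qed.

Lemma nodal_root k l : (l < k)%nat -> nodal k (INR l) = 0.
Proof.
induction k as [|k IH]; intros H; [lia|simpl].
destruct (Nat.eq_dec l k) as [->|Hne]; [ring|]. rewrite IH by lia; ring.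
Qed.

Lemma nodal_nonroot k l : (k <= l)%nat -> nodal k (INR l) <> 0.
Proof.
induction k as [|k IH]; intros H; simpl; [lra|].
apply Rmult_integral_contrapositive_currified; [apply IH; lia|].
assert (INR k < INR l) by (apply lt_INR; lia). lra.
Qed.

(** Lagrange interpolation at 0, 1, ..., k: the values at finitely many points
    determine a polynomial linearly, so a polynomial in x that is differentiable
    in t at every x has a polynomial time derivative. *)
Lemma lagrange k : exists l : nat -> R -> R,
  (forall i, (i <= k)%nat -> is_poly k (l i)) /\
  forall g, is_poly k g -> forall x, g x = bigsum (S k) (fun i => g (INR i) * l i x).
Proof.
induction k as [|k [l [Pl El]]].
- exists (fun _ _ => 1). split; [intros; apply is_poly_const|].
  intros g Hg x. simpl. rewrite (is_poly_0 g Hg x 0); ring.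
- destruct (nodal_poly k) as [Pd Pn]. set (e := nodal (S k)) in *.
  assert (He0 : forall i, (i <= k)%nat -> e (INR i) = 0) by (intros; apply nodal_root; lia).
  assert (He1 : e (INR (S k)) <> 0) by (apply nodal_nonroot; lia).
  set (E := e (INR (S k))) in *.
  exists (fun i x => if Nat.eq_dec i (S k) then e x / E
                     else l i x - l i (INR (S k)) / E * e x).
  split.
  + intros i Hi. destruct (Nat.eq_dec i (S k)) as [_|Hne].
    * apply (is_poly_ext _ (fun x => / E * e x)); [intros; unfold Rdiv; ring|].
      now apply is_poly_scal.
    * apply is_poly_minus; [apply is_poly_weaken, Pl; lia|now apply is_poly_scal].
  + intros g Hg x. destruct (proj1 (is_poly_lead _ _) Hg) as [c [g1 [Hg1 E1]]].
    assert (Hr : is_poly k (fun x => g x - c * e x)).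
    { apply (is_poly_ext _ (fun x => g1 x + (- c) * (e x - x ^ S k))).
      - intros y; rewrite E1; ring.
      - apply is_poly_plus; auto. apply (is_poly_scal k (-c) (fun x => e x - x ^ S k)); auto. }
    assert (Er := El _ Hr). cbv beta in Er.
    assert (Er' : forall y, g y - c * e y = bigsum (S k) (fun i => g (INR i) * l i y)).
    { intros y. rewrite Er. apply bigsum_ext. intros i Hi. rewrite He0 by lia. ring. }
    assert (Hc := Er' (INR (S k))). fold E in Hc.
    rewrite <- (Rplus_0_r (g x)), <- (Rminus_diag_eq (c * e x) (c * e x) eq_refl).
    replace (g x + (c * e x - c * e x)) with ((g x - c * e x) + c * e x) by ring.
    rewrite Er', (bigsum_S (S k)).
    destruct (Nat.eq_dec (S k) (S k)) as [_|]; [|lia].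
    replace c with ((g (INR (S k)) - bigsum (S k) (fun i => g (INR i) * l i (INR (S k)))) / E)
      by (rewrite <- Hc; field; auto).
    transitivity (bigsum (S k) (fun i => g (INR i) * l i x
       - (e x / E) * (g (INR i) * l i (INR (S k)))) + g (INR (S k)) * (e x / E)).
    * rewrite bigsum_minus, bigsum_scal. field; auto.
    * f_equal. apply bigsum_ext. intros i Hi.
      destruct (Nat.eq_dec i (S k)); [lia|]. field; auto.
Qed.

(** Linear independence of the monomials. *)
Lemma pow_not_poly k : ~ is_poly k (fun x => x ^ S k).
Proof.
induction k as [|k IH]; intros H.
- assert (H1 := is_poly_0 _ H 0 1). simpl in H1; lra.
- destruct (proj1 (is_poly_S _ _) H) as [c [g1 [Hg1 E]]].
  assert (c = 0) by (specialize (E 0); simpl in E; lra). subst c.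
  apply IH. apply (is_poly_ext _ g1); auto.
  assert (Hd : is_poly (S k) (fun x => g1 x - x ^ S k)).
  { apply is_poly_minus; [now apply is_poly_weaken|apply is_poly_pow]. }
  intros x. assert (H0 := is_poly_vanish _ _ Hd). simpl in H0.
  enough (g1 x - x * x ^ k = 0) by (simpl; lra).
  apply H0. intros y Hy. specialize (E y). simpl in E.
  apply (Rmult_eq_reg_l y); lra.
Qed.

Lemma cont_bounded g c d : c <= d -> cont g ->
  exists M, 0 <= M /\ forall x, c <= x <= d -> Rabs (g x) <= M.
Proof.
intros Hcd Hg.
destruct (continuity_ab_maj (fun x => Rabs (g x)) c d Hcd) as [x0 [H0 _]].
{ intros x _. apply continuity_pt_filterlim. apply (cont_abs g Hg). }
exists (Rabs (g x0)); split; [apply Rabs_pos|auto].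
Qed.

Definition delta (i j : nat) : R := if Nat.eq_dec i j then 1 else 0.

Lemma delta_eq i : delta i i = 1.
Proof. unfold delta; destruct (Nat.eq_dec i i); [reflexivity|lia]. Qed.
Lemma delta_ne i j : i <> j -> delta i j = 0.
Proof. unfold delta; destruct (Nat.eq_dec i j); [lia|reflexivity]. Qed.

Definition ip01 (g h : R -> R) : R := RInt (fun x => g x * h x) 0 1.

Lemma ip01_sym g h : ip01 g h = ip01 h g.
Proof. apply RInt_ext_R; intros; ring. Qed.
Lemma ip01_ext g g' h : (forall x, g x = g' x) -> ip01 g h = ip01 g' h.
Proof. intros E; apply RInt_ext_R; intros; rewrite E; ring. Qed.
Lemma ip01_plus g g' h : cont g -> cont g' -> cont h ->
  ip01 (fun x => g x + g' x) h = ip01 g h + ip01 g' h.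
Proof.
intros. unfold ip01. rewrite <- RInt_plus_cont by cont_tac.
apply RInt_ext_R; intros; ring.
Qed.
Lemma ip01_scal l g h : cont g -> cont h -> ip01 (fun x => l * g x) h = l * ip01 g h.
Proof.
intros. unfold ip01. rewrite <- RInt_scal_cont by cont_tac.
apply RInt_ext_R; intros; ring.
Qed.
Lemma ip01_minus g g' h : cont g -> cont g' -> cont h ->
  ip01 (fun x => g x - g' x) h = ip01 g h - ip01 g' h.
Proof.
intros. unfold ip01. rewrite <- RInt_minus_cont by cont_tac.
apply RInt_ext_R; intros; ring.
Qed.
Lemma ip01_bigsum n (F : nat -> R -> R) h : (forall i, (i < n)%nat -> cont (F i)) -> cont h ->
  ip01 (fun x => bigsum n (fun i => F i x)) h = bigsum n (fun i => ip01 (F i) h).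
Proof.
intros HF Hh. unfold ip01.
rewrite <- (RInt_bigsum n (fun i x => F i x * h x)).
- apply RInt_ext_R; intros; apply bigsum_mulr.
- intros i Hi. specialize (HF i Hi). cont_tac.
Qed.

(** Gram-Schmidt on the monomials; the phi i are the normalised Legendre polynomials
    of the unit interval. A monomial minus its projection on lower degrees has positive
    norm because the monomials are independent. *)
Lemma orthonormal_basis k : exists phi : nat -> R -> R,
  (forall i, (i <= k)%nat -> is_poly i (phi i)) /\
  (forall i j, (i <= k)%nat -> (j <= k)%nat -> ip01 (phi i) (phi j) = delta i j) /\
  (forall n g, (n <= k)%nat -> is_poly n g ->
     forall x, g x = bigsum (S n) (fun i => ip01 g (phi i) * phi i x)).
Proof.
induction k as [|k [phi [P1 [O1 E1]]]].
- exists (fun _ _ => 1). split; [intros; apply is_poly_const|split].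
  + intros i j Hi Hj. replace i with 0%nat by lia. replace j with 0%nat by lia.
    unfold ip01. rewrite RInt_const_R. rewrite delta_eq; ring.
  + intros n g Hn Hg x. replace n with 0%nat in * by lia. simpl.
    rewrite (ip01_ext g (fun _ => g x)) by (intros; apply (is_poly_0 g Hg)).
    unfold ip01. rewrite RInt_const_R; ring.
- set (X := fun x : R => x ^ S k).
  assert (CX : cont X) by apply (is_poly_cont (S k) _ (is_poly_pow (S k))).
  assert (Cphi : forall i, (i <= k)%nat -> cont (phi i))
    by (intros; apply (is_poly_cont i); auto).
  set (pr := fun x => bigsum (S k) (fun i => ip01 X (phi i) * phi i x)).
  assert (Ppr : is_poly k pr).
  { apply (is_poly_bigsum k (S k) (fun i x => ip01 X (phi i) * phi i x)).
    intros i Hi. apply is_poly_scal, (is_poly_le i); [lia|apply P1; lia]. }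
  assert (Cpr := is_poly_cont _ _ Ppr).
  set (m := fun x => X x - pr x).
  assert (Pm : is_poly (S k) m).
  { apply is_poly_minus; [apply is_poly_pow|now apply is_poly_weaken]. }
  assert (Cm := is_poly_cont _ _ Pm).
  assert (Om : forall j, (j <= k)%nat -> ip01 m (phi j) = 0).
  { intros j Hj. unfold m. rewrite ip01_minus by auto. unfold pr.
    rewrite (ip01_bigsum (S k) (fun i x => ip01 X (phi i) * phi i x)).
    - rewrite (bigsum_single _ _ j) by (try lia; intros i Hi Hne;
        rewrite ip01_scal by (apply Cphi; lia); rewrite O1 by lia;
        rewrite delta_ne by auto; ring).
      rewrite ip01_scal by (apply Cphi; lia). rewrite O1 by lia. rewrite delta_eq. ring.
    - intros i Hi. assert (cont (phi i)) by (apply Cphi; lia). cont_tac.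
    - apply Cphi; lia. }
  assert (Hn : 0 < ip01 m m).
  { assert (H0 : forall x, 0 < x < 1 -> 0 <= m x * m x).
    { intros; apply Rle_0_sqr. }
    assert (0 <= ip01 m m) by (apply RInt_nonneg_cont; auto; [lra|cont_tac]).
    destruct (Req_dec (ip01 m m) 0) as [Hz|]; [exfalso|lra].
    assert (Hz' := RInt_zero_nonneg (fun x => m x * m x) 0 1 ltac:(lra) ltac:(cont_tac) H0 Hz).
    assert (Hm0 := is_poly_vanish _ _ Pm). 
    apply (pow_not_poly k), (is_poly_ext _ pr); auto. intros x.
    enough (m x = 0) by (unfold m, X in *; lra).
    apply Hm0. intros y Hy. specialize (Hz' y Hy). simpl in Hz'. nra. }
  set (nu := sqrt (ip01 m m)).
  assert (Hnu : 0 < nu) by now apply sqrt_lt_R0.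
  assert (Hnu2 : nu * nu = ip01 m m) by (apply sqrt_sqrt; lra).
  set (q := fun x => / nu * m x).
  assert (Pq : is_poly (S k) q) by now apply is_poly_scal.
  assert (Cq := is_poly_cont _ _ Pq).
  assert (Oq : forall j, (j <= k)%nat -> ip01 q (phi j) = 0).
  { intros j Hj. unfold q. rewrite ip01_scal by auto. rewrite Om by auto; ring. }
  assert (Nq : ip01 q q = 1).
  { unfold q at 1. rewrite ip01_scal by auto. rewrite ip01_sym. unfold q.
    rewrite ip01_scal by auto. rewrite <- Hnu2. field; lra. }
  exists (fun i => if Nat.eq_dec i (S k) then q else phi i).
  split; [|split].
  + intros i Hi. destruct (Nat.eq_dec i (S k)) as [->|]; auto. apply P1; lia.
  + intros i j Hi Hj.
    destruct (Nat.eq_dec i (S k)) as [->|]; destruct (Nat.eq_dec j (S k)) as [->|].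
    * rewrite delta_eq; auto.
    * rewrite delta_ne by auto. apply Oq; lia.
    * rewrite delta_ne by auto. rewrite ip01_sym; apply Oq; lia.
    * apply O1; lia.
  + intros n g Hnk Hg x.
    destruct (Nat.eq_dec n (S k)) as [->|Hne].
    * destruct (proj1 (is_poly_lead _ _) Hg) as [c [g1 [Hg1 Eg]]].
      set (r := fun x => g1 x + c * pr x).
      assert (Pr : is_poly k r) by (apply is_poly_plus; auto; now apply is_poly_scal).
      assert (Cr := is_poly_cont _ _ Pr).
      assert (Egr : forall y, g y = r y + (c * nu) * q y).
      { intros y. rewrite Eg. unfold r, q, m, X. field; lra. }
      assert (Hi : forall i, (i <= k)%nat -> ip01 g (phi i) = ip01 r (phi i)).
      { intros i Hi. rewrite (ip01_ext g _ _ Egr), ip01_plus, ip01_scal by (auto; cont_tac).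
        rewrite Oq by auto; ring. }
      assert (Hrq : ip01 r q = 0).
      { rewrite (ip01_ext r _ _ (E1 k r ltac:(lia) Pr)).
        rewrite (ip01_bigsum (S k) (fun i x => ip01 r (phi i) * phi i x)).
        - apply bigsum_zero. intros i Hi0. rewrite ip01_scal by (auto; apply Cphi; lia).
          rewrite (ip01_sym (phi i)), Oq by lia. ring.
        - intros i Hi0. assert (cont (phi i)) by (apply Cphi; lia). cont_tac.
        - auto. }
      assert (Hq : ip01 g q = c * nu).
      { rewrite (ip01_ext g _ _ Egr), ip01_plus, ip01_scal by (auto; cont_tac).
        rewrite Hrq, Nq; ring. }
      change (bigsum (S (S k)) ?F) with (bigsum (S k) F + F (S k)). cbv beta.
      destruct (Nat.eq_dec (S k) (S k)) as [_|]; [|lia].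
      rewrite Hq, Egr, (E1 k r ltac:(lia) Pr). f_equal.
      apply bigsum_ext. intros i Hi0.
      destruct (Nat.eq_dec i (S k)); [lia|]. rewrite Hi by lia. reflexivity.
    * rewrite (E1 n g ltac:(lia) Hg). apply bigsum_ext. intros i Hi.
      destruct (Nat.eq_dec i (S k)); [lia|reflexivity].
Qed.

Lemma sqr_le_of_abs x y : Rabs x <= y -> x ^ 2 <= y ^ 2.
Proof. intros H. rewrite <- (pow2_abs x). apply pow_incr; split; [apply Rabs_pos|auto]. Qed.

(** All norms on the finite-dimensional space of polynomials are equivalent;
    the constant is read off from the orthonormal basis. *)
Lemma inverse_unit k : exists C, 0 < C /\ forall g s, is_poly k g -> 0 <= s <= 1 ->
  g s ^ 2 <= C * RInt (fun x => g x ^ 2) 0 1 /\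
  Derive g s ^ 2 <= C * RInt (fun x => g x ^ 2) 0 1.
Proof.
destruct (orthonormal_basis k) as [phi [P1 [O1 E1]]].
assert (Cphi : forall i, (i <= k)%nat -> cont (phi i))
  by (intros; apply (is_poly_cont i); auto).
assert (Hbd : forall n, (n <= S k)%nat -> exists M, 0 <= M /\ forall i s, (i < n)%nat -> 0 <= s <= 1 ->
   Rabs (phi i s) <= M /\ Rabs (Derive (phi i) s) <= M).
{ induction n as [|n IH]; intros Hn; [exists 0; split; [lra|intros; lia]|].
  destruct (IH ltac:(lia)) as [M [HM H]].
  destruct (cont_bounded (phi n) 0 1 ltac:(lra) (Cphi n ltac:(lia))) as [M1 [HM1 H1]].
  destruct (cont_bounded (Derive (phi n)) 0 1 ltac:(lra)
    (is_poly_cont_Derive n _ (P1 n ltac:(lia)))) as [M2 [HM2 H2]].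
  exists (M + M1 + M2). split; [lra|]. intros i s Hi Hs.
  destruct (Nat.eq_dec i n) as [->|].
  - specialize (H1 s Hs). specialize (H2 s Hs). lra.
  - destruct (H i s ltac:(lia) Hs); lra. }
destruct (Hbd (S k) ltac:(lia)) as [M [HM H]].
assert (HS : 0 < INR (S k)) by (apply lt_0_INR; lia).
exists ((INR (S k) * M) ^ 2 + 1). split; [assert (H0 := pow2_ge_0 (INR (S k) * M)); lra|].
intros g s Hg Hs. assert (Cg := is_poly_cont _ _ Hg).
set (I := RInt (fun x => g x ^ 2) 0 1).
assert (Eg := E1 k g ltac:(lia) Hg).
assert (HI0 : 0 <= I).
{ apply RInt_nonneg_cont; [lra|cont_tac|intros; apply pow2_ge_0]. }
assert (EI : I = bigsum (S k) (fun i => ip01 g (phi i) * ip01 g (phi i))).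
{ transitivity (ip01 g g); [apply RInt_ext_R; intros; ring|].
  rewrite (ip01_ext g _ g Eg) at 1.
  rewrite (ip01_bigsum (S k) (fun i x => ip01 g (phi i) * phi i x)).
  - apply bigsum_ext; intros i Hi. rewrite ip01_scal by (auto; apply Cphi; lia).
    rewrite (ip01_sym (phi i)). ring.
  - intros i Hi. assert (cont (phi i)) by (apply Cphi; lia). cont_tac.
  - auto. }
assert (Hc : forall i, (i < S k)%nat -> Rabs (ip01 g (phi i)) <= sqrt I).
{ intros i Hi. rewrite <- sqrt_Rsqr_abs. apply sqrt_le_1_alt. rewrite EI.
  apply (bigsum_term_le (S k) (fun i => ip01 g (phi i) * ip01 g (phi i))); auto.
  intros; apply Rle_0_sqr. }
assert (Hgen : forall (psi : nat -> R), (forall i, (i < S k)%nat -> Rabs (psi i) <= M) ->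
  (bigsum (S k) (fun i => ip01 g (phi i) * psi i)) ^ 2 <= ((INR (S k) * M) ^ 2 + 1) * I).
{ intros psi Hpsi.
  apply Rle_trans with ((INR (S k) * (sqrt I * M)) ^ 2).
  - apply sqr_le_of_abs. rewrite <- bigsum_const.
    eapply Rle_trans; [apply bigsum_Abs|apply bigsum_le]. intros i Hi.
    rewrite Rabs_mult. apply Rmult_le_compat; auto using Rabs_pos.
  - replace ((INR (S k) * (sqrt I * M)) ^ 2) with ((INR (S k) * M) ^ 2 * (sqrt I * sqrt I)) by ring.
    rewrite sqrt_sqrt by auto. lra. }
split.
- rewrite Eg. apply Hgen. intros i Hi. now apply H.
- replace (Derive g s) with (bigsum (S k) (fun i => ip01 g (phi i) * Derive (phi i) s)).
  + apply Hgen. intros i Hi. now apply H.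
  + symmetry. apply is_derive_unique.
    apply (is_derive_ext (fun x => bigsum (S k) (fun i => ip01 g (phi i) * phi i x)));
      [intros; symmetry; apply Eg|].
    apply (is_derive_bigsum (S k) (fun i x => ip01 g (phi i) * phi i x)).
    intros i Hi. apply is_derive_scal, Derive_correct, (is_poly_ex_derive i), P1; lia.
Qed.

Lemma Derive_affine g c d s : (forall x, ex_derive g x) ->
  Derive (fun s => g (c + d * s)) s = d * Derive g (c + d * s).
Proof.
intros H. apply is_derive_unique.
apply (is_derive_comp g (fun s => c + d * s)).
- apply Derive_correct, H.
- auto_derive; auto. ring.
Qed.

(** Scaling to the unit interval yields the powers of the cell size. *)
Lemma inverse_cell k : exists C, 0 < C /\ forall c d g x, c < d -> is_poly k g ->
  c <= x <= d ->
  (d - c) * g x ^ 2 <= C * RInt (fun x => g x ^ 2) c d /\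
  (d - c) ^ 3 * Derive g x ^ 2 <= C * RInt (fun x => g x ^ 2) c d.
Proof.
destruct (inverse_unit k) as [C [HC H]]. exists C; split; auto.
intros c d g x Hcd Hg Hx. assert (Cg := is_poly_cont _ _ Hg).
set (s := (x - c) / (d - c)).
assert (Hs : 0 <= s <= 1).
{ unfold s; split; [apply Rdiv_le_0_compat; lra|]. apply -> Rdiv_le_1; lra. }
assert (Ex : c + (d - c) * s = x) by (unfold s; field; lra).
destruct (H (fun s => g (c + (d - c) * s)) s (is_poly_affine k g _ _ Hg) Hs) as [H1 H2].
rewrite Derive_affine in H2 by (intros; now apply (is_poly_ex_derive k)).
rewrite Ex in H1, H2.
rewrite (RInt_rescale (fun x => g x ^ 2)) by cont_tac.
set (I := RInt _ 0 1) in *.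
assert (Hd : 0 < d - c) by lra.
split.
- replace (C * ((d - c) * I)) with ((d - c) * (C * I)) by ring.
  apply Rmult_le_compat_l; lra.
- replace ((d - c) ^ 3 * Derive g x ^ 2) with ((d - c) * ((d - c) * Derive g x) ^ 2) by ring.
  replace (C * ((d - c) * I)) with ((d - c) * (C * I)) by ring.
  apply Rmult_le_compat_l; lra.
Qed.

(** * Gauss-Radau projection *)

Fixpoint smooth (r : nat) (g : R -> R) : Prop :=
  match r with
  | O => cont g
  | S r' => (forall x, ex_derive g x) /\ smooth r' (Derive g)
  end.

Lemma smooth_cont r g : smooth r g -> cont g.
Proof. destruct r; simpl; auto. intros [H _]; now apply cont_ex_derive. Qed.

Lemma Derive_n_shift g n x : Derive_n g (S n) x = Derive_n (Derive g) n x.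
Proof.
rewrite <- Nat.add_1_r, <- Derive_n_comp. reflexivity.
Qed.

Lemma smooth_Derive_n r g : smooth r g -> cont (Derive_n g r).
Proof.
revert g; induction r as [|r IH]; intros g H; [exact H|].
destruct H as [_ H]. apply (cont_ext (Derive_n (Derive g) r)); auto.
intros; symmetry; apply Derive_n_shift.
Qed.

Lemma mean_value_bound g dg M x y :
  (forall z, is_derive g z (dg z)) -> (forall z, Rmin x y <= z <= Rmax x y -> Rabs (dg z) <= M) ->
  Rabs (g y - g x) <= M * Rabs (y - x).
Proof.
intros Hd HM. destruct (MVT_gen g x y dg) as [z [Hz E]]; auto.
- intros z _. apply derivable_continuous_pt. exists (dg z). apply is_derive_Reals, Hd.
- rewrite E, Rabs_mult. apply Rmult_le_compat_r; [apply Rabs_pos|auto].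
Qed.

(** The polynomial for g is a primitive of the one for g', so each step gains a factor
    d - c. The remainder is measured in L1 of the last derivative, since that derivative
    is only controlled in L2. *)
Lemma taylor_approx k g c d : c < d -> smooth (S k) g ->
  exists tau, is_poly k tau /\ forall x, c <= x <= d ->
    Rabs (g x - tau x) <= (d - c) ^ k * RInt (fun y => Rabs (Derive_n g (S k) y)) c d.
Proof.
intros Hcd. revert g; induction k as [|k IH]; intros g Hg.
- exists (fun _ => g c). split; [apply is_poly_const|]. intros x Hx.
  destruct Hg as [D1 C1]. simpl in C1.
  rewrite <- (RInt_Derive_cont g c x D1 C1).
  assert (CA : cont (fun y => Rabs (Derive g y))) by now apply cont_abs.
  eapply Rle_trans; [apply (RInt_Abs_cont _ (fun y => Rabs (Derive g y))); auto; [lra|intros; lra]|].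
  assert (H := RInt_Chasles_cont (fun y => Rabs (Derive g y)) c x d CA).
  assert (H0 : 0 <= RInt (fun y => Rabs (Derive g y)) x d).
  { apply RInt_nonneg_cont; auto; [lra|intros; apply Rabs_pos]. }
  simpl. change (fun y => Rabs (Derive (fun x => g x) y)) with (fun y => Rabs (Derive g y)). lra.
- destruct Hg as [D1 Hg1]. destruct (IH _ Hg1) as [t1 [P1 A1]].
  destruct (is_poly_primitive k t1 P1) as [t [P0 D0]].
  exists (fun x => (g c - t c) + t x).
  split; [apply is_poly_plus; auto; apply is_poly_const|]. intros x Hx.
  replace (g x - (g c - t c + t x)) with ((g x - t x) - (g c - t c)) by ring.
  set (I := RInt (fun y => Rabs (Derive_n g (S (S k)) y)) c d).
  assert (EI : I = RInt (fun y => Rabs (Derive_n (Derive g) (S k) y)) c d).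
  { apply RInt_ext_R; intros. now rewrite Derive_n_shift. }
  rewrite <- EI in A1.
  apply Rle_trans with (((d - c) ^ k * I) * Rabs (x - c)).
  + apply (mean_value_bound (fun x => g x - t x) (fun x => Derive g x - t1 x)).
    * intros z. apply (is_derive_minus g t); [apply Derive_correct, D1|apply D0].
    * intros z Hz. rewrite Rmin_left, Rmax_right in Hz by lra. apply A1; lra.
  + assert (H1 := A1 c ltac:(lra)). assert (H2 := Rabs_pos (Derive g c - t1 c)).
    rewrite Rabs_pos_eq by lra. simpl.
    replace ((d - c) * (d - c) ^ k * I) with ((d - c) ^ k * I * (d - c)) by ring.
    apply Rmult_le_compat_l; lra.
Qed.

Definition unif_deriv (c d : R) (u : R -> R -> R) (t : R) (g : R -> R) : Prop :=
  forall e, 0 < e -> exists dl, 0 < dl /\ forall s, Rabs (s - t) < dl ->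
  forall x, c <= x <= d -> Rabs (u s x - u t x - (s - t) * g x) <= e * Rabs (s - t).

Definition unif_cont (c d : R) (u : R -> R -> R) (t : R) : Prop :=
  forall e, 0 < e -> exists dl, 0 < dl /\ forall s, Rabs (s - t) < dl ->
  forall x, c <= x <= d -> Rabs (u s x - u t x) <= e.

(** The Gauss-Radau projection P c d g of g on the cell [c,d], through the properties
    that the analysis uses: e = 0 or 1 selects the end at which g is interpolated, and
    matching against degree k - 1 is what makes derivatives of test functions invisible
    to the error. The last two fields express that P is bounded and linear for the
    uniform norm, hence commutes with limits and derivatives in time. *)
Record radau (k : nat) (e C : R) (P : R -> R -> (R -> R) -> R -> R) : Prop := Radau {
  radau_poly : forall c d g, c < d -> cont g -> is_poly k (P c d g);
  radau_end : forall c d g, c < d -> cont g ->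
    P c d g (c + (d - c) * e) = g (c + (d - c) * e);
  radau_orth : forall c d g r, c < d -> cont g -> is_poly (pred k) r ->
    RInt (fun x => (g x - P c d g x) * r x) c d = 0;
  radau_approx : forall c d g x, c < d -> smooth (S k) g -> c <= x <= d ->
    (g x - P c d g x) ^ 2 <=
      C * (d - c) ^ (2 * k + 1) * RInt (fun y => Derive_n g (S k) y ^ 2) c d;
  radau_cont : forall c d u t x, c < d -> (forall s, cont (u s)) ->
    unif_cont c d u t -> continuous (fun s => P c d (u s) x) t;
  radau_deriv : forall c d u t g x, c < d -> (forall s, cont (u s)) -> cont g ->
    unif_deriv c d u t g -> is_derive (fun s => P c d (u s) x) t (P c d g x)
}.

Arguments radau_poly {k e C P}.
Arguments radau_end {k e C P}.
Arguments radau_orth {k e C P}.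
Arguments radau_approx {k e C P}.
Arguments radau_cont {k e C P}.
Arguments radau_deriv {k e C P}.

(** The projection as an integral operator, rescaled from the unit interval. *)
Definition cell_proj (e : R) (rho : R -> R) (kap : R -> R -> R) (c d : R)
    (g : R -> R) (x : R) : R :=
  g (c + (d - c) * e) * rho ((x - c) / (d - c))
  + RInt (fun y => g (c + (d - c) * y) * kap ((x - c) / (d - c)) y) 0 1.

Lemma cell_proj_lin e rho kap c d a b g h x : (forall s, cont (kap s)) -> cont g -> cont h ->
  cell_proj e rho kap c d (fun y => a * g y + b * h y) x
  = a * cell_proj e rho kap c d g x + b * cell_proj e rho kap c d h x.
Proof.
intros Hk Hg Hh. unfold cell_proj. set (s := (x - c) / (d - c)).
assert (C1 : cont (fun y => g (c + (d - c) * y))) by now apply cont_affine.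
assert (C2 : cont (fun y => h (c + (d - c) * y))) by now apply cont_affine.
assert (C3 := Hk s).
rewrite (RInt_ext_R _ (fun y => a * (g (c + (d - c) * y) * kap s y)
                          + b * (h (c + (d - c) * y) * kap s y))) by (intros; ring).
rewrite RInt_plus_cont, !RInt_scal_cont by cont_tac. ring.
Qed.

Lemma cell_proj_bound e rho kap c d Lr Lk g M x :
  0 <= e <= 1 -> c < d -> (forall s, cont (kap s)) -> cont g ->
  Rabs (rho ((x - c) / (d - c))) <= Lr ->
  (forall y, 0 <= y <= 1 -> Rabs (kap ((x - c) / (d - c)) y) <= Lk) ->
  (forall y, c <= y <= d -> Rabs (g y) <= M) ->
  Rabs (cell_proj e rho kap c d g x) <= (Lr + Lk) * M.
Proof.
intros He Hcd Hk Hg Hr Hb HM.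
assert (Hin : forall y, 0 <= y <= 1 -> Rabs (g (c + (d - c) * y)) <= M)
  by (intros y Hy; apply HM; nra).
unfold cell_proj. set (s := (x - c) / (d - c)) in *.
eapply Rle_trans; [apply Rabs_triang|].
assert (C1 : cont (fun y => g (c + (d - c) * y))) by now apply cont_affine.
assert (C3 := Hk s).
assert (H1 : Rabs (g (c + (d - c) * e) * rho s) <= M * Lr).
{ rewrite Rabs_mult. apply Rmult_le_compat; auto using Rabs_pos. }
assert (H2 : Rabs (RInt (fun y => g (c + (d - c) * y) * kap s y) 0 1) <= M * Lk).
{ assert (E := RInt_const_R 0 1 (M * Lk)).
  replace ((1 - 0) * (M * Lk)) with (M * Lk) in E by ring. rewrite <- E.
  apply RInt_Abs_cont; [lra|cont_tac|cont_tac|]. intros y Hy.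
  rewrite Rabs_mult. apply Rmult_le_compat; auto using Rabs_pos.
  - apply Hin; lra.
  - apply Hb; lra. }
lra.
Qed.

(** If the top Legendre polynomial phi vanished at an end e, then phi = (x - e) r with r
    orthogonal to phi, so that (x - e) r^2, of constant sign, would have zero integral. *)
Lemma legendre_endpoint k phi e : e = 0 \/ e = 1 -> is_poly (S k) phi ->
  ip01 phi phi = 1 -> (forall r, is_poly k r -> ip01 phi r = 0) -> phi e <> 0.
Proof.
intros He P N O Hz. destruct (is_poly_factor k phi e P Hz) as [r [Pr Er]].
assert (Cr := is_poly_cont _ _ Pr).
assert (H0 := O r Pr).
rewrite (ip01_ext _ _ _ Er) in H0. unfold ip01 in H0.
assert (Hr : forall x, 0 < x < 1 -> r x = 0).
{ intros x Hx.
  assert (H1 : (if Req_EM_T e 0 then x else 1 - x) * (r x * r x) = 0).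
  { destruct (Req_EM_T e 0) as [->|Hne].
    - apply (RInt_zero_nonneg (fun x => x * (r x * r x)) 0 1); auto; [lra|cont_tac| |].
      + intros y Hy. apply Rmult_le_pos; [lra|apply Rle_0_sqr].
      + eapply eq_trans; [|apply H0]. apply RInt_ext_R; intros; ring.
    - apply (RInt_zero_nonneg (fun x => (1 - x) * (r x * r x)) 0 1); auto; [lra|cont_tac| |].
      + intros y Hy. apply Rmult_le_pos; [lra|apply Rle_0_sqr].
      + eapply eq_trans; [apply (RInt_ext_R _ (fun x => (-1) * ((x - e) * r x * r x)))|].
        * intros. destruct He as [He|He]; [lra|subst; ring].
        * rewrite RInt_scal_cont, H0 by cont_tac. eq_in_R; ring. }
  apply Rmult_integral in H1. destruct H1 as [H1|H1]; [destruct (Req_EM_T e 0); lra|nra]. }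
assert (Hr0 := is_poly_vanish _ _ Pr Hr).
rewrite (ip01_ext phi (fun _ => 0)) in N by (intros; rewrite Er, Hr0; ring).
unfold ip01 in N. rewrite (RInt_ext_R _ (fun _ => 0)), RInt_const_R in N by (intros; ring).
lra.
Qed.

(** The projection keeps the Legendre coefficients of degree below k and chooses the last
    one to match the endpoint value. It reproduces polynomials and is bounded in the uniform
    norm, so its error is that of the Taylor polynomial up to a constant. *)
Lemma radau_exists k e : (1 <= k)%nat -> e = 0 \/ e = 1 -> exists C P, 0 < C /\ radau k e C P.
Proof.
intros Hk He. destruct k as [|k]; [lia|clear Hk].
assert (He01 : 0 <= e <= 1) by (destruct He; subst; lra).
destruct (orthonormal_basis (S k)) as [phi [P1 [O1 E1]]].
assert (Cphi : forall i, (i <= S k)%nat -> cont (phi i))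
  by (intros; apply (is_poly_cont i); auto).
set (top := phi (S k)).
assert (Ctop : cont top) by (apply Cphi; lia).
assert (Otop : forall r, is_poly k r -> ip01 top r = 0).
{ intros r Pr. rewrite ip01_sym. rewrite (ip01_ext r _ _ (E1 k r ltac:(lia) Pr)).
  rewrite (ip01_bigsum (S k) (fun i x => ip01 r (phi i) * phi i x)).
  - apply bigsum_zero. intros i Hi. rewrite ip01_scal by (auto; apply Cphi; lia).
    unfold top. rewrite O1, delta_ne by lia. ring.
  - intros i Hi. assert (cont (phi i)) by (apply Cphi; lia). cont_tac.
  - auto. }
assert (Hnz : top e <> 0).
{ apply (legendre_endpoint k); auto.
  unfold top. rewrite O1, delta_eq by lia. reflexivity. }
set (rho := fun s => top s / top e).
set (kap := fun s y => bigsum (S k) (fun i => phi i y * (phi i s - phi i e * rho s))).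
assert (Prho : is_poly (S k) rho).
{ apply (is_poly_ext _ (fun s => / top e * top s)); [intros; unfold rho; field; auto|].
  apply is_poly_scal, P1; lia. }
assert (Crho := is_poly_cont _ _ Prho).
assert (Ckap : forall s, cont (kap s)).
{ intros s. apply (cont_bigsum (S k) (fun i y => phi i y * (phi i s - phi i e * rho s))).
  intros i Hi. assert (cont (phi i)) by (apply Cphi; lia). cont_tac. }
(* On the unit interval the integral operator is the projection in coefficient form. *)
assert (Eref : forall g s, cont g ->
  RInt (fun y => g y * kap s y) 0 1
  = bigsum (S k) (fun i => ip01 g (phi i) * (phi i s - phi i e * rho s))).
{ intros g s Hg. unfold kap.
  rewrite (RInt_ext_R _ (fun y => bigsum (S k)
     (fun i => (phi i s - phi i e * rho s) * (g y * phi i y)))).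
  - rewrite (RInt_bigsum (S k) (fun i y => (phi i s - phi i e * rho s) * (g y * phi i y))).
    + apply bigsum_ext; intros i Hi. assert (cont (phi i)) by (apply Cphi; lia).
      rewrite RInt_scal_cont by cont_tac. unfold ip01; ring.
    + intros i Hi. assert (cont (phi i)) by (apply Cphi; lia). cont_tac.
  - intros y. rewrite <- bigsum_scal. apply bigsum_ext; intros; ring. }
set (Q := fun (g : R -> R) s => g e * rho s
   + bigsum (S k) (fun i => ip01 g (phi i) * (phi i s - phi i e * rho s))).
assert (PQ : forall g, is_poly (S k) (Q g)).
{ intros g. apply (is_poly_plus (S k) (fun s => g e * rho s)); [now apply is_poly_scal|].
  apply (is_poly_bigsum (S k) (S k) (fun i s => ip01 g (phi i) * (phi i s - phi i e * rho s))).
  intros i Hi. apply is_poly_scal, (is_poly_minus (S k)).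
  - apply (is_poly_le i); [lia|apply P1; lia].
  - now apply is_poly_scal. }
assert (Qsplit : forall g s, Q g s = bigsum (S k) (fun i => ip01 g (phi i) * phi i s)
    + (g e - bigsum (S k) (fun i => ip01 g (phi i) * phi i e)) / top e * top s).
{ intros g s. unfold Q.
  rewrite (bigsum_ext (S k) _ (fun i => ip01 g (phi i) * phi i s
     - rho s * (ip01 g (phi i) * phi i e))) by (intros; ring).
  rewrite bigsum_minus, bigsum_scal. unfold rho. field; auto. }
assert (Qend : forall g, Q g e = g e).
{ intros g. rewrite Qsplit. field; auto. }
assert (Qrep : forall g, is_poly (S k) g -> forall s, Q g s = g s).
{ intros g Hg s. rewrite Qsplit.
  rewrite (E1 (S k) g ltac:(lia) Hg e), (E1 (S k) g ltac:(lia) Hg s) at 1.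
  rewrite !(bigsum_S (S k)). fold top. field; auto. }
assert (Qorth : forall g r, cont g -> is_poly k r -> ip01 (Q g) r = ip01 g r).
{ intros g r Hg Pr. assert (Cr := is_poly_cont _ _ Pr).
  assert (Cs : cont (fun s => bigsum (S k) (fun i => ip01 g (phi i) * phi i s))).
  { apply (cont_bigsum (S k) (fun i s => ip01 g (phi i) * phi i s)).
    intros i Hi. assert (cont (phi i)) by (apply Cphi; lia). cont_tac. }
  rewrite (ip01_ext (Q g) _ _ (Qsplit g)), ip01_plus, (ip01_scal _ top r), (Otop r Pr), Rmult_0_r, Rplus_0_r
    by (auto; cont_tac).
  rewrite (ip01_bigsum (S k) (fun i s => ip01 g (phi i) * phi i s)); auto.
  - rewrite (ip01_sym g r), (ip01_ext r _ _ (E1 k r ltac:(lia) Pr)).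
    rewrite (ip01_bigsum (S k) (fun i s => ip01 r (phi i) * phi i s)); auto.
    + apply bigsum_ext. intros i Hi.
      assert (cont (phi i)) by (apply Cphi; lia).
      rewrite !ip01_scal by auto. rewrite (ip01_sym (phi i) r), (ip01_sym (phi i) g). ring.
    + intros i Hi. assert (cont (phi i)) by (apply Cphi; lia). cont_tac.
  - intros i Hi. assert (cont (phi i)) by (apply Cphi; lia). cont_tac. }
set (P := cell_proj e rho kap).
assert (EP : forall c d g x, c < d -> cont g ->
  P c d g x = Q (fun s => g (c + (d - c) * s)) ((x - c) / (d - c))).
{ intros c d g x Hcd Hg. unfold P, cell_proj. rewrite Eref by now apply cont_affine.
  reflexivity. }
assert (Hkb : forall s, exists L, 0 <= L /\ forall y, 0 <= y <= 1 -> Rabs (kap s y) <= L).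
{ intros s. apply cont_bounded; auto; lra. }
(* A bound of the kernel uniform over the square, from bounds of the basis. *)
destruct (cont_bounded rho 0 1 ltac:(lra) Crho) as [Lr [HLr Hr]].
assert (Hku : exists L, 0 <= L /\ forall s y, 0 <= s <= 1 -> 0 <= y <= 1 -> Rabs (kap s y) <= L).
{ unfold kap. assert (Hgen : forall n, (n <= S k)%nat -> exists L, 0 <= L /\
    forall s y, 0 <= s <= 1 -> 0 <= y <= 1 ->
    Rabs (bigsum n (fun i => phi i y * (phi i s - phi i e * rho s))) <= L).
  { induction n as [|n IH]; intros Hn.
    - exists 0; split; [lra|]. intros; simpl. rewrite Rabs_R0; lra.
    - destruct (IH ltac:(lia)) as [L [HL H]].
      destruct (cont_bounded (phi n) 0 1 ltac:(lra) (Cphi n ltac:(lia))) as [M [HM HMb]].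
      exists (L + M * (M + M * Lr)). split; [nra|]. intros s y Hs Hy. rewrite bigsum_S.
      eapply Rle_trans; [apply Rabs_triang|]. apply Rplus_le_compat; [auto|].
      rewrite Rabs_mult. apply Rmult_le_compat; auto using Rabs_pos.
      unfold Rminus. eapply Rle_trans; [apply Rabs_triang|]. rewrite Rabs_Ropp, Rabs_mult.
      apply Rplus_le_compat; auto. apply Rmult_le_compat; auto using Rabs_pos. }
  apply Hgen; lia. }
destruct Hku as [Lk [HLk Hkk]].
exists ((1 + Lr + Lk) ^ 2), P.
assert (HC : 0 < 1 + Lr + Lk) by lra.
split; [nra|].
assert (Hlip : forall c d x, c < d -> exists L, 0 <= L /\ forall g M, cont g ->
   (forall y, c <= y <= d -> Rabs (g y) <= M) -> Rabs (P c d g x) <= L * M).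
{ intros c d x Hcd. destruct (Hkb ((x - c) / (d - c))) as [L [HL HLb]].
  exists (Rabs (rho ((x - c) / (d - c))) + L).
  split; [assert (H := Rabs_pos (rho ((x - c) / (d - c)))); lra|].
  intros g M Hg HM. apply cell_proj_bound; auto. lra. }
assert (Plin : forall c d a b g h x, cont g -> cont h ->
  P c d (fun y => a * g y + b * h y) x = a * P c d g x + b * P c d h x).
{ intros. now apply cell_proj_lin. }
split.
- intros c d g Hcd Hg.
  apply (is_poly_ext _ (fun x => Q (fun s => g (c + (d - c) * s)) (- c / (d - c) + / (d - c) * x))).
  + intros x. rewrite EP by auto. f_equal. field; lra.
  + apply (is_poly_affine (S k) (Q (fun s => g (c + (d - c) * s)))), PQ.
- intros c d g Hcd Hg. rewrite EP by auto.
  replace ((c + (d - c) * e - c) / (d - c)) with e by (field; lra). apply Qend.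
- intros c d g r Hcd Hg Pr. simpl in Pr.
  assert (Cr := is_poly_cont _ _ Pr).
  assert (CP : cont (P c d g)).
  { apply (cont_ext (fun x => Q (fun s => g (c + (d - c) * s)) (- c / (d - c) + / (d - c) * x))).
    - intros x. rewrite EP by auto. f_equal. field; lra.
    - apply cont_affine, (is_poly_cont (S k)), PQ. }
  rewrite RInt_rescale by cont_tac.
  set (gh := fun s => g (c + (d - c) * s)).
  assert (Cgh : cont gh) by now apply cont_affine.
  set (rh := fun s => r (c + (d - c) * s)).
  assert (Prh : is_poly k rh) by now apply is_poly_affine.
  assert (CQ := is_poly_cont _ _ (PQ gh)).
  assert (Crh := is_poly_cont _ _ Prh).
  assert (H := Qorth gh rh Cgh Prh).
  rewrite (RInt_ext_R _ (fun s => gh s * rh s - Q gh s * rh s)).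
  + rewrite RInt_minus_cont by cont_tac. unfold ip01 in H. rewrite H; eq_in_R; ring.
  + intros s. rewrite EP by auto.
    replace ((c + (d - c) * s - c) / (d - c)) with s by (field; lra).
    unfold gh, rh. ring.
- intros c d g x Hcd Hg Hx. assert (Cg := smooth_cont _ _ Hg).
  destruct (taylor_approx (S k) g c d Hcd Hg) as [tau [Pt At]].
  assert (Ct := is_poly_cont _ _ Pt).
  assert (CD : cont (Derive_n g (S (S k)))) by now apply smooth_Derive_n.
  set (I1 := RInt (fun y => Rabs (Derive_n g (S (S k)) y)) c d) in *.
  set (I2 := RInt (fun y => Derive_n g (S (S k)) y ^ 2) c d).
  set (D := (d - c) ^ S k) in *.
  assert (HI : I1 ^ 2 <= (d - c) * I2).
  { unfold I1, I2. eapply Rle_trans; [apply RInt_sqr_le; [lra|now apply cont_abs]|].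
    apply Req_le. f_equal. apply RInt_ext_R; intros. apply pow2_abs. }
  assert (Hs : 0 <= (x - c) / (d - c) <= 1).
  { split; [apply Rdiv_le_0_compat; lra|]. apply -> Rdiv_le_1; lra. }
  assert (Ptau : P c d tau x = tau x).
  { rewrite EP by auto. rewrite Qrep by now apply is_poly_affine.
    f_equal. field; lra. }
  assert (H1 : Rabs (P c d (fun y => 1 * g y + (-1) * tau y) x) <= (Lr + Lk) * (D * I1)).
  { apply cell_proj_bound; auto; [cont_tac|]. intros y Hy.
    replace (1 * g y + -1 * tau y) with (g y - tau y) by ring. now apply At. }
  rewrite Plin, Ptau in H1 by auto.
  assert (H2 := At x Hx).
  assert (H3 : Rabs (g x - P c d g x) <= (1 + Lr + Lk) * (D * I1)).
  { replace (g x - P c d g x) with ((g x - tau x) + - (1 * P c d g x + -1 * tau x)) by ring.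
    eapply Rle_trans; [apply Rabs_triang|]. rewrite Rabs_Ropp. lra. }
  apply sqr_le_of_abs in H3. eapply Rle_trans; [apply H3|].
  replace ((d - c) ^ (2 * S k + 1)) with (D ^ 2 * (d - c)).
  2:{ unfold D. rewrite <- pow_mult, Nat.mul_comm, pow_add. ring. }
  replace (((1 + Lr + Lk) * (D * I1)) ^ 2) with ((1 + Lr + Lk) ^ 2 * D ^ 2 * I1 ^ 2) by ring.
  replace ((1 + Lr + Lk) ^ 2 * (D ^ 2 * (d - c)) * I2)
    with ((1 + Lr + Lk) ^ 2 * D ^ 2 * ((d - c) * I2)) by ring.
  apply Rmult_le_compat_l; auto. apply Rmult_le_pos; apply pow2_ge_0.
- intros c d u t x Hcd Hu Hc. destruct (Hlip c d x Hcd) as [L [HL HLb]].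
  apply filterlim_locally. intros [eps Heps].
  destruct (Hc (eps / (2 * (L + 1)))) as [dl [Hdl H]]; [apply Rdiv_lt_0_compat; lra|].
  exists (mkposreal dl Hdl). intros s Hs. change (Rabs (s - t) < dl) in Hs.
  change (Rabs (P c d (u s) x - P c d (u t) x) < eps).
  replace (P c d (u s) x - P c d (u t) x) with (1 * P c d (u s) x + -1 * P c d (u t) x) by ring.
  rewrite <- Plin by auto.
  eapply Rle_lt_trans; [apply (HLb _ (eps / (2 * (L + 1))))|].
  + assert (Cs := Hu s). assert (Ct := Hu t). cont_tac.
  + intros y Hy. replace (1 * u s y + -1 * u t y) with (u s y - u t y) by ring. now apply H.
  + apply Rle_lt_trans with ((L + 1) * (eps / (2 * (L + 1)))).
    * apply Rmult_le_compat_r; [|lra]. apply Rlt_le, Rdiv_lt_0_compat; lra.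
    * replace ((L + 1) * (eps / (2 * (L + 1)))) with (eps / 2) by (field; lra). lra.
- intros c d u t g x Hcd Hu Hg Hd. destruct (Hlip c d x Hcd) as [L [HL HLb]].
  apply is_derive_Reals. intros eps Heps.
  destruct (Hd (eps / (2 * (L + 1)))) as [dl [Hdl H]]; [apply Rdiv_lt_0_compat; lra|].
  exists (mkposreal dl Hdl). intros s Hs0 Hs. simpl in Hs.
  specialize (H (t + s)). replace (t + s - t) with s in H by ring. specialize (H Hs).
  assert (Ct := Hu t). assert (Cts := Hu (t + s)).
  assert (E : P c d (u (t + s)) x - P c d (u t) x - s * P c d g x
    = P c d (fun y => 1 * u (t + s) y + (-1) * (1 * u t y + s * g y)) x).
  { rewrite Plin, Plin by cont_tac. ring. }
  assert (Hb : Rabs (P c d (u (t + s)) x - P c d (u t) x - s * P c d g x)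
     <= L * (eps / (2 * (L + 1)) * Rabs s)).
  { rewrite E. apply HLb; [cont_tac|]. intros y Hy.
    replace (1 * u (t + s) y + -1 * (1 * u t y + s * g y))
      with (u (t + s) y - u t y - s * g y) by ring. now apply H. }
  assert (Hsp := Rabs_pos_lt s Hs0).
  replace ((P c d (u (t + s)) x - P c d (u t) x) / s - P c d g x)
    with ((P c d (u (t + s)) x - P c d (u t) x - s * P c d g x) / s) by (field; auto).
  unfold Rdiv at 1. rewrite Rabs_mult, Rabs_inv.
  apply (Rmult_lt_reg_r (Rabs s)); auto. rewrite Rmult_assoc, Rinv_l, Rmult_1_r by lra.
  eapply Rle_lt_trans; [apply Hb|].
  replace (L * (eps / (2 * (L + 1)) * Rabs s)) with ((eps * Rabs s) * (L / (2 * (L + 1))))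
    by (field; lra).
  assert (0 < eps * Rabs s) by now apply Rmult_lt_0_compat.
  assert (L / (2 * (L + 1)) < 1).
  { apply (Rmult_lt_reg_r (2 * (L + 1))); [lra|]. unfold Rdiv.
    rewrite Rmult_assoc, Rinv_l by lra. lra. }
  nra.
Qed.

(** * Meshes, traces and the discrete derivative *)

Definition width {a b} (m : mesh a b) (j : nat) : R := node m (S j) - node m j.

Lemma width_pos {a b} (m : mesh a b) j : (j < ncell m)%nat -> 0 < width m j.
Proof. intros H. assert (H1 := node_incr _ _ m j H). unfold width; lra. Qed.

Lemma width_in {a b} (m : mesh a b) j : (j < ncell m)%nat -> In (width m j) (widths m).
Proof.
intros H. apply (in_map (fun j => node m (S j) - node m j)). apply in_seq; lia.
Qed.

Lemma width_le_hmax {a b} (m : mesh a b) j : (j < ncell m)%nat -> width m j <= hmax m.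
Proof. intros H. apply RList.MaxRlist_P1. now apply width_in. Qed.

Lemma hmax_pos {a b} (m : mesh a b) : 0 < hmax m.
Proof.
assert (H := ncell_pos _ _ m).
apply Rlt_le_trans with (width m 0); [now apply width_pos|now apply width_le_hmax].
Qed.

Lemma hmin_pos {a b} (m : mesh a b) : 0 < hmin m.
Proof.
apply RList.MinRlist_P2. intros y Hy. apply in_map_iff in Hy.
destruct Hy as [j [<- Hj]]. apply in_seq in Hj. apply (width_pos m j); lia.
Qed.

Lemma hmax_le_width {a b} (m : mesh a b) sigma j : hmax m / hmin m <= sigma ->
  (j < ncell m)%nat -> hmax m <= sigma * width m j.
Proof.
intros Hs Hj. assert (Hm := hmin_pos m). assert (HM := hmax_pos m).
assert (H1 : hmin m <= width m j) by (apply RList.MinRlist_P1; now apply width_in).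
assert (H2 : hmax m <= sigma * hmin m).
{ apply (Rmult_le_compat_r (hmin m)) in Hs; [|lra].
  unfold Rdiv in Hs. rewrite Rmult_assoc, Rinv_l in Hs; lra. }
assert (0 < hmax m / hmin m) by (apply Rdiv_lt_0_compat; lra).
apply Rle_trans with (1 := H2). apply Rmult_le_compat_l; lra.
Qed.

Lemma node_mono {a b} (m : mesh a b) i j : (i <= j)%nat -> (j <= ncell m)%nat -> node m i <= node m j.
Proof.
induction 1 as [|j Hij IH]; intros H; [lra|].
assert (H1 := node_incr _ _ m j ltac:(lia)). specialize (IH ltac:(lia)). lra.
Qed.

Lemma node_range {a b} (m : mesh a b) j : (j <= ncell m)%nat -> a <= node m j <= b.
Proof.
intros H. assert (H1 := node_mono m 0 j ltac:(lia) H).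
assert (H2 := node_mono m j _ H ltac:(lia)).
rewrite (node_first _ _ m) in H1. rewrite (node_last _ _ m) in H2. lra.
Qed.

Lemma cell_in_domain {a b} (m : mesh a b) j x : (j < ncell m)%nat ->
  node m j <= x <= node m (S j) -> a <= x <= b.
Proof.
intros H Hx. assert (H1 := node_range m j ltac:(lia)).
assert (H2 := node_range m (S j) ltac:(lia)). lra.
Qed.

Lemma sum_cell_int {a b} (m : mesh a b) g : cont g ->
  bigsum (ncell m) (fun j => cell_int m j g) = RInt g a b.
Proof.
intros Hg.
assert (H : forall n, bigsum n (fun j => cell_int m j g) = RInt g (node m 0) (node m n)).
{ induction n as [|n IH].
  - rewrite RInt_point. reflexivity.
  - rewrite bigsum_S, IH. unfold cell_int. now apply RInt_Chasles_cont. }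
rewrite H, (node_first _ _ m), (node_last _ _ m). reflexivity.
Qed.

Definition pw_cont {a b} (m : mesh a b) (v : nat -> R -> R) : Prop :=
  forall j, (j < ncell m)%nat -> cont (v j).

Definition ip {a b} (m : mesh a b) (v w : nat -> R -> R) : R :=
  bigsum (ncell m) (fun j => cell_int m j (fun x => v j x * w j x)).

Lemma cell_le {a b} (m : mesh a b) j : (j < ncell m)%nat -> node m j <= node m (S j).
Proof. intros H; assert (H1 := node_incr _ _ m j H); lra. Qed.

Lemma Vh_cont {a b} (m : mesh a b) k v : Vh m k v -> pw_cont m v.
Proof. intros H j Hj. apply (is_poly_cont k); auto. Qed.

Lemma Vh_minus {a b} (m : mesh a b) k v w : Vh m k v -> Vh m k w ->
  Vh m k (fun j x => v j x - w j x).
Proof. intros Hv Hw j Hj. apply is_poly_minus; auto. Qed.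

Lemma ip_minus_l {a b} (m : mesh a b) v v' w : pw_cont m v -> pw_cont m v' -> pw_cont m w ->
  ip m (fun j x => v j x - v' j x) w = ip m v w - ip m v' w.
Proof.
intros Hv Hv' Hw. unfold ip. rewrite <- bigsum_minus. apply bigsum_ext; intros j Hj.
specialize (Hv j Hj). specialize (Hv' j Hj). specialize (Hw j Hj).
unfold cell_int. rewrite <- RInt_minus_cont by cont_tac. apply RInt_ext_R; intros; ring.
Qed.

Lemma ip_pos {a b} (m : mesh a b) v : pw_cont m v -> 0 <= ip m v v.
Proof.
intros Hv. apply bigsum_nonneg; intros j Hj. specialize (Hv j Hj).
apply RInt_nonneg_cont; [now apply cell_le|cont_tac|intros; apply Rle_0_sqr].
Qed.

Lemma ip_young {a b} (m : mesh a b) e v w : 0 < e -> pw_cont m v -> pw_cont m w ->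
  Rabs (ip m v w) <= e * ip m v v + / (4 * e) * ip m w w.
Proof.
intros He Hv Hw. unfold ip. eapply Rle_trans; [apply bigsum_Abs|].
rewrite <- !bigsum_scal, <- bigsum_plus. apply bigsum_le; intros j Hj.
specialize (Hv j Hj). specialize (Hw j Hj). unfold cell_int.
rewrite <- !RInt_scal_cont, <- RInt_plus_cont by cont_tac.
apply RInt_Abs_cont; [now apply cell_le|cont_tac|cont_tac|]. intros x _.
rewrite Rabs_mult.
replace (v j x * v j x) with (Rabs (v j x) * Rabs (v j x))
  by (rewrite <- Rabs_mult; apply Rabs_pos_eq, Rle_0_sqr).
replace (w j x * w j x) with (Rabs (w j x) * Rabs (w j x))
  by (rewrite <- Rabs_mult; apply Rabs_pos_eq, Rle_0_sqr).
set (p := Rabs (v j x)); set (q := Rabs (w j x)).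
assert (H : 0 <= (2 * e * p - q) ^ 2 * / (4 * e)).
{ apply Rmult_le_pos; [apply pow2_ge_0|]. apply Rlt_le, Rinv_0_lt_compat; lra. }
replace ((2 * e * p - q) ^ 2 * / (4 * e)) with (e * (p * p) + / (4 * e) * (q * q) - p * q) in H
  by (field; lra).
lra.
Qed.

Lemma trace_minus_S {a b} (m : mesh a b) v j : trace_minus m v (S j) = v j (node m (S j)).
Proof. reflexivity. Qed.

Lemma trace_plus_lt {a b} (m : mesh a b) v i : (i < ncell m)%nat ->
  trace_plus m v i = v i (node m i).
Proof. intros H; unfold trace_plus. destruct (Nat.eq_dec i (ncell m)); [lia|reflexivity]. Qed.

Lemma trace_minus_periodic {a b} (m : mesh a b) v :
  trace_minus m v (ncell m) = trace_minus m v 0.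
Proof.
assert (H := ncell_pos _ _ m). destruct (ncell m) as [|n] eqn:E; [lia|].
unfold trace_minus. rewrite E. reflexivity.
Qed.

Lemma trace_plus_periodic {a b} (m : mesh a b) v :
  trace_plus m v (ncell m) = trace_plus m v 0.
Proof.
rewrite (trace_plus_lt m v 0) by apply (ncell_pos _ _ m).
unfold trace_plus. destruct (Nat.eq_dec (ncell m) (ncell m)); [reflexivity|lia].
Qed.

Lemma at_nodes_periodic {a b} (m : mesh a b) g v :
  at_nodes m g v (ncell m) = at_nodes m g v 0.
Proof. unfold at_nodes. rewrite trace_minus_periodic, trace_plus_periodic; reflexivity. Qed.

(** Ends of cells regrouped by nodes; periodicity identifies the outer two nodes. *)
Lemma sum_cells_to_nodes {a b} (m : mesh a b) (Gm Gp : nat -> R) :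
  Gm (ncell m) = Gm 0%nat ->
  bigsum (ncell m) (fun j => Gm (S j) - Gp j) = bigsum (ncell m) (fun i => Gm i - Gp i).
Proof. intros H. rewrite !bigsum_minus, bigsum_shift by auto. reflexivity. Qed.

(** Every trace is the value of one cell at an endpoint, and every cell has two. *)
Lemma sum_traces_le {a b} (m : mesh a b) (v : nat -> R -> R) (s : nat -> R) :
  (forall j x, (j < ncell m)%nat -> node m j <= x <= node m (S j) -> v j x ^ 2 <= s j) ->
  bigsum (ncell m) (fun i => trace_minus m v i ^ 2 + trace_plus m v i ^ 2)
  <= 2 * bigsum (ncell m) s.
Proof.
intros H. rewrite bigsum_plus.
rewrite <- (bigsum_shift (ncell m) (fun i => trace_minus m v i ^ 2)).
2:{ now rewrite trace_minus_periodic. }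
rewrite <- bigsum_plus, <- bigsum_scal. apply bigsum_le; intros j Hj.
rewrite trace_minus_S, trace_plus_lt by auto. assert (Hc := cell_le m j Hj).
assert (H1 := H j (node m j) Hj ltac:(lra)). assert (H2 := H j (node m (S j)) Hj ltac:(lra)).
lra.
Qed.

Lemma trace_bound {a b} (m : mesh a b) (v : nat -> R -> R) (Q : R -> Prop) i :
  (forall j x, (j < ncell m)%nat -> node m j <= x <= node m (S j) -> Q (v j x)) ->
  (i < ncell m)%nat -> Q (trace_minus m v i) /\ Q (trace_plus m v i).
Proof.
intros H Hi. assert (Hm : forall j, (j < ncell m)%nat -> Q (trace_minus m v (S j))).
{ intros j Hj. rewrite trace_minus_S. assert (Hc := cell_le m j Hj). apply H; auto; lra. }
split.
- destruct i as [|i]; [|apply Hm; lia].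
  rewrite <- trace_minus_periodic. assert (H0 := ncell_pos _ _ m).
  destruct (ncell m) as [|n]; [lia|]. apply Hm; lia.
- rewrite trace_plus_lt by auto. assert (Hc := cell_le m i Hi). apply H; auto; lra.
Qed.

(** The upwind, downwind and central linear fluxes are th = 1, th = 0 and th = 1/2. *)
Definition lin (th um up : R) : R := th * um + (1 - th) * up.

(** Discrete derivative: minus the distributional pairing of v with phi', with the
    traces of v replaced by a numerical flux. *)
Definition ddx {a b} (m : mesh a b) (th : R) (v phi : nat -> R -> R) : R :=
  bigsum (ncell m) (fun j => bracket m (at_nodes m (lin th) v) phi j
    - cell_int m j (fun x => v j x * Derive (phi j) x)).

Lemma ddx_minus_l {a b} (m : mesh a b) k th v w phi : pw_cont m v -> pw_cont m w -> Vh m k phi ->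
  ddx m th (fun j x => v j x - w j x) phi = ddx m th v phi - ddx m th w phi.
Proof.
intros Hv Hw Hp. unfold ddx. rewrite <- bigsum_minus. apply bigsum_ext; intros j Hj.
specialize (Hv j Hj). specialize (Hw j Hj).
assert (Cp := is_poly_cont_Derive k _ (Hp j Hj)).
assert (E : cell_int m j (fun x => (v j x - w j x) * Derive (phi j) x)
  = cell_int m j (fun x => v j x * Derive (phi j) x) - cell_int m j (fun x => w j x * Derive (phi j) x)).
{ unfold cell_int. rewrite <- RInt_minus_cont by cont_tac. apply RInt_ext_R; intros; ring. }
rewrite E. unfold bracket.
assert (Ea : forall i, at_nodes m (lin th) (fun j x => v j x - w j x) i
   = at_nodes m (lin th) v i - at_nodes m (lin th) w i).
{ intros i. unfold at_nodes, lin.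
  replace (trace_minus m (fun j0 x => v j0 x - w j0 x) i)
    with (trace_minus m v i - trace_minus m w i) by (destruct i; reflexivity).
  replace (trace_plus m (fun j0 x => v j0 x - w j0 x) i)
    with (trace_plus m v i - trace_plus m w i)
    by (unfold trace_plus; destruct (Nat.eq_dec i (ncell m)); reflexivity).
  ring. }
rewrite !Ea. ring.
Qed.

Lemma sum_bracket {a b} (m : mesh a b) hat phi : hat (ncell m) = hat 0%nat ->
  bigsum (ncell m) (bracket m hat phi)
  = bigsum (ncell m) (fun i => hat i * (trace_minus m phi i - trace_plus m phi i)).
Proof.
intros H. unfold bracket.
rewrite (sum_cells_to_nodes m (fun i => hat i * trace_minus m phi i)
           (fun i => hat i * trace_plus m phi i)).
- apply bigsum_ext; intros; ring.
- now rewrite H, trace_minus_periodic.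
Qed.

(** Summation by parts: exchanging the roles of the one-sided traces gives the
    negative adjoint. *)
Lemma ddx_adjoint {a b} (m : mesh a b) k th v w : Vh m k v -> Vh m k w ->
  ddx m th v w + ddx m (1 - th) w v = 0.
Proof.
intros Hv Hw. unfold ddx. rewrite !bigsum_minus.
rewrite !sum_bracket by apply at_nodes_periodic.
set (Sv := bigsum (ncell m) (fun j => cell_int m j (fun x => v j x * Derive (w j) x))).
set (Sw := bigsum (ncell m) (fun j => cell_int m j (fun x => w j x * Derive (v j) x))).
assert (H : Sv + Sw = bigsum (ncell m)
   (fun i => trace_minus m v i * trace_minus m w i - trace_plus m v i * trace_plus m w i)).
{ rewrite <- (sum_cells_to_nodes m (fun i => trace_minus m v i * trace_minus m w i)
     (fun i => trace_plus m v i * trace_plus m w i)) by now rewrite !trace_minus_periodic.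
  unfold Sv, Sw. rewrite <- bigsum_plus. apply bigsum_ext; intros j Hj.
  rewrite !trace_minus_S, !trace_plus_lt by auto. unfold cell_int.
  rewrite <- (RInt_by_parts (v j) (w j)).
  - rewrite Rplus_comm. f_equal. apply RInt_ext_R; intros; ring.
  - intros; apply (is_poly_ex_derive k); auto.
  - intros; apply (is_poly_ex_derive k); auto.
  - apply (is_poly_cont_Derive k); auto.
  - apply (is_poly_cont_Derive k); auto. }
match goal with |- ?A - Sv + (?B - Sw) = 0 => assert (E : A + B = Sv + Sw) end.
{ rewrite H, <- bigsum_plus. apply bigsum_ext; intros i Hi. unfold at_nodes, lin. ring. }
lra.
Qed.

Lemma at_nodes_exact {a b} (m : mesh a b) h g i : (forall y, h y y = y) -> g a = g b ->
  (i <= ncell m)%nat -> at_nodes m h (fun _ => g) i = g (node m i).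
Proof.
intros Hh Hg Hi. unfold at_nodes.
replace (trace_minus m (fun _ => g) i) with (g (node m i)).
2:{ destruct i as [|i]; [|reflexivity]. unfold trace_minus.
    rewrite (node_first _ _ m), (node_last _ _ m). auto. }
replace (trace_plus m (fun _ => g) i) with (g (node m i)); [apply Hh|].
unfold trace_plus. destruct (Nat.eq_dec i (ncell m)) as [->|]; [|reflexivity].
rewrite (node_first _ _ m), (node_last _ _ m). auto.
Qed.

Lemma exact_by_parts {a b} (m : mesh a b) k g phi : Vh m k phi ->
  smooth 1 g ->
  forall j, (j < ncell m)%nat ->
  bracket m (fun i => g (node m i)) phi j - cell_int m j (fun x => g x * Derive (phi j) x)
  = cell_int m j (fun x => Derive g x * phi j x).
Proof.
intros Hp [Dg Cg] j Hj. simpl in Cg. unfold bracket, cell_int.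
rewrite trace_minus_S, trace_plus_lt by auto.
rewrite <- (RInt_by_parts g (phi j)); auto.
- ring.
- intros; apply (is_poly_ex_derive k); auto.
- apply (is_poly_cont_Derive k); auto.
Qed.

(** The discrete derivative is consistent: on a smooth periodic function it is
    the derivative. *)
Lemma ddx_exact {a b} (m : mesh a b) k th g phi : Vh m k phi -> smooth 1 g -> g a = g b ->
  ddx m th (fun _ => g) phi = ip m (fun _ => Derive g) phi.
Proof.
intros Hp Hg Hab. unfold ddx, ip. apply bigsum_ext; intros j Hj.
rewrite <- (exact_by_parts m k g phi Hp Hg j Hj). f_equal. unfold bracket.
rewrite !at_nodes_exact by (auto; try lia; intros; unfold lin; ring). reflexivity.
Qed.

(** Stability of the elliptic part: testing the two first-order equations with the
    errors of v, q and u makes all derivatives cancel by adjointness, so the error of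
    v is controlled by that of u and by the consistency residual rho. *)
Lemma elliptic_stability {a b} (m : mesh a b) k th rho (xu xv xq : nat -> R -> R)
  (R1 R2 : (nat -> R -> R) -> R) :
  Vh m k xu -> Vh m k xv -> Vh m k xq ->
  (forall phi, Vh m k phi -> ip m xv phi - ddx m th xq phi - ddx m th xu phi = R1 phi) ->
  (forall phi, Vh m k phi -> ip m xq phi - ddx m (1 - th) xv phi = R2 phi) ->
  (forall phi, Vh m k phi -> Rabs (R1 phi) <= rho + / 4 * ip m phi phi) ->
  (forall phi, Vh m k phi -> Rabs (R2 phi) <= rho + / 4 * ip m phi phi) ->
  ip m xv xv <= 4 * rho + 2 * ip m xu xu.
Proof.
intros Hu Hv Hq E1 E2 B1 B2.
assert (Cu := Vh_cont _ _ _ Hu). assert (Cv := Vh_cont _ _ _ Hv). assert (Cq := Vh_cont _ _ _ Hq).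
assert (A1 := E1 xv Hv). assert (A2 := E2 xq Hq). assert (A3 := E2 xu Hu).
assert (D1 := ddx_adjoint m k th xq xv Hq Hv). assert (D2 := ddx_adjoint m k th xu xv Hu Hv).
assert (N1 := B1 xv Hv). assert (N2 := B2 xq Hq). assert (N3 := B2 xu Hu).
assert (Y := ip_young m (/ 4) xq xu ltac:(lra) Cq Cu).
replace (/ (4 * / 4)) with 1 in Y by field.
assert (Pu := ip_pos m xu Cu). assert (Pv := ip_pos m xv Cv). assert (Pq := ip_pos m xq Cq).
apply Rabs_le_between in N1. apply Rabs_le_between in N2. apply Rabs_le_between in N3.
apply Rabs_le_between in Y. lra.
Qed.

(** * Nonlinear flux: interior of a cell and nodes *)

(** Bounds of the speed f1 on an interval [-r,r] that contains all arguments of the flux;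
    a power flux has no global ones. *)
Record flux_data (f f1 F : R -> R) (r L L2 : R) : Prop := FluxData {
  flux_primitive : forall y, is_derive F y (f y);
  flux_derive : forall y, is_derive f y (f1 y);
  flux_cont1 : cont f1;
  flux_bound : forall y, Rabs y <= r -> Rabs (f1 y) <= L;
  flux_lip : forall y z, Rabs y <= r -> Rabs z <= r -> Rabs (f1 y - f1 z) <= L2 * Rabs (y - z);
  flux_L : 0 <= L;
  flux_L2 : 0 <= L2
}.

Arguments flux_primitive {f f1 F r L L2}.
Arguments flux_derive {f f1 F r L L2}.
Arguments flux_cont1 {f f1 F r L L2}.
Arguments flux_bound {f f1 F r L L2}.
Arguments flux_lip {f f1 F r L L2}.
Arguments flux_L {f f1 F r L L2}.
Arguments flux_L2 {f f1 F r L L2}.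

Lemma mean_value g dg x y : (forall z, is_derive g z (dg z)) ->
  exists z, Rmin x y <= z <= Rmax x y /\ g y - g x = dg z * (y - x).
Proof.
intros Hd. apply (MVT_gen g x y dg); auto.
intros z _. apply derivable_continuous_pt. exists (dg z). apply is_derive_Reals, Hd.
Qed.

Lemma between_abs x y z : Rmin x y <= z <= Rmax x y ->
  Rabs (z - x) <= Rabs (y - x) /\ Rabs (z - y) <= Rabs (y - x).
Proof.
unfold Rmin, Rmax. destruct (Rle_dec x y) as [H|H]; intros Hz.
- rewrite (Rabs_pos_eq (z - x)), (Rabs_left1 (z - y)), (Rabs_pos_eq (y - x)); lra.
- rewrite (Rabs_left1 (z - x)), (Rabs_pos_eq (z - y)), (Rabs_left1 (y - x)); lra.
Qed.

Lemma between_bound x y z r : Rmin x y <= z <= Rmax x y -> Rabs x <= r -> Rabs y <= r ->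
  Rabs z <= r.
Proof.
unfold Rmin, Rmax. destruct (Rle_dec x y); intros Hz Hx Hy;
apply Rabs_le_between in Hx; apply Rabs_le_between in Hy; apply Rabs_le; lra.
Qed.

Lemma is_derive_cont g dg : (forall z, is_derive g z (dg z)) -> cont g.
Proof. intros H; apply cont_ex_derive; intros x; eexists; apply H. Qed.

Lemma flux_taylor f f1 F r L L2 y e : flux_data f f1 F r L L2 ->
  Rabs y <= r -> Rabs (y + e) <= r ->
  Rabs (f (y + e) - f y - f1 y * e) <= L2 * e ^ 2.
Proof.
intros Hf Hy He. destruct (mean_value f f1 y (y + e) (flux_derive Hf)) as [z [Hz E]].
replace (y + e - y) with e in E by ring.
rewrite E. replace (f1 z * e - f1 y * e) with ((f1 z - f1 y) * e) by ring.
rewrite Rabs_mult, <- (pow2_abs e).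
replace (L2 * Rabs e ^ 2) with (L2 * Rabs e * Rabs e) by ring.
apply Rmult_le_compat_r; [apply Rabs_pos|].
destruct (between_abs _ _ _ Hz) as [H1 _]. replace (y + e - y) with e in H1 by ring.
eapply Rle_trans; [apply (flux_lip Hf); auto|].
- now apply (between_bound _ _ _ r Hz).
- apply Rmult_le_compat_l; auto. apply (flux_L2 Hf).
Qed.

(** Relative entropy of u + s with respect to u. *)
Definition rel_entropy (f F : R -> R) (u s : R) : R := F (u + s) - F u - f u * s.

Lemma rel_entropy_derive f f1 F r L L2 (u xi : R -> R) du dxi x :
  flux_data f f1 F r L L2 -> is_derive u x du -> is_derive xi x dxi ->
  is_derive (fun x => rel_entropy f F (u x) (xi x)) x
    ((f (u x + xi x) - f (u x)) * dxi
     + (f (u x + xi x) - f (u x) - f1 (u x) * xi x) * du).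
Proof.
intros Hf Hu Hx. unfold rel_entropy.
assert (H1 := is_derive_comp F (fun x => u x + xi x) x _ _
   (flux_primitive Hf _) (is_derive_plus u xi x _ _ Hu Hx)).
assert (H2 := is_derive_comp F u x _ _ (flux_primitive Hf _) Hu).
assert (H3 := is_derive_comp f u x _ _ (flux_derive Hf _) Hu).
assert (H4 := is_derive_mult (fun x => f (u x)) xi x _ _ H3 Hx ltac:(intros; apply Rmult_comm)).
assert (H5 := is_derive_minus _ _ x _ _ (is_derive_minus _ _ x _ _ H1 H2) H4).
eapply is_derive_ext; [|evar_last; [apply H5|]].
- intros; reflexivity.
- unfold minus, plus, opp, scal; simpl. unfold mult; simpl. ring.
Qed.

Lemma half_squares x y : 0 <= x -> 0 <= y -> x * y <= / 2 * (x ^ 2 + y ^ 2).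
Proof. intros. assert (H1 := pow2_ge_0 (x - y)). nra. Qed.

(** Interior contribution of one cell. Up to an exact derivative, whose boundary
    terms are passed to the nodes, the nonlinear term is quadratic in the errors: the
    part linear in eta drops out by orthogonality once f1 is frozen on the cell, and no
    inverse power of the cell size is lost on the part cubic in xi. *)
Lemma interior_cell f f1 F r R1 L L2 A k c d (u xi eta : R -> R) :
  flux_data f f1 F r L L2 -> 0 <= A -> 0 <= R1 -> c < d ->
  smooth 1 u -> is_poly k xi -> cont eta ->
  (forall x, c <= x <= d -> Rabs (u x) <= r - 2 /\ Rabs (Derive u x) <= R1 /\
     Rabs (xi x) <= 1 /\ Rabs (eta x) <= 1 /\ Rabs (eta x) <= A * (d - c)) ->
  RInt (fun x => eta x * Derive xi x) c d = 0 ->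
  RInt (fun x => (f (u x + xi x - eta x) - f (u x)) * Derive xi x) c d
  <= rel_entropy f F (u d) (xi d) - rel_entropy f F (u c) (xi c)
     + L2 * (A + 2 * R1) * (RInt (fun x => xi x ^ 2) c d + RInt (fun x => eta x ^ 2) c d
         + (d - c) ^ 2 * RInt (fun x => Derive xi x ^ 2) c d).
Proof.
intros Hf HA HR1 Hcd [Du Cdu] Pxi Ceta Hb Horth. simpl in Cdu.
assert (HL2 := flux_L2 Hf).
assert (Cu : cont u) by now apply cont_ex_derive.
assert (Cxi := is_poly_cont _ _ Pxi). assert (Cdxi := is_poly_cont_Derive _ _ Pxi).
assert (Cf := is_derive_cont _ _ (flux_derive Hf)).
assert (Cf1 := flux_cont1 Hf).
assert (C1 : cont (fun x => f (u x))) by now apply (cont_comp f).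
assert (C2 : cont (fun x => f (u x + xi x))) by (apply (cont_comp f); cont_tac).
assert (C3 : cont (fun x => f (u x + xi x - eta x))) by (apply (cont_comp f); cont_tac).
assert (C4 : cont (fun x => f1 (u x))) by now apply (cont_comp f1).
set (dG := fun x => (f (u x + xi x) - f (u x)) * Derive xi x
     + (f (u x + xi x) - f (u x) - f1 (u x) * xi x) * Derive u x).
assert (CdG : cont dG) by (unfold dG; cont_tac).
assert (EG : RInt dG c d = rel_entropy f F (u d) (xi d) - rel_entropy f F (u c) (xi c)).
{ assert (H : is_RInt dG c d (minus (rel_entropy f F (u d) (xi d)) (rel_entropy f F (u c) (xi c)))).
  { apply (is_RInt_derive (fun x => rel_entropy f F (u x) (xi x))).
    - intros x _. apply (rel_entropy_derive f f1 F r L L2); auto.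
      + apply Derive_correct, Du.
      + apply Derive_correct, (is_poly_ex_derive k), Pxi.
    - intros x _. apply CdG. }
  exact (is_RInt_unique (V := R_CompleteNormedModule) _ c d _ H). }
set (rest := fun x => (f (u x + xi x - eta x) - f (u x + xi x) + f1 (u c) * eta x) * Derive xi x
     - (f (u x + xi x) - f (u x) - f1 (u x) * xi x) * Derive u x).
assert (Crest : cont rest) by (unfold rest; cont_tac).
rewrite (RInt_ext_R _ (fun x => dG x + rest x - f1 (u c) * (eta x * Derive xi x)))
  by (intros; unfold dG, rest; ring).
rewrite RInt_minus_cont, RInt_plus_cont, RInt_scal_cont, Horth, EG by cont_tac.
rewrite <- RInt_scal_cont, <- !RInt_plus_cont, <- RInt_scal_cont by cont_tac.
enough (RInt rest c d <= RInt (fun x => L2 * (A + 2 * R1) *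
   (xi x ^ 2 + eta x ^ 2 + (d - c) ^ 2 * Derive xi x ^ 2)) c d) by lra.
apply RInt_le_cont; [lra|auto|cont_tac|].
intros x Hx. unfold rest. destruct (Hb x ltac:(lra)) as [B1 [B2 [B3 [B4 B5]]]].
destruct (Hb c ltac:(lra)) as [B1c _].
assert (K1 : Rabs (u x) <= r) by lra.
assert (K2 : Rabs (u x + xi x) <= r).
{ eapply Rle_trans; [apply Rabs_triang|lra]. }
assert (K3 : Rabs (u x + xi x - eta x) <= r).
{ unfold Rminus. eapply Rle_trans; [apply Rabs_triang|]. rewrite Rabs_Ropp.
  assert (H := Rabs_triang (u x) (xi x)). lra. }
assert (T1 : - ((f (u x + xi x) - f (u x) - f1 (u x) * xi x) * Derive u x) <= L2 * R1 * xi x ^ 2).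
{ rewrite <- Rabs_Ropp in B2. eapply Rle_trans; [apply Rle_abs|].
  rewrite Rabs_Ropp, Rabs_mult. rewrite Rabs_Ropp in B2.
  replace (L2 * R1 * xi x ^ 2) with (L2 * xi x ^ 2 * R1) by ring.
  apply Rmult_le_compat; auto using Rabs_pos.
  now apply (flux_taylor f f1 F r L L2). }
destruct (mean_value f f1 (u x + xi x) (u x + xi x - eta x) (flux_derive Hf))
  as [z [Hz Ez]].
replace (u x + xi x - eta x - (u x + xi x)) with (- eta x) in Ez by ring.
assert (Hzb := between_bound _ _ _ r Hz K2 K3).
destruct (between_abs _ _ _ Hz) as [Hz1 _].
replace (u x + xi x - eta x - (u x + xi x)) with (- eta x) in Hz1 by ring.
rewrite Rabs_Ropp in Hz1.
rewrite Ez. replace (f1 z * - eta x + f1 (u c) * eta x) with (- ((f1 z - f1 (u c)) * eta x)) by ring.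
set (X := Rabs (xi x)) in *. set (N := Rabs (eta x)) in *.
set (Z := (d - c) * Rabs (Derive xi x)).
assert (HX : 0 <= X) by apply Rabs_pos. assert (HN : 0 <= N) by apply Rabs_pos.
assert (HZ : 0 <= Z) by (apply Rmult_le_pos; [lra|apply Rabs_pos]).
assert (Huc : Rabs (u x - u c) <= R1 * (d - c)).
{ destruct (mean_value u (Derive u) c x) as [w [Hw Ew]].
  { intros; apply Derive_correct, Du. }
  rewrite Rmin_left, Rmax_right in Hw by lra. rewrite Ew, Rabs_mult.
  apply Rmult_le_compat; auto using Rabs_pos.
  - apply Hb; lra.
  - rewrite Rabs_pos_eq; lra. }
assert (Hzc : Rabs (f1 z - f1 (u c)) <= L2 * (N + X + R1 * (d - c))).
{ eapply Rle_trans; [apply (flux_lip Hf); auto; lra|].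
  apply Rmult_le_compat_l; auto.
  replace (z - u c) with ((z - (u x + xi x)) + xi x + (u x - u c)) by ring.
  eapply Rle_trans; [apply Rabs_triang|].
  assert (H := Rabs_triang (z - (u x + xi x)) (xi x)). fold X in H. lra. }
assert (T2 : - ((f1 z - f1 (u c)) * eta x) * Derive xi x
   <= L2 * (A * X * Z + A * N * Z + R1 * N * Z)).
{ eapply Rle_trans; [apply Rle_abs|]. rewrite Rabs_mult, Rabs_Ropp, Rabs_mult. fold N.
  apply Rle_trans with (L2 * (N + X + R1 * (d - c)) * N * Rabs (Derive xi x)).
  - apply Rmult_le_compat_r; [apply Rabs_pos|]. now apply Rmult_le_compat_r.
  - replace (L2 * (N + X + R1 * (d - c)) * N * Rabs (Derive xi x))
      with (L2 * ((N + X) * Rabs (Derive xi x) * N + R1 * N * Z)) by (unfold Z; ring).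
    apply Rmult_le_compat_l; auto.
    enough ((N + X) * Rabs (Derive xi x) * N <= (N + X) * Rabs (Derive xi x) * (A * (d - c)))
      by (unfold Z in *; lra).
    apply Rmult_le_compat_l; auto. apply Rmult_le_pos; [lra|apply Rabs_pos]. }
assert (Y1 := half_squares X Z HX HZ). assert (Y2 := half_squares N Z HN HZ).
replace (xi x ^ 2) with (X ^ 2) in * by apply pow2_abs.
replace (eta x ^ 2) with (N ^ 2) by apply pow2_abs.
replace ((d - c) ^ 2 * Derive xi x ^ 2) with (Z ^ 2)
  by (unfold Z; rewrite Rpow_mult_distr, pow2_abs; reflexivity).
assert (HX2 := pow2_ge_0 X). assert (HN2 := pow2_ge_0 N). assert (HZ2 := pow2_ge_0 Z).
assert (Q1 : A * X * Z <= A * (/ 2 * (X ^ 2 + Z ^ 2))).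
{ rewrite Rmult_assoc. now apply Rmult_le_compat_l. }
assert (Q2 : A * N * Z <= A * (/ 2 * (N ^ 2 + Z ^ 2))).
{ rewrite Rmult_assoc. now apply Rmult_le_compat_l. }
assert (Q3 : R1 * N * Z <= R1 * (/ 2 * (N ^ 2 + Z ^ 2))).
{ rewrite Rmult_assoc. now apply Rmult_le_compat_l. }
assert (Q : A * X * Z + A * N * Z + R1 * N * Z + R1 * X ^ 2
   <= (A + 2 * R1) * (X ^ 2 + N ^ 2 + Z ^ 2)).
{ assert (0 <= A * X ^ 2) by nonneg.
  assert (0 <= A * N ^ 2) by nonneg.
  assert (0 <= R1 * X ^ 2) by nonneg.
  assert (0 <= R1 * N ^ 2) by nonneg.
  assert (0 <= R1 * Z ^ 2) by nonneg. lra. }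
apply (Rmult_le_compat_l L2) in Q; auto. lra.
Qed.

(** The entropy produced at a node with one-sided values al and be by a numerical flux
    of value g: the integral of g - f from al to be. It is nonpositive for every
    monotone flux evaluated at al and be themselves. *)
Definition node_term (F : R -> R) (al be g : R) : R := F al - F be + g * (be - al).

(** The numerical flux sees the traces al - em and be - ep, shifted by the projection
    errors em and ep. Its production there is at most E, and the two missing pieces of the
    integral have lengths em and ep; on them f differs from f(th) by the local speed times
    the distance. That speed is measured at al, for comparison with the dissipation. *)
Lemma node_term_le f f1 F r L L2 al be em ep th E :
  flux_data f f1 F r L L2 ->
  Rabs al <= r -> Rabs be <= r -> Rabs (al - em) <= r -> Rabs (be - ep) <= r ->
  Rmin (al - em) (be - ep) <= th <= Rmax (al - em) (be - ep) ->
  node_term F (al - em) (be - ep) (f th) <= E ->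
  let d := Rabs (be - ep - (al - em)) + (Rabs em + Rabs ep) in
  node_term F al be (f th) <= E + (Rabs (f1 al) + L2 * d) * d * (Rabs em + Rabs ep).
Proof.
intros Hf Ha Hb Ha' Hb' Hth HE d.
assert (HL2 := flux_L2 Hf).
assert (Hthr := between_bound _ _ _ r Hth Ha' Hb').
destruct (between_abs _ _ _ Hth) as [D1 D2].
assert (Pm := Rabs_pos em). assert (Pp := Rabs_pos ep).
set (Q := Rabs (f1 al) + L2 * d).
assert (Hgen : forall s, Rabs s <= r -> Rabs (th - s) <= d -> Rabs (s - al) <= d ->
  Rabs (th - al) <= d -> Rabs (f th - f s) <= Q * d).
{ intros s Hs Hd Hsa Hta.
  destruct (mean_value f f1 s th (flux_derive Hf)) as [z [Hz Ez]].
  rewrite Ez, Rabs_mult. apply Rmult_le_compat; auto using Rabs_pos.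
  assert (Hzr := between_bound _ _ _ r Hz Hs Hthr).
  assert (Hza : Rabs (z - al) <= d).
  { apply (between_bound (s - al) (th - al)); auto.
    unfold Rmin, Rmax in *. destruct (Rle_dec s th); destruct (Rle_dec (s - al) (th - al)); lra. }
  assert (H := flux_lip Hf z al Hzr Ha).
  assert (H2 : L2 * Rabs (z - al) <= L2 * d) by now apply Rmult_le_compat_l.
  assert (H3 := Rabs_triang (f1 z - f1 al) (f1 al)).
  replace (f1 z - f1 al + f1 al) with (f1 z) in H3 by ring.
  unfold Q; lra. }
assert (Hta : Rabs (th - al) <= d).
{ replace (th - al) with ((th - (al - em)) + - em) by ring.
  eapply Rle_trans; [apply Rabs_triang|]. rewrite Rabs_Ropp. unfold d; lra. }
destruct (mean_value F f (be - ep) be (flux_primitive Hf)) as [s1 [Hs1 E1]].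
destruct (mean_value F f (al - em) al (flux_primitive Hf)) as [s2 [Hs2 E2]].
replace (be - (be - ep)) with ep in E1 by ring.
replace (al - (al - em)) with em in E2 by ring.
destruct (between_abs _ _ _ Hs1) as [A1 B1]. destruct (between_abs _ _ _ Hs2) as [A2 B2].
replace (be - (be - ep)) with ep in * by ring.
replace (al - (al - em)) with em in * by ring.
assert (G1 : Rabs (f th - f s1) <= Q * d).
{ apply Hgen; auto.
  - apply (between_bound _ _ _ r Hs1); auto.
  - replace (th - s1) with ((th - (be - ep)) + - (s1 - (be - ep))) by ring.
    eapply Rle_trans; [apply Rabs_triang|]. rewrite Rabs_Ropp. unfold d; lra.
  - replace (s1 - al) with ((s1 - (be - ep)) + (be - ep - (al - em)) + - em) by ring.
    eapply Rle_trans; [apply Rabs_triang|]. rewrite Rabs_Ropp.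
    assert (H := Rabs_triang (s1 - (be - ep)) (be - ep - (al - em))). unfold d; lra. }
assert (G2 : Rabs (f th - f s2) <= Q * d).
{ apply Hgen; auto.
  - apply (between_bound _ _ _ r Hs2); auto.
  - replace (th - s2) with ((th - (al - em)) + - (s2 - (al - em))) by ring.
    eapply Rle_trans; [apply Rabs_triang|]. rewrite Rabs_Ropp. unfold d; lra.
  - assert (0 <= Rabs (be - ep - (al - em))) by apply Rabs_pos. unfold d; lra. }
replace (node_term F al be (f th)) with (node_term F (al - em) (be - ep) (f th)
   + (f th - f s1) * ep + - ((f th - f s2) * em)).
2:{ unfold node_term.
    replace (F be) with (F (be - ep) + f s1 * ep) by lra.
    replace (F al) with (F (al - em) + f s2 * em) by lra. ring. }
assert (P1 : (f th - f s1) * ep <= Q * d * Rabs ep).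
{ eapply Rle_trans; [apply Rle_abs|]. rewrite Rabs_mult. now apply Rmult_le_compat_r. }
assert (P2 : - ((f th - f s2) * em) <= Q * d * Rabs em).
{ eapply Rle_trans; [apply Rle_abs|]. rewrite Rabs_Ropp, Rabs_mult. now apply Rmult_le_compat_r. }
lra.
Qed.

Lemma deriv_nonneg_le g dg x y : x <= y -> (forall z, is_derive g z (dg z)) ->
  (forall z, x <= z <= y -> 0 <= dg z) -> g x <= g y.
Proof.
intros Hxy Hd H. destruct (mean_value g dg x y Hd) as [z [Hz E]].
rewrite Rmin_left, Rmax_right in Hz by lra.
assert (0 <= dg z * (y - x)) by (apply Rmult_le_pos; [auto|lra]). lra.
Qed.

(** The area below f is at least that of a rectangle and a triangle. *)
Lemma area_from_left f F c m x y : x <= y -> (forall s, is_derive F s (f s)) ->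
  (forall s, x <= s <= y -> c + m * (s - x) <= f s) ->
  c * (y - x) + / 2 * m * (y - x) ^ 2 <= F y - F x.
Proof.
intros Hxy HF H.
assert (H1 := deriv_nonneg_le (fun s => F s - (c * s + / 2 * m * (s - x) ^ 2))
   (fun s => f s - (c + m * (s - x))) x y Hxy).
cbv beta in H1. enough (F x - (c * x + / 2 * m * (x - x) ^ 2) <=
   F y - (c * y + / 2 * m * (y - x) ^ 2)) by nra.
apply H1.
- intros z. apply (is_derive_minus F (fun s => c * s + / 2 * m * (s - x) ^ 2)); [apply HF|].
  auto_derive; auto. field.
- intros z Hz. specialize (H z Hz). lra.
Qed.

Lemma area_from_right f F c m x y : x <= y -> (forall s, is_derive F s (f s)) ->
  (forall s, x <= s <= y -> c + m * (y - s) <= f s) ->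
  c * (y - x) + / 2 * m * (y - x) ^ 2 <= F y - F x.
Proof.
intros Hxy HF H.
assert (H1 := deriv_nonneg_le (fun s => F s - (c * s - / 2 * m * (y - s) ^ 2))
   (fun s => f s - (c + m * (y - s))) x y Hxy).
cbv beta in H1. enough (F x - (c * x - / 2 * m * (y - x) ^ 2) <=
   F y - (c * y - / 2 * m * (y - y) ^ 2)) by nra.
apply H1.
- intros z. apply (is_derive_minus F (fun s => c * s - / 2 * m * (y - s) ^ 2)); [apply HF|].
  auto_derive; auto. field.
- intros z Hz. specialize (H z Hz). lra.
Qed.

(** The extremum that defines the Godunov flux is attained, at th. *)
Lemma godunov_spec f um up : cont f -> exists th,
  Rmin um up <= th <= Rmax um up /\ godunov f um up = f th /\
  (um <= up -> forall s, um <= s <= up -> f th <= f s) /\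
  (up <= um -> forall s, up <= s <= um -> f s <= f th).
Proof.
intros Cf.
assert (Cp : forall c d, forall x, c <= x <= d -> continuity_pt f x)
  by (intros; apply continuity_pt_filterlim, Cf).
unfold godunov. destruct (Rlt_dec um up) as [H|H].
- destruct (continuity_ab_min f um up ltac:(lra) (Cp _ _)) as [th [Hmin Hth]].
  exists th. rewrite Rmin_left, Rmax_right by lra. split; auto. split; [|split; auto; lra].
  unfold min_on. rewrite (is_glb_Rbar_unique _ (Finite (f th))); [reflexivity|].
  split.
  + intros y [w [Hw ->]]. simpl. auto.
  + intros l Hl. apply Hl. exists th; auto.
- destruct (continuity_ab_maj f up um ltac:(lra) (Cp _ _)) as [th [Hmax Hth]].
  exists th. rewrite Rmin_right, Rmax_left by lra. split; auto. split; [|split; auto].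
  + unfold max_on. rewrite (is_lub_Rbar_unique _ (Finite (f th))); [reflexivity|].
    split.
    * intros y [w [Hw ->]]. simpl. auto.
    * intros l Hl. apply Hl. exists th; auto.
  + intros H1 s Hs. replace s with um by lra. replace th with um by lra. lra.
Qed.

Lemma godunov_monotone f um up : cont f -> (forall x y, x <= y -> f x <= f y) ->
  godunov f um up = f um.
Proof.
intros Cf Hm. destruct (godunov_spec f um up Cf) as [th [Hth [-> [H1 H2]]]].
unfold Rmin, Rmax in Hth. destruct (Rle_dec um up) as [H|H].
- apply Rle_antisym; [apply H1; lra|apply Hm; lra].
- apply Rle_antisym; [apply Hm; lra|apply H2; lra].
Qed.

(** Entropy dissipation of the Godunov flux: where f is strictly monotone between the
    traces the production is at most minus half the speed times the squared jump, and it
    is never positive. *)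
Lemma godunov_dissipation f f1 F r L L2 al ga :
  flux_data f f1 F r L L2 -> Rabs al <= r -> Rabs ga <= r ->
  node_term F al ga (godunov f al ga)
  <= - (/ 2 * Rmax 0 (Rabs (f1 al) - L2 * Rabs (ga - al)) * (ga - al) ^ 2).
Proof.
intros Hf Ha Hg.
assert (HF := flux_primitive Hf).
assert (Hd := flux_derive Hf).
assert (HL2 := flux_L2 Hf).
destruct (godunov_spec f al ga (is_derive_cont _ _ Hd)) as [th [Hth [-> [Hmin Hmax]]]].
set (m := Rmax 0 (Rabs (f1 al) - L2 * Rabs (ga - al))).
assert (HFo : forall s, is_derive (fun s => - F s) s (- f s)).
{ intros s. apply (is_derive_opp F), HF. }
(* On the hull the speed keeps its sign and stays at least m in modulus. *)
assert (Hs : m = 0 \/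
  (forall x y, Rmin al ga <= x -> x <= y -> y <= Rmax al ga -> f x + m * (y - x) <= f y) \/
  (forall x y, Rmin al ga <= x -> x <= y -> y <= Rmax al ga -> f y + m * (y - x) <= f x)).
{ unfold m, Rmax at 1. destruct (Rle_dec 0 (Rabs (f1 al) - L2 * Rabs (ga - al))) as [H|H]; [right|now left].
  assert (Em : m = Rabs (f1 al) - L2 * Rabs (ga - al)).
  { unfold m, Rmax. destruct (Rle_dec 0 (Rabs (f1 al) - L2 * Rabs (ga - al))); lra. }
  fold m.
  assert (Hz : forall z, Rmin al ga <= z <= Rmax al ga ->
     Rabs (f1 z - f1 al) <= L2 * Rabs (ga - al)).
  { intros z Hz. eapply Rle_trans; [apply (flux_lip Hf); auto|].
    - now apply (between_bound _ _ _ r Hz).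
    - apply Rmult_le_compat_l; auto. now apply between_abs. }
  assert (Hm : forall x y, Rmin al ga <= x -> x <= y -> y <= Rmax al ga -> exists z,
    Rmin al ga <= z <= Rmax al ga /\ f y - f x = f1 z * (y - x)).
  { intros x y Hx Hxy Hy. destruct (mean_value f f1 x y Hd) as [z [Hz1 Ez]].
    rewrite Rmin_left, Rmax_right in Hz1 by lra. exists z; split; auto; lra. }
  destruct (Rle_dec 0 (f1 al)) as [Hp|Hp].
  - left. rewrite Rabs_pos_eq in Em by auto. intros x y Hx Hxy Hy.
    destruct (Hm x y Hx Hxy Hy) as [z [Hz1 Ez]].
    assert (H1 := Hz z Hz1). apply Rabs_le_between in H1.
    assert (m * (y - x) <= f1 z * (y - x)) by (apply Rmult_le_compat_r; lra). lra.
  - right. rewrite Rabs_left in Em by lra. intros x y Hx Hxy Hy.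
    destruct (Hm x y Hx Hxy Hy) as [z [Hz1 Ez]].
    assert (H1 := Hz z Hz1). apply Rabs_le_between in H1.
    assert (f1 z * (y - x) <= - m * (y - x)) by (apply Rmult_le_compat_r; lra). lra. }
unfold node_term. destruct (Rle_dec al ga) as [Hle|Hle].
- rewrite Rmin_left, Rmax_right in * by lra. specialize (Hmin Hle).
  enough (f th * (ga - al) + / 2 * m * (ga - al) ^ 2 <= F ga - F al) by lra.
  destruct Hs as [Hs|[Hs|Hs]].
  + apply (area_from_left f); auto. intros s Hs1. rewrite Hs. specialize (Hmin s Hs1). lra.
  + apply (area_from_left f); auto. intros s Hs1.
    assert (H1 := Hmin al ltac:(lra)). assert (H2 := Hs al s ltac:(lra) ltac:(lra) ltac:(lra)). lra.
  + apply (area_from_right f); auto. intros s Hs1.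
    assert (H1 := Hmin ga ltac:(lra)). assert (H2 := Hs s ga ltac:(lra) ltac:(lra) ltac:(lra)). lra.
- rewrite Rmin_right, Rmax_left in * by lra. specialize (Hmax ltac:(lra)).
  enough ((- f th) * (al - ga) + / 2 * m * (al - ga) ^ 2 <= - F al - - F ga) by lra.
  destruct Hs as [Hs|[Hs|Hs]].
  + apply (area_from_left (fun s => - f s) (fun s => - F s)); [lra|auto|]. intros s Hs1.
    rewrite Hs. specialize (Hmax s Hs1). lra.
  + apply (area_from_right (fun s => - f s) (fun s => - F s)); [lra|auto|]. intros s Hs1.
    assert (H1 := Hmax al ltac:(lra)). assert (H2 := Hs s al ltac:(lra) ltac:(lra) ltac:(lra)). lra.
  + apply (area_from_left (fun s => - f s) (fun s => - F s)); [lra|auto|]. intros s Hs1.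
    assert (H1 := Hmax ga ltac:(lra)). assert (H2 := Hs ga s ltac:(lra) ltac:(lra) ltac:(lra)). lra.
Qed.

(** Being the mean of f between the traces, this flux produces no entropy at all. *)
Lemma conservative_spec f F um up : cont f -> (forall s, is_derive F s (f s)) ->
  exists th, Rmin um up <= th <= Rmax um up /\ conservative f um up = f th /\
  node_term F um up (f th) = 0.
Proof.
intros Cf HF.
assert (HI : forall x, RInt f 0 x = F x - F 0).
{ intros x. assert (H : is_RInt f 0 x (minus (F x) (F 0))) by (apply (is_RInt_derive F); auto).
  exact (is_RInt_unique (V := R_CompleteNormedModule) _ _ _ _ H). }
unfold conservative, node_term. destruct (Req_EM_T up um) as [->|Hne].
- exists um. rewrite Rmin_left, Rmax_left by lra. split; [lra|split; [|ring]].
  unfold average. f_equal. field.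
- destruct (mean_value F f um up HF) as [th [Hth E]]. exists th. split; auto.
  rewrite !HI. split.
  + replace (F up - F 0 - (F um - F 0)) with (F up - F um) by ring. rewrite E. field; lra.
  + lra.
Qed.

(** Node estimate for a monotone flux function, where the Godunov flux is upwind and
    the projection error vanishes on the upwind side: no error at all. *)
Lemma node_upwind f f1 F r L L2 al ga be : flux_data f f1 F r L L2 ->
  (forall x y, x <= y -> f x <= f y) ->
  node_term F al be (godunov f al ga) <= 0.
Proof.
intros Hf Hm. assert (Cf := is_derive_cont _ _ (flux_derive Hf)).
rewrite godunov_monotone by auto. unfold node_term.
destruct (mean_value F f al be (flux_primitive Hf)) as [z [Hz E]].
enough (0 <= (f z - f al) * (be - al)) by lra.
unfold Rmin, Rmax in Hz. destruct (Rle_dec al be) as [H|H].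
- assert (H1 := Hm al z ltac:(lra)). apply Rmult_le_pos; lra.
- assert (H1 := Hm z al ltac:(lra)).
  replace ((f z - f al) * (be - al)) with ((f al - f z) * (al - be)) by ring.
  apply Rmult_le_pos; lra.
Qed.

Lemma abs_shift_le u x e r : Rabs u <= r - 2 -> Rabs x <= 1 -> Rabs e <= 1 ->
  Rabs (u + x) <= r /\ Rabs (u + x - e) <= r.
Proof.
intros Hu Hx He. assert (H := Rabs_triang u x). split; [lra|].
unfold Rminus. eapply Rle_trans; [apply Rabs_triang|]. rewrite Rabs_Ropp. lra.
Qed.

(** Node estimate for the Godunov flux of a possibly sonic f, with the projection error
    vanishing on the left: the part of the error that is linear in the jump carries the
    factor |f1| and is absorbed by the dissipation. *)
Lemma node_godunov f f1 F r L L2 A h u xm xp ep :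
  flux_data f f1 F r L L2 -> 0 <= A -> 0 <= h -> Rabs u <= r - 2 -> Rabs xm <= 1 -> Rabs xp <= 1 ->
  Rabs ep <= 1 -> Rabs ep <= A * h ->
  node_term F (u + xm) (u + xp) (godunov f (u + xm) (u + xp - ep))
  <= (2 * L + 16 * L2 * (1 + A)) * (ep ^ 2 + h * (xm ^ 2 + xp ^ 2)).
Proof.
intros Hf HA Hh Hu Hm Hp He HeA.
assert (HL := flux_L Hf). assert (HL2 := flux_L2 Hf).
destruct (abs_shift_le u xm 0 r Hu Hm ltac:(rewrite Rabs_R0; lra)) as [Ba Ba'].
destruct (abs_shift_le u xp ep r Hu Hp He) as [Bb Bb'].
set (al := u + xm) in *. set (be := u + xp) in *.
assert (HD := godunov_dissipation f f1 F r L L2 al (be - ep) Hf Ba Bb').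
destruct (godunov_spec f al (be - ep) (is_derive_cont _ _ (flux_derive Hf)))
  as [th [Hth [Eg _]]].
rewrite Eg in *. rewrite <- (Rminus_0_r al) in HD, Hth.
assert (H := node_term_le f f1 F r L L2 al be 0 ep th _ Hf Ba Bb Ba' Bb' Hth HD).
cbv zeta in H. rewrite !Rminus_0_r, Rabs_R0, !Rplus_0_l in H.
set (d0 := Rabs (be - ep - al)) in *. set (e := Rabs ep) in *.
set (a := Rabs (f1 al)) in *. set (m := Rmax 0 (a - L2 * d0)) in *.
assert (Ha : 0 <= a <= L) by (split; [apply Rabs_pos|apply (flux_bound Hf); auto]).
assert (Hd0 : 0 <= d0) by apply Rabs_pos. assert (He0 : 0 <= e) by apply Rabs_pos.
assert (HLd : 0 <= L2 * d0) by nonneg.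
assert (Hm0 : 0 <= m) by apply Rmax_l.
assert (Hm1 : a - L2 * d0 <= m) by apply Rmax_r.
assert (Hm2 : m <= L) by (apply Rmax_lub; lra).
replace ((be - ep - al) ^ 2) with (d0 ^ 2) in H by apply pow2_abs.
replace (ep ^ 2) with (e ^ 2) by apply pow2_abs.
eapply Rle_trans; [apply H|].
set (x2 := xm ^ 2 + xp ^ 2).
assert (Hx2 : 0 <= x2) by (unfold x2; assert (I1 := pow2_ge_0 xm); assert (I2 := pow2_ge_0 xp); lra).
assert (Hd2 : d0 ^ 2 <= 4 * x2 + 2 * e ^ 2).
{ unfold d0, e, x2, al, be. rewrite !pow2_abs.
  replace (u + xp - ep - (u + xm)) with (xp - xm - ep) by ring.
  assert (I1 := pow2_ge_0 (xp - xm + ep)). assert (I2 := pow2_ge_0 (xp + xm)). nra. }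
(* The speed a exceeds m by at most L2 d0; only m d0 e is linear in the jump d0, and it
   is absorbed by the dissipation. *)
assert (S1 : (a + L2 * (d0 + e)) * (d0 + e) * e <=
  m * d0 * e + m * e ^ 2 + L2 * e * (4 * d0 ^ 2 + 3 * e ^ 2)).
{ apply Rle_trans with ((m + L2 * d0 + L2 * (d0 + e)) * (d0 + e) * e).
  - apply Rmult_le_compat_r; auto. apply Rmult_le_compat_r; lra.
  - replace ((m + L2 * d0 + L2 * (d0 + e)) * (d0 + e) * e)
      with (m * d0 * e + m * e ^ 2 + L2 * e * (2 * d0 ^ 2 + 3 * (d0 * e) + e ^ 2)) by ring.
    apply Rplus_le_compat_l. apply Rmult_le_compat_l; [now apply Rmult_le_pos|].
    assert (I := half_squares d0 e Hd0 He0). assert (I1 := pow2_ge_0 d0).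
    assert (I2 := pow2_ge_0 e). lra. }
assert (S2 : m * d0 * e <= / 2 * m * d0 ^ 2 + / 2 * m * e ^ 2).
{ assert (I := half_squares d0 e Hd0 He0).
  apply (Rmult_le_compat_l m) in I; auto. lra. }
assert (S3 : m * e ^ 2 <= L * e ^ 2) by (apply Rmult_le_compat_r; [apply pow2_ge_0|auto]).
assert (S4 : L2 * e * (4 * d0 ^ 2 + 3 * e ^ 2) <= L2 * (16 * (A * h) * x2 + 11 * e ^ 2)).
{ rewrite Rmult_assoc. apply Rmult_le_compat_l; auto.
  assert (I2 := pow2_ge_0 e).
  assert (e * (4 * d0 ^ 2 + 3 * e ^ 2) <= e * (16 * x2 + 11 * e ^ 2))
    by (apply Rmult_le_compat_l; lra).
  assert (e * x2 <= A * h * x2) by (apply Rmult_le_compat_r; auto).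
  assert (e * e ^ 2 <= 1 * e ^ 2) by (apply Rmult_le_compat_r; auto). lra. }
assert (I2 := pow2_ge_0 e).
assert (T1 : 0 <= L * e ^ 2) by nonneg.
assert (T2 : 0 <= L2 * e ^ 2) by nonneg.
assert (T3 : 0 <= L2 * A * e ^ 2) by nonneg.
assert (T4 : 0 <= h * x2) by nonneg.
assert (0 <= L * (h * x2)) by nonneg.
assert (0 <= L2 * (h * x2)) by nonneg. lra.
Qed.

(** Node estimate for the conservative flux: without dissipation the linear part of
    the error is split between the two sides by Young's inequality with weight h. *)
Lemma node_conservative f f1 F r L L2 h u xm xp em ep :
  flux_data f f1 F r L L2 -> 0 < h <= 1 -> Rabs u <= r - 2 -> Rabs xm <= 1 -> Rabs xp <= 1 ->
  Rabs em <= 1 -> Rabs ep <= 1 ->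
  node_term F (u + xm) (u + xp) (conservative f (u + xm - em) (u + xp - ep))
  <= 5 * (L + 6 * L2) * (/ h * (em ^ 2 + ep ^ 2) + h * (xm ^ 2 + xp ^ 2)).
Proof.
intros Hf Hh Hu Hm Hp Hem Hep.
assert (HL := flux_L Hf). assert (HL2 := flux_L2 Hf).
destruct (abs_shift_le u xm em r Hu Hm Hem) as [Ba Ba'].
destruct (abs_shift_le u xp ep r Hu Hp Hep) as [Bb Bb'].
set (al := u + xm) in *. set (be := u + xp) in *.
destruct (conservative_spec f F (al - em) (be - ep)
  (is_derive_cont _ _ (flux_derive Hf)) (flux_primitive Hf))
  as [th [Hth [Eg H0]]].
rewrite Eg. assert (H := node_term_le f f1 F r L L2 al be em ep th _ Hf Ba Bb Ba' Bb' Hth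
  (Req_le _ _ H0)).
cbv zeta in H. rewrite Rplus_0_l in H. eapply Rle_trans; [apply H|].
set (d := Rabs (be - ep - (al - em)) + (Rabs em + Rabs ep)).
set (e := Rabs em + Rabs ep). set (X := Rabs xm + Rabs xp).
assert (He0 : 0 <= e) by (assert (I1 := Rabs_pos em); assert (I2 := Rabs_pos ep); unfold e; lra).
assert (HX0 : 0 <= X) by (assert (I1 := Rabs_pos xm); assert (I2 := Rabs_pos xp); unfold X; lra).
assert (Hd : d <= X + 2 * e).
{ unfold d, al, be. replace (u + xp - ep - (u + xm - em)) with ((xp + - xm) + (- ep + em)) by ring.
  assert (I1 := Rabs_triang (xp + - xm) (- ep + em)).
  assert (I2 := Rabs_triang xp (- xm)). assert (I3 := Rabs_triang (- ep) em).
  rewrite Rabs_Ropp in I2, I3. unfold X, e. lra. }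
assert (Hd0 : 0 <= d) by (assert (I := Rabs_pos (be - ep - (al - em))); unfold d; fold e; lra).
assert (Hd6 : d <= 6) by (unfold X, e in *; lra).
assert (Ha : Rabs (f1 al) <= L) by (apply (flux_bound Hf); auto).
apply Rle_trans with ((L + 6 * L2) * ((X + 2 * e) * e)).
- rewrite Rmult_assoc. apply Rmult_le_compat.
  + assert (I := Rabs_pos (f1 al)). assert (0 <= L2 * d) by nonneg. lra.
  + now apply Rmult_le_pos.
  + assert (L2 * d <= L2 * 6) by now apply Rmult_le_compat_l. lra.
  + now apply Rmult_le_compat_r.
- rewrite (Rmult_comm 5), Rmult_assoc. apply Rmult_le_compat_l; [lra|].
  set (e2 := em ^ 2 + ep ^ 2). set (x2 := xm ^ 2 + xp ^ 2).
  assert (He2 : e ^ 2 <= 2 * e2).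
  { unfold e, e2. rewrite <- (pow2_abs em), <- (pow2_abs ep).
    assert (I := pow2_ge_0 (Rabs em - Rabs ep)). lra. }
  assert (HX2 : X ^ 2 <= 2 * x2).
  { unfold X, x2. rewrite <- (pow2_abs xm), <- (pow2_abs xp).
    assert (I := pow2_ge_0 (Rabs xm - Rabs xp)). lra. }
  assert (He2p : 0 <= e2) by (assert (I := pow2_ge_0 e); lra).
  assert (HXe : X * e <= / 2 * (h * X ^ 2) + / 2 * (/ h * e ^ 2)).
  { assert (I : 0 <= / h * (h * X - e) ^ 2).
    { apply Rmult_le_pos; [apply Rlt_le, Rinv_0_lt_compat; lra|apply pow2_ge_0]. }
    replace (/ h * (h * X - e) ^ 2) with (h * X ^ 2 - 2 * (X * e) + / h * e ^ 2) in I
      by (field; lra). lra. }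
  assert (Hih : 1 <= / h) by (rewrite <- Rinv_1; apply Rinv_le_contravar; lra).
  assert (J1 : h * X ^ 2 <= h * (2 * x2)) by (apply Rmult_le_compat_l; lra).
  assert (J2 : / h * e ^ 2 <= / h * (2 * e2)) by (apply Rmult_le_compat_l; lra).
  assert (J3 : 1 * e2 <= / h * e2) by (apply Rmult_le_compat_r; lra).
  assert (J4 : 0 <= h * x2).
  { apply Rmult_le_pos; [lra|]. assert (I := pow2_ge_0 X); lra. }
  replace ((X + 2 * e) * e) with (X * e + 2 * e ^ 2) by ring. lra.
Qed.

(** * The energy inequality at a fixed time *)

Lemma weighted_young w x y : 0 < w -> x * y <= w * y ^ 2 + / (4 * w) * x ^ 2.
Proof.
intros Hw. assert (I : 0 <= / (4 * w) * (2 * w * y - x) ^ 2).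
{ apply Rmult_le_pos; [apply Rlt_le, Rinv_0_lt_compat; lra|apply pow2_ge_0]. }
replace (/ (4 * w) * (2 * w * y - x) ^ 2) with (w * y ^ 2 + / (4 * w) * x ^ 2 - x * y) in I
  by (field; lra).
lra.
Qed.

(** Sup bounds on the cells instead of an L2 norm, because traces are needed as well;
    Sq is of the order h^(2k+1), one power of h short of the squared L2 norm. *)
Definition cell_bounded {a b} (m : mesh a b) (eta : nat -> R -> R) (Sq : R) : Prop :=
  exists s : nat -> R,
    (forall j x, (j < ncell m)%nat -> node m j <= x <= node m (S j) -> eta j x ^ 2 <= s j) /\
    bigsum (ncell m) s <= Sq.

Lemma cell_bounded_ip {a b} (m : mesh a b) eta Sq : cell_bounded m eta Sq -> pw_cont m eta ->
  ip m eta eta <= hmax m * Sq.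
Proof.
intros [s [H HS]] Hc. apply Rle_trans with (hmax m * bigsum (ncell m) s).
- rewrite <- bigsum_scal. apply bigsum_le; intros j Hj. specialize (Hc j Hj).
  assert (Hw := width_pos m j Hj). assert (Hw1 := width_le_hmax m j Hj).
  assert (Hs : 0 <= s j).
  { eapply Rle_trans; [apply pow2_ge_0|apply (H j (node m j) Hj)]. assert (I := cell_le m j Hj); lra. }
  apply Rle_trans with (width m j * s j); [|now apply Rmult_le_compat_r].
  unfold width. rewrite <- RInt_const_R. apply RInt_le_cont; [now apply cell_le|cont_tac|apply cont_const|].
  intros x Hx. replace (eta j x * eta j x) with (eta j x ^ 2) by ring. apply H; auto; lra.
- apply Rmult_le_compat_l; auto. apply Rlt_le, hmax_pos.
Qed.

Lemma cell_bounded_traces {a b} (m : mesh a b) eta Sq : cell_bounded m eta Sq ->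
  bigsum (ncell m) (fun i => trace_minus m eta i ^ 2 + trace_plus m eta i ^ 2) <= 2 * Sq.
Proof.
intros [s [H HS]]. eapply Rle_trans; [apply (sum_traces_le m eta s H)|lra].
Qed.

Definition inverse_const (k : nat) (Ci : R) : Prop := forall c d g x, c < d -> is_poly k g ->
  c <= x <= d ->
  (d - c) * g x ^ 2 <= Ci * RInt (fun x => g x ^ 2) c d /\
  (d - c) ^ 3 * Derive g x ^ 2 <= Ci * RInt (fun x => g x ^ 2) c d.

(** Traces of a discrete function cost half a power of h; quasi-uniformity lets a trace
    from either side of a node be weighted by the global h. *)
Lemma inverse_traces {a b} (m : mesh a b) k Ci sigma v : inverse_const k Ci -> 0 < Ci ->
  hmax m / hmin m <= sigma -> Vh m k v ->
  hmax m * bigsum (ncell m) (fun i => trace_minus m v i ^ 2 + trace_plus m v i ^ 2)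
  <= 2 * sigma * Ci * ip m v v.
Proof.
intros Hi HCi Hs Hv. assert (Hh := hmax_pos m).
assert (Hsig : 0 < sigma).
{ assert (H := hmax_le_width m sigma 0 Hs (ncell_pos _ _ m)).
  assert (H1 := width_pos m 0 (ncell_pos _ _ m)).
  apply (Rmult_lt_reg_r (width m 0)); lra. }
assert (H := sum_traces_le m v (fun j => / hmax m * (sigma * Ci * cell_int m j (fun x => v j x * v j x)))).
rewrite bigsum_scal, bigsum_scal in H. fold (ip m v v) in H.
apply (Rmult_le_reg_l (/ hmax m)); [now apply Rinv_0_lt_compat|].
rewrite <- Rmult_assoc, Rinv_l, Rmult_1_l by lra.
eapply Rle_trans; [apply H|apply Req_le; ring].
intros j x Hj Hx. assert (Hc := node_incr _ _ m j Hj).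
destruct (Hi _ _ _ x Hc (Hv j Hj) Hx) as [H1 _].
rewrite (RInt_ext_R _ (fun x => v j x * v j x)) in H1 by (intros; ring).
fold (cell_int m j (fun x => v j x * v j x)) in H1. fold (width m j) in H1.
apply (Rmult_le_reg_l (hmax m)); auto. rewrite <- (Rmult_assoc (hmax m)), Rinv_r, Rmult_1_l by lra.
apply Rle_trans with (sigma * width m j * v j x ^ 2).
- apply Rmult_le_compat_r; [apply pow2_ge_0|]. now apply hmax_le_width.
- rewrite !Rmult_assoc. apply Rmult_le_compat_l; lra.
Qed.

Definition interp_error (g : R -> R) (pg : nat -> R -> R) : nat -> R -> R :=
  fun j x => g x - pg j x.

Lemma interp_error_cont {a b} (m : mesh a b) k g pg : cont g -> Vh m k pg ->
  pw_cont m (interp_error g pg).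
Proof.
intros Hg Hp j Hj. assert (H := Vh_cont _ _ _ Hp j Hj). unfold interp_error. cont_tac.
Qed.

Definition mean_free {a b} (m : mesh a b) (k : nat) (eta : nat -> R -> R) : Prop :=
  forall phi, Vh m k phi -> forall j, (j < ncell m)%nat ->
    cell_int m j (fun x => eta j x * Derive (phi j) x) = 0.

Lemma ddx_mean_free {a b} (m : mesh a b) k th eta phi : mean_free m k eta -> Vh m k phi ->
  ddx m th eta phi = bigsum (ncell m) (fun i => at_nodes m (lin th) eta i
     * (trace_minus m phi i - trace_plus m phi i)).
Proof.
intros Hm Hp. rewrite <- sum_bracket by apply at_nodes_periodic. unfold ddx.
apply bigsum_ext; intros j Hj. rewrite (Hm phi Hp j Hj). ring.
Qed.

(** Consistency residual of the discrete derivative on a projection error: in general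
    it loses a full power of h through the traces. *)
Lemma ddx_residual {a b} (m : mesh a b) k th Ci sigma eta Sq e :
  inverse_const k Ci -> 0 < Ci -> hmax m / hmin m <= sigma -> 0 <= th <= 1 ->
  mean_free m k eta -> cell_bounded m eta Sq -> 0 < e ->
  forall phi, Vh m k phi ->
  Rabs (ddx m th eta phi) <= e * ip m phi phi + (4 * sigma * Ci / e) * (/ hmax m * Sq).
Proof.
intros Hi HCi Hs Hth Hm HS He phi Hp. rewrite (ddx_mean_free m k) by auto.
assert (Hh := hmax_pos m).
assert (Hsig : 0 < sigma).
{ assert (H := hmax_le_width m sigma 0 Hs (ncell_pos _ _ m)).
  assert (H1 := width_pos m 0 (ncell_pos _ _ m)).
  apply (Rmult_lt_reg_r (width m 0)); lra. }
set (w := e / (4 * sigma * Ci) * hmax m).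
assert (HsC : 0 < sigma * Ci) by now apply Rmult_lt_0_compat.
assert (Hw : 0 < w) by (apply Rmult_lt_0_compat; auto; apply Rdiv_lt_0_compat; lra).
assert (H1 := inverse_traces m k Ci sigma phi Hi HCi Hs Hp).
assert (H2 := cell_bounded_traces m eta Sq HS).
set (Tp := bigsum (ncell m) (fun i => trace_minus m phi i ^ 2 + trace_plus m phi i ^ 2)) in *.
set (Te := bigsum (ncell m) (fun i => trace_minus m eta i ^ 2 + trace_plus m eta i ^ 2)) in *.
apply Rle_trans with (2 * w * Tp + / (4 * w) * (2 * Te)).
- eapply Rle_trans; [apply bigsum_Abs|]. unfold Tp, Te.
  rewrite <- !bigsum_scal, <- bigsum_plus. apply bigsum_le; intros i Hi0.
  unfold at_nodes, lin. set (em := trace_minus m eta i). set (ep := trace_plus m eta i).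
  set (pm := trace_minus m phi i). set (pp := trace_plus m phi i).
  rewrite Rabs_mult. set (x := Rabs (th * em + (1 - th) * ep)). set (y := Rabs (pm - pp)).
  assert (Hx : x ^ 2 <= 2 * (em ^ 2 + ep ^ 2)).
  { unfold x. rewrite pow2_abs.
    assert (I0 : th * em * ((1 - th) * ep) = th * (1 - th) * (em * ep)) by ring.
    assert (I1 := pow2_ge_0 (em - ep)). assert (I2 := pow2_ge_0 em). assert (I3 := pow2_ge_0 ep).
    replace ((th * em + (1 - th) * ep) ^ 2) with
      (th * em ^ 2 + (1 - th) * ep ^ 2 - th * (1 - th) * (em - ep) ^ 2) by ring.
    assert (0 <= th * (1 - th) * (em - ep) ^ 2)
      by (apply Rmult_le_pos; [apply Rmult_le_pos; lra|auto]).
    assert (th * em ^ 2 <= 1 * em ^ 2) by (apply Rmult_le_compat_r; lra).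
    assert ((1 - th) * ep ^ 2 <= 1 * ep ^ 2) by (apply Rmult_le_compat_r; lra). lra. }
  assert (Hy : y ^ 2 <= 2 * (pm ^ 2 + pp ^ 2)).
  { unfold y. rewrite pow2_abs. assert (I1 := pow2_ge_0 (pm + pp)). lra. }
  assert (Hxy : x * y <= w * y ^ 2 + / (4 * w) * x ^ 2) by now apply weighted_young.
  assert (J1 : w * y ^ 2 <= w * (2 * (pm ^ 2 + pp ^ 2))) by (apply Rmult_le_compat_l; lra).
  assert (J2 : / (4 * w) * x ^ 2 <= / (4 * w) * (2 * (em ^ 2 + ep ^ 2))).
  { apply Rmult_le_compat_l; auto. apply Rlt_le, Rinv_0_lt_compat; lra. }
  lra.
- apply Rplus_le_compat.
  + replace (2 * w * Tp) with (e / (2 * sigma * Ci) * (hmax m * Tp)) by (unfold w; field; split; lra).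
    replace (e * ip m phi phi) with (e / (2 * sigma * Ci) * (2 * sigma * Ci * ip m phi phi))
      by (field; split; lra).
    apply Rmult_le_compat_l; auto. apply Rlt_le, Rdiv_lt_0_compat; lra.
  + replace (4 * sigma * Ci / e * (/ hmax m * Sq)) with (/ (4 * w) * (2 * (2 * Sq)))
      by (unfold w; field; repeat split; lra).
    apply Rmult_le_compat_l; [apply Rlt_le, Rinv_0_lt_compat; lra|lra].
Qed.

(** Nonlinear part of the energy identity: the interior estimates are summed and
    the boundary values of the relative entropy are collected at the nodes. *)
Lemma nonlinear_sum {a b} (m : mesh a b) k f f1 F r R1 L L2 A Ci (fhat : R -> R -> R)
    (u : R -> R) (uh pu : nat -> R -> R) (nu : nat -> R) :
  let eta := interp_error u pu in
  let xi := fun j x => uh j x - pu j x in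
  flux_data f f1 F r L L2 -> 0 <= A -> 0 <= R1 -> inverse_const k Ci ->
  smooth 1 u -> u a = u b -> Vh m k uh -> Vh m k pu -> mean_free m k eta ->
  (forall x, a <= x <= b -> Rabs (u x) <= r - 2 /\ Rabs (Derive u x) <= R1) ->
  (forall j x, (j < ncell m)%nat -> node m j <= x <= node m (S j) ->
     Rabs (xi j x) <= 1 /\ Rabs (eta j x) <= 1 /\ Rabs (eta j x) <= A * width m j) ->
  (forall i, (i < ncell m)%nat ->
     node_term F (u (node m i) + trace_minus m xi i) (u (node m i) + trace_plus m xi i)
       (at_nodes m fhat uh i) <= nu i) ->
  bigsum (ncell m) (fun j => cell_int m j (fun x => (f (uh j x) - f (u x)) * Derive (xi j) x)
     - bracket m (fun i => at_nodes m fhat uh i - f (u (node m i))) xi j)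
  <= L2 * (A + 2 * R1) * ((1 + Ci) * ip m xi xi + ip m eta eta) + bigsum (ncell m) nu.
Proof.
intros eta xi Hf HA HR1 HCi Su Hab Huh Hpu Hmf Hub Hb Hnu.
assert (Hxi : Vh m k xi) by now apply Vh_minus.
assert (Ceta : pw_cont m eta) by (apply (interp_error_cont m k); auto; now apply (smooth_cont 1)).
set (g := at_nodes m fhat uh) in *.
set (H := fun i s => F (u (node m i) + s) - F (u (node m i)) - g i * s).
set (Cn := L2 * (A + 2 * R1)).
assert (HCn : 0 <= Cn).
{ apply Rmult_le_pos; [apply (flux_L2 Hf)|lra]. }
apply Rle_trans with (bigsum (ncell m) (fun j =>
   (H (S j) (trace_minus m xi (S j)) - H j (trace_plus m xi j))
   + Cn * ((1 + Ci) * cell_int m j (fun x => xi j x * xi j x)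
           + cell_int m j (fun x => eta j x * eta j x)))).
- apply bigsum_le; intros j Hj. assert (Hc := node_incr _ _ m j Hj).
  set (c := node m j) in *. set (d := node m (S j)) in *.
  assert (Pxi : is_poly k (xi j)) by now apply Hxi.
  assert (Cxi := is_poly_cont _ _ Pxi). assert (Cdxi := is_poly_cont_Derive _ _ Pxi).
  specialize (Ceta j Hj).
  assert (I := interior_cell f f1 F r R1 L L2 A k c d u (xi j) (eta j) Hf HA HR1 Hc Su Pxi Ceta).
  assert (I1 : forall x, c <= x <= d -> Rabs (u x) <= r - 2 /\ Rabs (Derive u x) <= R1 /\
     Rabs (xi j x) <= 1 /\ Rabs (eta j x) <= 1 /\ Rabs (eta j x) <= A * (d - c)).
  { intros x Hx. destruct (Hb j x Hj Hx) as [B1 [B2 B3]].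
    destruct (Hub x (cell_in_domain m j x Hj Hx)) as [B4 B5]. repeat split; auto. }
  specialize (I I1 (Hmf xi Hxi j Hj)).
  assert (E1 : cell_int m j (fun x => (f (uh j x) - f (u x)) * Derive (xi j) x)
    = RInt (fun x => (f (u x + xi j x - eta j x) - f (u x)) * Derive (xi j) x) c d).
  { apply RInt_ext_R; intros x.
    replace (u x + xi j x - eta j x) with (uh j x) by (unfold xi, eta, interp_error; ring).
    reflexivity. }
  rewrite E1. unfold cell_int. fold c d.
  rewrite (RInt_ext_R (fun x => xi j x * xi j x) (fun x => xi j x ^ 2)) by (intros; ring).
  rewrite (RInt_ext_R (fun x => eta j x * eta j x) (fun x => eta j x ^ 2)) by (intros; ring).
  set (Ix := RInt (fun x => xi j x ^ 2) c d) in *. set (Ie := RInt (fun x => eta j x ^ 2) c d) in *.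
  assert (I2 : (d - c) ^ 2 * RInt (fun x => Derive (xi j) x ^ 2) c d <= Ci * Ix).
  { apply (Rmult_le_reg_l (d - c)); [lra|].
    replace ((d - c) * ((d - c) ^ 2 * RInt (fun x => Derive (xi j) x ^ 2) c d))
      with ((d - c) ^ 3 * RInt (fun x => Derive (xi j) x ^ 2) c d) by ring.
    rewrite <- RInt_scal_cont by cont_tac. rewrite <- RInt_const_R.
    apply RInt_le_cont; [lra|cont_tac|apply cont_const|]. intros x Hx.
    apply (HCi c d (xi j) x Hc Pxi); lra. }
  assert (I3 : Cn * (Ix + Ie + (d - c) ^ 2 * RInt (fun x => Derive (xi j) x ^ 2) c d)
     <= Cn * (Ix + Ie + Ci * Ix)) by (apply Rmult_le_compat_l; lra).
  unfold bracket, H. rewrite !trace_minus_S, !trace_plus_lt by auto. fold c d. fold Cn in I.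
  unfold rel_entropy in I. lra.
- rewrite bigsum_plus, bigsum_scal, bigsum_plus, bigsum_scal. fold (ip m xi xi) (ip m eta eta).
  rewrite (sum_cells_to_nodes m (fun i => H i (trace_minus m xi i)) (fun i => H i (trace_plus m xi i))).
  + enough (bigsum (ncell m) (fun i => H i (trace_minus m xi i) - H i (trace_plus m xi i))
       <= bigsum (ncell m) nu) by lra.
    apply bigsum_le; intros i Hi. eapply Rle_trans; [|apply (Hnu i Hi)].
    unfold H, node_term. lra.
  + unfold H, g. rewrite trace_minus_periodic, at_nodes_periodic.
    rewrite (node_last _ _ m), (node_first _ _ m), Hab. reflexivity.
Qed.

Record ldg_summed {a b} (m : mesh a b) (k : nat) (f : R -> R) (fhat : R -> R -> R) (th : R)
    (uht uh vh qh : nat -> R -> R) : Prop := LdgSummed {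
  summed_u : forall phi, Vh m k phi ->
    ip m uht phi + bigsum (ncell m) (fun j => bracket m (at_nodes m fhat uh) phi j
       - cell_int m j (fun x => f (uh j x) * Derive (phi j) x)) + ip m vh phi = 0;
  summed_v : forall phi, Vh m k phi -> ip m vh phi - ddx m th qh phi = ddx m th uh phi;
  summed_q : forall phi, Vh m k phi -> ip m qh phi = ddx m (1 - th) vh phi
}.

Lemma bracket_ext {a b} (m : mesh a b) h h' phi j : (forall i, h i = h' i) ->
  bracket m h phi j = bracket m h' phi j.
Proof. intros H. unfold bracket. now rewrite !H. Qed.

Lemma ldg_sum {a b} (m : mesh a b) k f (Fl : fluxes) th uht uh vh qh :
  (forall x y, qhat Fl x y = lin th x y) -> (forall x y, uhat Fl x y = lin th x y) ->
  (forall x y, vhat Fl x y = lin (1 - th) x y) ->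
  ldg_equations m k f Fl uht uh vh qh -> ldg_summed m k f (fhat Fl) th uht uh vh qh.
Proof.
intros Eq Eu Ev H. split; intros phi Hp.
- unfold ip. rewrite <- !bigsum_plus. apply bigsum_zero; intros j Hj.
  destruct (H j Hj) as [H1 _]. specialize (H1 phi Hp). lra.
- unfold ip, ddx. rewrite <- bigsum_minus. apply bigsum_ext; intros j Hj.
  destruct (H j Hj) as [_ [H1 _]]. specialize (H1 phi Hp).
  rewrite (bracket_ext m (at_nodes m (qhat Fl) qh) (at_nodes m (lin th) qh)) in H1
    by (intros; apply Eq).
  rewrite (bracket_ext m (at_nodes m (uhat Fl) uh) (at_nodes m (lin th) uh)) in H1
    by (intros; apply Eu). lra.
- unfold ip, ddx. apply bigsum_ext; intros j Hj.
  destruct (H j Hj) as [_ [_ H1]]. specialize (H1 phi Hp).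
  rewrite (bracket_ext m (at_nodes m (vhat Fl) vh) (at_nodes m (lin (1 - th)) vh)) in H1
    by (intros; apply Ev). exact H1.
Qed.

(** The exact solution at one time: u1 stands for its time derivative and w for the
    nonlocal term. *)
Record exact_slice (a b : R) (f : R -> R) (u u1 w : R -> R) : Prop := ExactSlice {
  slice_u : smooth 1 u;
  slice_w : smooth 2 w;
  slice_u1 : cont u1;
  slice_u_per : u a = u b;
  slice_w_per : w a = w b;
  slice_w1_per : Derive w a = Derive w b;
  slice_elliptic : forall x, w x - Derive (Derive w) x = Derive u x;
  slice_evol : forall x, u1 x + Derive (fun y => f (u y)) x + w x = 0
}.

(** Half the growth rate of the energy. The weight kappa measures the loss at the nodes,
    both in the flux of u and in the linear fluxes: 0 if fluxes and projections match
    perfectly, 1 if only dissipation helps, 1/h without either. All nonlinear terms are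
    quadratic in xi as long as xi is at most 1, which is all that is asked of its size. *)
Lemma energy_rate k r R1 L L2 A Ci sigma Cn Cr :
  0 <= A -> 0 <= R1 -> 0 <= L2 -> 0 < Ci -> 0 < sigma -> 0 <= Cn -> 0 <= Cr -> inverse_const k Ci ->
  exists C, 0 < C /\
  forall a b (m : mesh a b) f f1 F fhat th kappa Sq u u1 w uht uh vh qh pu pu1 pw pq,
  let eta := interp_error u pu in
  let xi := fun j x => uh j x - pu j x in
  flux_data f f1 F r L L2 -> hmax m / hmin m <= sigma -> 0 <= kappa -> 0 <= Sq ->
  exact_slice a b f u u1 w ->
  (forall x, a <= x <= b -> Rabs (u x) <= r - 2 /\ Rabs (Derive u x) <= R1) ->
  Vh m k uht -> Vh m k uh -> Vh m k vh -> Vh m k qh ->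
  Vh m k pu -> Vh m k pu1 -> Vh m k pw -> Vh m k pq ->
  ldg_summed m k f fhat th uht uh vh qh ->
  cell_bounded m eta Sq -> cell_bounded m (interp_error u1 pu1) Sq ->
  cell_bounded m (interp_error w pw) Sq -> cell_bounded m (interp_error (Derive w) pq) Sq ->
  mean_free m k eta ->
  (forall phi, Vh m k phi ->
     Rabs (ddx m th eta phi) <= / 16 * ip m phi phi + Cr * (kappa * Sq) /\
     Rabs (ddx m th (interp_error (Derive w) pq) phi) <= / 16 * ip m phi phi + Cr * (kappa * Sq) /\
     Rabs (ddx m (1 - th) (interp_error w pw) phi) <= / 16 * ip m phi phi + Cr * (kappa * Sq)) ->
  (forall j x, (j < ncell m)%nat -> node m j <= x <= node m (S j) ->
     Rabs (xi j x) <= 1 /\ Rabs (eta j x) <= 1 /\ Rabs (eta j x) <= A * width m j) ->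
  (forall i, (i < ncell m)%nat ->
     node_term F (u (node m i) + trace_minus m xi i) (u (node m i) + trace_plus m xi i)
       (at_nodes m fhat uh i)
     <= Cn * (kappa * (trace_minus m eta i ^ 2 + trace_plus m eta i ^ 2)
              + hmax m * (trace_minus m xi i ^ 2 + trace_plus m xi i ^ 2))) ->
  ip m (fun j x => uht j x - pu1 j x) xi <= C * (ip m xi xi + (kappa + hmax m) * Sq).
Proof.
intros HA HR1 HL2 HCi Hsig HCn HCr Hinv.
set (Cv := L2 * (A + 2 * R1)).
assert (HCv : 0 <= Cv) by nonneg.
exists (Cv * (1 + Ci) + 2 * Cn * (1 + sigma * Ci) + 10 + 8 * Cr).
assert (HsC : 0 < sigma * Ci) by now apply Rmult_lt_0_compat.
split.
{ assert (0 <= Cv * (1 + Ci)) by nonneg.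
  assert (0 <= 2 * Cn * (1 + sigma * Ci)) by nonneg. lra. }
intros a b m f f1 F fhat th kappa Sq u u1 w uht uh vh qh pu pu1 pw pq eta xi
  Hf Hs Hk HS He Hub Vuht Vuh Vvh Vqh Vpu Vpu1 Vpw Vpq [Eu Ev Eq] Be B1 Bw Bq Hmf Hres Hb Hnode.
destruct He as [Su Sw Cu1 Pu Pw Pw1 Eell Eev].
assert (Hh := hmax_pos m).
assert (Cu := smooth_cont _ _ Su). assert (Cw := smooth_cont _ _ Sw).
assert (Cw1 : cont (Derive w)) by (destruct Sw as [_ Sw]; apply (smooth_cont _ _ Sw)).
assert (Su' := Su). destruct Su' as [Du Cdu]. simpl in Cdu.
assert (Sw1 : smooth 1 w) by (destruct Sw as [D1 [D2 C2]]; split; [auto|simpl; now apply cont_ex_derive]).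
assert (Sw2 : smooth 1 (Derive w)) by (destruct Sw as [D1 S2]; exact S2).
assert (Cw2 : cont (Derive (Derive w))) by (destruct Sw2 as [_ C2]; exact C2).
assert (Vxi : Vh m k xi) by now apply Vh_minus.
set (xv := fun j x => vh j x - pw j x). set (xq := fun j x => qh j x - pq j x).
assert (Vxv : Vh m k xv) by now apply Vh_minus.
assert (Vxq : Vh m k xq) by now apply Vh_minus.
assert (Ccst : forall g, cont g -> pw_cont m (fun _ => g)) by (intros g Hg j Hj; exact Hg).
assert (Keta : pw_cont m eta) by now apply (interp_error_cont m k).
assert (Keta1 : pw_cont m (interp_error u1 pu1)) by now apply (interp_error_cont m k).
assert (Ketav : pw_cont m (interp_error w pw)) by now apply (interp_error_cont m k).
assert (Ketaq : pw_cont m (interp_error (Derive w) pq)) by now apply (interp_error_cont m k).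
assert (Kxi := Vh_cont _ _ _ Vxi).
assert (Dxi : forall t g v pg phi, Vh m k v -> Vh m k pg -> Vh m k phi -> cont g ->
   ddx m t (fun j x => v j x - pg j x) phi
   = ddx m t v phi - ddx m t (fun _ => g) phi + ddx m t (interp_error g pg) phi).
{ intros t g v pg phi Hv Hpg Hphi Hg.
  assert (E1 := ddx_minus_l m k t v pg phi (Vh_cont _ _ _ Hv) (Vh_cont _ _ _ Hpg) Hphi).
  assert (E2 := ddx_minus_l m k t (fun _ => g) pg phi (Ccst g Hg) (Vh_cont _ _ _ Hpg) Hphi).
  unfold interp_error. lra. }
assert (Ixi : forall g v pg phi, Vh m k v -> Vh m k pg -> Vh m k phi -> cont g ->
   ip m (fun j x => v j x - pg j x) phi
   = ip m v phi - ip m (fun _ => g) phi + ip m (interp_error g pg) phi).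
{ intros g v pg phi Hv Hpg Hphi Hg.
  assert (E1 := ip_minus_l m v pg phi (Vh_cont _ _ _ Hv) (Vh_cont _ _ _ Hpg) (Vh_cont _ _ _ Hphi)).
  assert (E2 := ip_minus_l m (fun _ => g) pg phi (Ccst g Hg) (Vh_cont _ _ _ Hpg) (Vh_cont _ _ _ Hphi)).
  unfold interp_error. lra. }
set (E := ip m xi xi). set (hS := hmax m * Sq). set (kS := kappa * Sq).
assert (HhS : 0 <= hS) by nonneg.
assert (HkS : 0 <= kS) by nonneg.
assert (HE : 0 <= E) by now apply ip_pos.
assert (Nv := cell_bounded_ip m _ Sq Bw Ketav). assert (Nq := cell_bounded_ip m _ Sq Bq Ketaq).
assert (N1 := cell_bounded_ip m _ Sq B1 Keta1). assert (Nu := cell_bounded_ip m _ Sq Be Keta).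
fold hS in Nv, Nq, N1, Nu.
assert (Hell : ip m xv xv <= 4 * (2 * hS + 2 * (Cr * kS)) + 2 * E).
{ apply (elliptic_stability m k th _ xi xv xq
    (fun phi => ip m (interp_error w pw) phi - ddx m th (interp_error (Derive w) pq) phi
                - ddx m th eta phi)
    (fun phi => ip m (interp_error (Derive w) pq) phi - ddx m (1 - th) (interp_error w pw) phi));
    auto; intros phi Hphi; assert (Kphi := Vh_cont _ _ _ Hphi).
  - unfold xv, xq, xi. rewrite (Ixi w), (Dxi th (Derive w)), (Dxi th u) by auto.
    rewrite (ddx_exact m k th (Derive w)), (ddx_exact m k th u) by auto.
    assert (Hx : ip m (fun _ => w) phi - ip m (fun _ => Derive (Derive w)) phi
       = ip m (fun _ => Derive u) phi).
    { rewrite <- ip_minus_l by auto. apply bigsum_ext; intros j Hj.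
      apply RInt_ext_R; intros x. now rewrite Eell. }
    assert (Hv := Ev phi Hphi). fold eta. lra.
  - unfold xv, xq. rewrite (Ixi (Derive w)), (Dxi (1 - th) w) by auto.
    rewrite (ddx_exact m k (1 - th) w) by auto. assert (Hq := Eq phi Hphi). lra.
  - assert (Pphi := ip_pos m phi Kphi).
    assert (Y := ip_young m 2 _ _ ltac:(lra) Ketav Kphi).
    replace (/ (4 * 2)) with (/ 8) in Y by field.
    destruct (Hres phi Hphi) as [R1' [R2' R3']]. fold kS in R1', R2', R3'.
    apply Rabs_le_between in Y. apply Rabs_le_between in R1'. apply Rabs_le_between in R2'.
    apply Rabs_le; lra.
  - assert (Pphi := ip_pos m phi Kphi).
    assert (Y := ip_young m 2 _ _ ltac:(lra) Ketaq Kphi).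
    replace (/ (4 * 2)) with (/ 8) in Y by field.
    destruct (Hres phi Hphi) as [R1' [R2' R3']]. fold kS in R1', R2', R3'.
    assert (0 <= Cr * kS) by nonneg.
    apply Rabs_le_between in Y. apply Rabs_le_between in R3'.
    apply Rabs_le; lra. }
assert (Hnl := nonlinear_sum m k f f1 F r R1 L L2 A Ci fhat u uh pu _ Hf HA HR1 Hinv Su Pu
   Vuh Vpu Hmf Hub Hb Hnode).
fold eta xi Cv E in Hnl. cbv beta in Hnl.
assert (Sfu : smooth 1 (fun y => f (u y))).
{ assert (Dfu : forall x, is_derive (fun y => f (u y)) x (Derive u x * f1 (u x))).
  { intros x. apply (is_derive_comp f u); [apply (flux_derive Hf)|apply Derive_correct, Du]. }
  split; [intros x; eexists; apply Dfu|]. simpl.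
  apply (cont_ext (fun x => Derive u x * f1 (u x))).
  - intros x. symmetry. apply is_derive_unique, Dfu.
  - assert (cont (fun x => f1 (u x))) by (apply (cont_comp f1); auto; apply (flux_cont1 Hf)).
    cont_tac. }
assert (Hex : ip m (fun _ => u1) xi = - bigsum (ncell m) (fun j =>
   bracket m (fun i => f (u (node m i))) xi j
   - cell_int m j (fun x => f (u x) * Derive (xi j) x)) - ip m (fun _ => w) xi).
{ replace (bigsum (ncell m) (fun j => bracket m (fun i => f (u (node m i))) xi j
    - cell_int m j (fun x => f (u x) * Derive (xi j) x)))
    with (ip m (fun _ => Derive (fun y => f (u y))) xi).
  2:{ unfold ip. apply bigsum_ext; intros j Hj. symmetry.
      exact (exact_by_parts m k (fun y => f (u y)) xi Vxi Sfu j Hj). }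
  destruct Sfu as [_ Cfu]. simpl in Cfu.
  assert (H0 : ip m (fun _ x => u1 x - (- Derive (fun y => f (u y)) x)) xi
     = ip m (fun _ x => - w x) xi).
  { apply bigsum_ext; intros j Hj. apply RInt_ext_R; intros x. assert (H := Eev x).
    replace (u1 x - - Derive (fun y => f (u y)) x) with (- w x) by lra. reflexivity. }
  assert (Hneg : forall g, cont g -> ip m (fun _ x => - g x) xi = - ip m (fun _ => g) xi).
  { intros g Hg. unfold ip.
    transitivity (bigsum (ncell m) (fun j => (-1) * cell_int m j (fun x => g x * xi j x))).
    - apply bigsum_ext; intros j Hj. assert (Kj := Kxi j Hj). unfold cell_int.
      rewrite <- RInt_scal_cont by cont_tac. apply RInt_ext_R; intros; ring.
    - rewrite bigsum_scal; ring. }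
  rewrite (ip_minus_l m (fun _ => u1) (fun _ x => - Derive (fun y => f (u y)) x)) in H0; auto.
  - rewrite !Hneg in H0 by auto. lra.
  - apply Ccst. cont_tac. }
assert (Hsc := Eu xi Vxi).
assert (Cf := is_derive_cont _ _ (flux_derive Hf)).
(* Scheme minus exact equation is the nonlinear form estimated in Hnl. *)
assert (Hdiff : bigsum (ncell m) (fun j => cell_int m j (fun x => (f (uh j x) - f (u x)) * Derive (xi j) x)
     - bracket m (fun i => at_nodes m fhat uh i - f (u (node m i))) xi j)
  = bigsum (ncell m) (fun j => bracket m (fun i => f (u (node m i))) xi j
       - cell_int m j (fun x => f (u x) * Derive (xi j) x))
    - bigsum (ncell m) (fun j => bracket m (at_nodes m fhat uh) xi j
       - cell_int m j (fun x => f (uh j x) * Derive (xi j) x))).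
{ rewrite <- bigsum_minus. apply bigsum_ext; intros j Hj.
  assert (Cuh := Vh_cont _ _ _ Vuh j Hj).
  assert (Cdx := is_poly_cont_Derive k _ (Vxi j Hj)).
  assert (cont (fun x => f (u x))) by now apply (cont_comp f).
  assert (cont (fun x => f (uh j x))) by now apply (cont_comp f).
  assert (Ec : cell_int m j (fun x => (f (uh j x) - f (u x)) * Derive (xi j) x)
    = cell_int m j (fun x => f (uh j x) * Derive (xi j) x)
      - cell_int m j (fun x => f (u x) * Derive (xi j) x)).
  { unfold cell_int. rewrite <- RInt_minus_cont by cont_tac. apply RInt_ext_R; intros; ring. }
  rewrite Ec. unfold bracket. ring. }
assert (Hnu : bigsum (ncell m) (fun i =>
   Cn * (kappa * (trace_minus m eta i ^ 2 + trace_plus m eta i ^ 2)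
              + hmax m * (trace_minus m xi i ^ 2 + trace_plus m xi i ^ 2)))
   <= Cn * (2 * kS + 2 * sigma * Ci * E)).
{ rewrite bigsum_scal, bigsum_plus, !bigsum_scal. apply Rmult_le_compat_l; auto.
  assert (T1 := cell_bounded_traces m eta Sq Be).
  assert (T2 := inverse_traces m k Ci sigma xi Hinv HCi Hs Vxi). fold E in T2.
  apply (Rmult_le_compat_l kappa) in T1; auto.
  unfold kS. lra. }
rewrite (Ixi u1 uht pu1 xi) by auto.
assert (Hvw := Ixi w vh pw xi Vvh Vpw Vxi Cw). fold xv in Hvw.
assert (Yv := ip_young m 1 xv xi ltac:(lra) (Vh_cont _ _ _ Vxv) Kxi).
assert (Yw := ip_young m 1 _ xi ltac:(lra) Ketav Kxi).
assert (Y1 := ip_young m 1 _ xi ltac:(lra) Keta1 Kxi).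
replace (/ (4 * 1)) with (/ 4) in Yv, Yw, Y1 by field. fold E in Yv, Yw, Y1.
apply Rabs_le_between in Yv. apply Rabs_le_between in Yw. apply Rabs_le_between in Y1.
assert (Z1 : Cv * ((1 + Ci) * E + ip m eta eta) <= Cv * ((1 + Ci) * E + hS))
  by (apply Rmult_le_compat_l; lra).
replace ((kappa + hmax m) * Sq) with (kS + hS) by (unfold kS, hS; ring).
assert (0 <= Cv * hS) by nonneg.
assert (0 <= Cv * E) by nonneg.
assert (0 <= Cv * Ci * hS) by nonneg.
assert (0 <= Cv * Ci * kS) by nonneg.
assert (0 <= Cv * kS) by nonneg.
assert (0 <= Cn * E) by nonneg.
assert (0 <= Cn * hS) by nonneg.
assert (0 <= Cn * (sigma * Ci) * hS) by nonneg.
assert (0 <= Cn * (sigma * Ci) * kS) by nonneg.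
assert (0 <= Cn * (sigma * Ci) * E) by nonneg.
assert (0 <= Cr * hS) by nonneg.
assert (0 <= Cr * kS) by nonneg.
assert (0 <= Cr * E) by nonneg.
lra.
Qed.

(** * Evolution in time *)

(** Mean value theorem with information on the open interval only: the derivative is
    replaced by 0 at the endpoints. *)
Lemma mean_value_open g dg (Q : R -> Prop) x y : x <= y -> cont g -> Q 0 ->
  (forall z, x < z < y -> is_derive g z (dg z) /\ Q (dg z)) ->
  exists l, Q l /\ g y - g x = l * (y - x).
Proof.
intros Hxy Cg H0 H.
set (dg' := fun z => if Rlt_dec x z then if Rlt_dec z y then dg z else 0 else 0).
destruct (MVT_gen g x y dg') as [z [_ E]].
- rewrite Rmin_left, Rmax_right by lra. intros z Hz. unfold dg'.
  destruct (Rlt_dec x z); [|lra]. destruct (Rlt_dec z y); [|lra]. now apply H.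
- intros z _. apply continuity_pt_filterlim, Cg.
- exists (dg' z). split; auto. unfold dg'.
  destruct (Rlt_dec x z); auto. destruct (Rlt_dec z y); auto. now apply H.
Qed.

Lemma cont_exp_lin C : cont (fun s => exp (C * s)).
Proof.
apply (cont_comp exp (fun s => C * s)); [|cont_tac]. intros y.
apply (ex_derive_continuous exp). eexists; apply is_derive_exp.
Qed.

(** Gronwall's inequality by continuation: the differential inequality is only
    available below the threshold dl, which the resulting bound never reaches. *)
Lemma gronwall_barrier E dE T C W dl : 0 <= T -> cont E ->
  (forall t, 0 < t < T -> is_derive E t (dE t)) ->
  (forall t, 0 < t < T -> E t < dl -> dE t <= C * (E t + W)) ->
  0 <= C -> 0 <= E 0 + W -> E 0 < dl -> (E 0 + W) * exp (C * T) < dl + W ->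
  forall t, 0 <= t <= T -> E t + W <= (E 0 + W) * exp (C * T).
Proof.
intros HT HE HD Hg HC H0 H0' Hdl.
assert (Hmon : forall t, 0 <= t <= T -> (forall s, 0 < s < t -> E s < dl) ->
   E t + W <= (E 0 + W) * exp (C * T)).
{ intros t Ht Hs. set (g := fun s => (E s + W) * exp (- C * s)).
  destruct (mean_value_open g (fun s => (dE s - C * (E s + W)) * exp (- C * s))
     (fun l => l <= 0) 0 t) as [l [Hl El]]; [lra| |cbv beta; lra| |].
  - unfold g. assert (Ce := cont_exp_lin (- C)). cont_tac.
  - intros x Hx. assert (H1 := HD x ltac:(lra)). split.
    + assert (H2 : is_derive (fun s => exp (- C * s)) x (- C * exp (- C * x)))
        by (auto_derive; [auto|ring]).
      assert (H3 : is_derive (fun s => E s + W) x (dE x)).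
      { evar_last; [apply (is_derive_plus E (fun _ => W)); [apply H1|apply (is_derive_const W)]|].
        unfold plus, zero; simpl; ring. }
      evar_last; [apply (is_derive_mult (fun s => E s + W) (fun s => exp (- C * s)) x _ _ H3 H2);
        intros; apply Rmult_comm|].
      unfold plus, mult; simpl; ring.
    + assert (H2 := Hg x ltac:(lra) (Hs x Hx)). assert (H3 := exp_pos (- C * x)). nra.
  - assert (Hgt : g t <= g 0).
    { assert (l * (t - 0) <= 0) by (assert (0 <= t - 0) by lra; nra). lra. }
    unfold g in Hgt. rewrite Rmult_0_r, exp_0, Rmult_1_r in Hgt.
    assert (Hinv : exp (- C * t) * exp (C * t) = 1).
    { rewrite <- exp_plus. replace (- C * t + C * t) with 0 by ring. apply exp_0. }
    apply (Rmult_le_compat_r (exp (C * t))) in Hgt; [|apply Rlt_le, exp_pos].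
    rewrite Rmult_assoc, Hinv, Rmult_1_r in Hgt.
    eapply Rle_trans; [apply Hgt|]. apply Rmult_le_compat_l; auto.
    destruct (Req_dec (C * t) (C * T)) as [->|Hne]; [lra|].
    apply Rlt_le, exp_increasing. assert (C * t <= C * T) by (apply Rmult_le_compat_l; lra). lra. }
(* The supremum s0 of the times up to which the threshold is respected. *)
set (good := fun s => 0 <= s <= T /\ forall t, 0 <= t <= s -> E t < dl).
assert (G0 : good 0).
{ split; [lra|]. intros t Ht. replace t with 0 by lra. auto. }
destruct (completeness good) as [s0 [Hub Hlub]].
{ exists T. intros s [Hs _]. lra. }
{ exists 0; auto. }
assert (Hs0 : 0 <= s0 <= T).
{ split; [apply Hub, G0|]. apply Hlub. intros s [Hs _]. lra. }
assert (Hbelow : forall t, 0 <= t < s0 -> E t < dl).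
{ intros t Ht. destruct (Rlt_dec (E t) dl) as [|Hn]; auto. exfalso.
  assert (s0 <= t); [|lra]. apply Hlub. intros s [Hs Hgs].
  destruct (Rle_dec s t) as [|Hst]; auto. exfalso. apply Hn, Hgs. lra. }
assert (Hat : E s0 < dl).
{ assert (H := Hmon s0 Hs0 ltac:(intros; apply Hbelow; lra)). lra. }
assert (HsT : s0 = T).
{ destruct (Req_dec s0 T) as [|Hne]; auto. exfalso.
  destruct (cont_locally_close E s0 (dl - E s0) HE ltac:(lra)) as [e [He Hc]].
  set (s1 := Rmin T (s0 + e / 2)).
  assert (Hs1 : s1 <= T) by apply Rmin_l. assert (Hs1' : s1 <= s0 + e / 2) by apply Rmin_r.
  assert (Hs1'' : s0 < s1) by (apply Rmin_glb_lt; lra).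
  assert (good s1).
  { split; [lra|]. intros t Ht. destruct (Rlt_dec t s0); [apply Hbelow; lra|].
    assert (H := Hc t ltac:(apply Rabs_def1; lra)). apply Rabs_def2 in H. lra. }
  assert (s1 <= s0) by now apply Hub. lra. }
intros t Ht. apply Hmon; auto. intros s Hs. apply Hbelow. lra.
Qed.

Lemma is_derive_mulr (g : R -> R) t dg c : is_derive g t dg -> is_derive (fun s => g s * c) t (dg * c).
Proof.
intros H. evar_last; [apply (is_derive_mult g (fun _ => c) t dg 0 H)|].
- apply (is_derive_const c).
- intros; apply Rmult_comm.
- unfold plus, mult; simpl; ring.
Qed.

Lemma interpolated_integral k l (g psi : R -> R) c d :
  (forall i, (i <= k)%nat -> is_poly k (l i)) ->
  (forall g, is_poly k g -> forall x, g x = bigsum (S k) (fun i => g (INR i) * l i x)) ->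
  is_poly k g -> cont psi ->
  RInt (fun x => g x * psi x) c d
  = bigsum (S k) (fun i => g (INR i) * RInt (fun x => l i x * psi x) c d).
Proof.
intros Pl El Hg Hpsi.
assert (Cl : forall i, (i < S k)%nat -> cont (l i))
  by (intros; apply (is_poly_cont k), Pl; lia).
rewrite (RInt_ext_R _ (fun x => bigsum (S k) (fun i => g (INR i) * (l i x * psi x)))).
- rewrite (RInt_bigsum (S k) (fun i x => g (INR i) * (l i x * psi x))).
  + apply bigsum_ext; intros i Hi. specialize (Cl i Hi). now rewrite RInt_scal_cont by cont_tac.
  + intros i Hi. specialize (Cl i Hi). cont_tac.
- intros x. rewrite (El g Hg x) at 1. rewrite bigsum_mulr. apply bigsum_ext; intros; ring.
Qed.

(** The time derivative is the interpolation polynomial of its own nodal values. *)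
Lemma poly_time_deriv k (z : R -> R -> R) (dz : R -> R) t :
  (forall s, is_poly k (z s)) -> (forall x, is_derive (fun s => z s x) t (dz x)) -> is_poly k dz.
Proof.
intros Pz Dz. destruct (lagrange k) as [l [Pl El]].
apply (is_poly_ext _ (fun x => bigsum (S k) (fun i => dz (INR i) * l i x))).
- intros x. apply (is_derive_unique (fun s => z s x)) in Dz as Dx.
  rewrite <- Dx. symmetry. apply is_derive_unique.
  apply (is_derive_ext (fun s => bigsum (S k) (fun i => z s (INR i) * l i x))).
  { intros s. symmetry. apply (El (z s) (Pz s)). }
  apply (is_derive_bigsum (S k) (fun i s => z s (INR i) * l i x)). intros i Hi.
  apply (is_derive_mulr (fun s => z s (INR i))), Dz.
- apply (is_poly_bigsum k (S k) (fun i x => dz (INR i) * l i x)). intros i Hi.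
  apply (is_poly_ext k (fun x => dz (INR i) * l i x)); [auto|]. apply is_poly_scal, Pl; lia.
Qed.

(** The energy of a polynomial moving in time is differentiable, although the time
    derivative is only assumed pointwise: it is a quadratic form in nodal values. *)
Lemma energy_derive k (z : R -> R -> R) (dz : R -> R) c d t :
  (forall s, is_poly k (z s)) -> (forall x, is_derive (fun s => z s x) t (dz x)) ->
  is_derive (fun s => RInt (fun x => z s x * z s x) c d) t
    (2 * RInt (fun x => dz x * z t x) c d).
Proof.
intros Pz Dz. assert (Pdz := poly_time_deriv k z dz t Pz Dz).
destruct (lagrange k) as [l [Pl El]].
assert (Cl : forall i, (i < S k)%nat -> cont (l i))
  by (intros; apply (is_poly_cont k), Pl; lia).
assert (Cz : forall s, cont (z s)) by (intros; apply (is_poly_cont k), Pz).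
assert (Cdz := is_poly_cont _ _ Pdz).
set (q := fun i s => RInt (fun x => z s x * l i x) c d).
assert (Hq : forall i, (i < S k)%nat -> is_derive (q i) t (RInt (fun x => dz x * l i x) c d)).
{ intros i Hi. unfold q.
  rewrite (interpolated_integral k l dz (l i) c d Pl El Pdz (Cl i Hi)).
  apply (is_derive_ext (fun s => bigsum (S k) (fun j => z s (INR j) * RInt (fun x => l j x * l i x) c d))).
  { intros s. symmetry. apply (interpolated_integral k l (z s) (l i) c d Pl El (Pz s) (Cl i Hi)). }
  apply (is_derive_bigsum (S k) (fun j s => z s (INR j) * RInt (fun x => l j x * l i x) c d)).
  intros j Hj. apply (is_derive_mulr (fun s => z s (INR j))), Dz. }
apply (is_derive_ext (fun s => bigsum (S k) (fun i => z s (INR i) * q i s))).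
{ intros s. rewrite (interpolated_integral k l (z s) (z s) c d Pl El (Pz s) (Cz s)).
  apply bigsum_ext; intros i Hi. unfold q. f_equal. apply RInt_ext_R; intros; ring. }
replace (2 * RInt (fun x => dz x * z t x) c d) with
  (bigsum (S k) (fun i => dz (INR i) * q i t + z t (INR i) * RInt (fun x => dz x * l i x) c d)).
- apply (is_derive_bigsum (S k) (fun i s => z s (INR i) * q i s)). intros i Hi.
  apply (is_derive_mult (fun s => z s (INR i)) (q i) t _ _ (Dz _) (Hq i Hi)).
  intros; apply Rmult_comm.
- rewrite bigsum_plus.
  replace (bigsum (S k) (fun i => dz (INR i) * q i t)) with (RInt (fun x => dz x * z t x) c d).
  2:{ rewrite (interpolated_integral k l dz (z t) c d Pl El Pdz (Cz t)).
      apply bigsum_ext; intros i Hi. unfold q. f_equal. apply RInt_ext_R; intros; ring. }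
  replace (bigsum (S k) (fun i => z t (INR i) * RInt (fun x => dz x * l i x) c d))
    with (RInt (fun x => dz x * z t x) c d); [ring|].
  rewrite (RInt_ext_R _ (fun x => z t x * dz x)) by (intros; ring).
  rewrite (interpolated_integral k l (z t) dz c d Pl El (Pz t) Cdz).
  apply bigsum_ext; intros i Hi. f_equal. apply RInt_ext_R; intros; ring.
Qed.

Lemma energy_cont k (z : R -> R -> R) c d :
  (forall s, is_poly k (z s)) -> (forall x, cont (fun s => z s x)) ->
  cont (fun s => RInt (fun x => z s x * z s x) c d).
Proof.
intros Pz Cz. destruct (lagrange k) as [l [Pl El]].
assert (Cl : forall i, (i < S k)%nat -> cont (l i))
  by (intros; apply (is_poly_cont k), Pl; lia).
assert (Czx : forall s, cont (z s)) by (intros; apply (is_poly_cont k), Pz).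
apply (cont_ext (fun s => bigsum (S k) (fun i => z s (INR i) *
   bigsum (S k) (fun j => z s (INR j) * RInt (fun x => l j x * l i x) c d)))).
- intros s. rewrite (interpolated_integral k l (z s) (z s) c d Pl El (Pz s) (Czx s)).
  apply bigsum_ext; intros i Hi. f_equal.
  rewrite <- (interpolated_integral k l (z s) (l i) c d Pl El (Pz s) (Cl i Hi)).
  apply RInt_ext_R; intros; ring.
- apply (cont_bigsum (S k) (fun i s => z s (INR i) *
   bigsum (S k) (fun j => z s (INR j) * RInt (fun x => l j x * l i x) c d))).
  intros i Hi. apply (cont_mult (fun s => z s (INR i))); [apply Cz|].
  apply (cont_bigsum (S k) (fun j s => z s (INR j) * RInt (fun x => l j x * l i x) c d)).
  intros j Hj. apply (cont_mult (fun s => z s (INR j))); [apply Cz|apply cont_const].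
Qed.

(** Time is clamped to [0,T], so that data given on [0,T] only become functions
    continuous on the whole line. *)
Definition clamp (T t : R) : R := Rmax 0 (Rmin t T).

Lemma clamp_range T t : 0 <= T -> 0 <= clamp T t <= T.
Proof.
intros HT. unfold clamp. split; [apply Rmax_l|]. apply Rmax_lub; auto. apply Rmin_r.
Qed.

Lemma clamp_id T t : 0 <= t <= T -> clamp T t = t.
Proof. intros Ht. unfold clamp. rewrite Rmin_left, Rmax_right by lra. reflexivity. Qed.

Lemma clamp_lip T s t : 0 <= T -> Rabs (clamp T s - clamp T t) <= Rabs (s - t).
Proof.
intros HT. unfold clamp, Rmax, Rmin.
destruct (Rle_dec s T); destruct (Rle_dec t T); repeat destruct Rle_dec;
unfold Rabs; repeat destruct Rcase_abs; lra.
Qed.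

Lemma clamp_cont T (g : R -> R) : 0 <= T -> continuous_on (fun t => 0 <= t <= T) g ->
  cont (fun t => g (clamp T t)).
Proof.
intros HT Hg t. apply filterlim_locally. intros eps.
assert (H := proj1 (filterlim_locally _ _) (Hg (clamp T t) (clamp_range T t HT)) eps).
destruct H as [dl H]. exists dl. intros s Hs. apply H; [|now apply clamp_range].
change (Rabs (clamp T s - clamp T t) < dl). change (Rabs (s - t) < dl) in Hs.
eapply Rle_lt_trans; [now apply clamp_lip|auto].
Qed.

Lemma clamp_derive T (g : R -> R) t dg : 0 < t < T -> is_derive g t dg ->
  is_derive (fun s => g (clamp T s)) t dg.
Proof.
intros Ht Hg. apply (is_derive_ext_loc g); auto.
assert (Hp : 0 < Rmin t (T - t)) by (apply Rmin_glb_lt; lra).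
exists (mkposreal _ Hp). intros s Hs. change (Rabs (s - t) < Rmin t (T - t)) in Hs.
assert (H1 := Rmin_l t (T - t)). assert (H2 := Rmin_r t (T - t)).
apply Rabs_def2 in Hs. rewrite clamp_id by lra. reflexivity.
Qed.

(** * Bounds on the exact solution *)

(** One-dimensional Sobolev inequality: compare g(x) with its values at all y and
    average over y. *)
Lemma sup_le_energy a b g x : a < b -> smooth 1 g -> a <= x <= b ->
  g x ^ 2 <= (2 / (b - a) + 2 * (b - a)) *
    (RInt (fun y => g y ^ 2) a b + RInt (fun y => Derive g y ^ 2) a b).
Proof.
intros Hab [Dg Cdg] Hx. simpl in Cdg. assert (Cg : cont g) by now apply cont_ex_derive.
set (I0 := RInt (fun y => g y ^ 2) a b). set (I1 := RInt (fun y => Derive g y ^ 2) a b).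
assert (H0 : 0 <= I0) by (apply RInt_sqr_nonneg; [lra|cont_tac]).
assert (H1 : 0 <= I1) by (apply RInt_sqr_nonneg; [lra|cont_tac]).
assert (Hsub : forall c d, a <= c -> c <= d -> d <= b -> (g d - g c) ^ 2 <= (b - a) * I1).
{ intros c d Hc Hcd Hd. rewrite <- (RInt_Derive_cont g c d Dg Cdg).
  eapply Rle_trans; [apply RInt_sqr_le; auto|].
  assert (E1 := RInt_Chasles_cont (fun y => Derive g y ^ 2) a c b ltac:(cont_tac)).
  assert (E2 := RInt_Chasles_cont (fun y => Derive g y ^ 2) c d b ltac:(cont_tac)).
  assert (P1 : 0 <= RInt (fun y => Derive g y ^ 2) a c)
    by (apply RInt_sqr_nonneg; [lra|cont_tac]).
  assert (P2 : 0 <= RInt (fun y => Derive g y ^ 2) d b)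
    by (apply RInt_sqr_nonneg; [lra|cont_tac]).
  assert (P3 : 0 <= RInt (fun y => Derive g y ^ 2) c d)
    by (apply RInt_sqr_nonneg; [lra|cont_tac]).
  fold I1 in E1. apply Rmult_le_compat; lra. }
assert (Hp : forall y, a <= y <= b -> g x ^ 2 <= 2 * g y ^ 2 + 2 * ((b - a) * I1)).
{ intros y Hy. assert (Hd : (g x - g y) ^ 2 <= (b - a) * I1).
  { destruct (Rle_dec x y).
    - replace ((g x - g y) ^ 2) with ((g y - g x) ^ 2) by ring. apply Hsub; lra.
    - apply Hsub; lra. }
  assert (I2 := pow2_ge_0 (g x - 2 * g y)). lra. }
assert (Hint : (b - a) * g x ^ 2 <= 2 * I0 + (b - a) * (2 * ((b - a) * I1))).
{ rewrite <- RInt_const_R. unfold I0. rewrite <- RInt_scal_cont, <- RInt_const_R, <- RInt_plus_cont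
    by cont_tac.
  apply RInt_le_cont; [lra|apply cont_const|cont_tac|]. intros y Hy. apply Hp; lra. }
apply (Rmult_le_reg_l (b - a)); [lra|]. eapply Rle_trans; [apply Hint|].
replace ((b - a) * ((2 / (b - a) + 2 * (b - a)) * (I0 + I1)))
  with (2 * I0 + 2 * I1 + 2 * (b - a) ^ 2 * I0 + (b - a) * (2 * ((b - a) * I1))) by (field; lra).
assert (0 <= 2 * (b - a) ^ 2 * I0) by (apply Rmult_le_pos; auto; assert (I := pow2_ge_0 (b - a)); lra).
lra.
Qed.

(** The last derivative is only bounded in L2, as the Sobolev norm provides, and the lower
    ones uniformly. For r > 0 the class is an algebra, which gives the bounds on f(u). *)
Fixpoint sob (a b : R) (r : nat) (M : R) (g : R -> R) : Prop :=
  match r with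
  | O => cont g /\ RInt (fun x => g x ^ 2) a b <= M
  | S r' => (forall x, ex_derive g x) /\ (forall x, a <= x <= b -> Rabs (g x) <= M)
            /\ sob a b r' M (Derive g)
  end.

Lemma sob_smooth a b r M g : sob a b r M g -> smooth r g.
Proof.
revert g; induction r as [|r IH]; intros g; simpl; [tauto|]. intros [H1 [_ H2]]. auto.
Qed.

Lemma sob_mono a b r M N g : M <= N -> sob a b r M g -> sob a b r N g.
Proof.
intros HMN. revert g; induction r as [|r IH]; intros g; simpl.
- intros [H1 H2]; split; auto; lra.
- intros [H1 [H2 H3]]; repeat split; auto. intros x Hx. specialize (H2 x Hx); lra.
Qed.

Lemma sob_ext a b r M g h : (forall x, g x = h x) -> sob a b r M g -> sob a b r M h.
Proof.
revert g h; induction r as [|r IH]; intros g h E; simpl.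
- intros [H1 H2]; split; [now apply (cont_ext g)|].
  rewrite <- (RInt_ext_R (fun x => g x ^ 2)) by (intros; now rewrite E). auto.
- intros [H1 [H2 H3]]; repeat split.
  + intros x; now apply (ex_derive_ext g).
  + intros x Hx; rewrite <- E; auto.
  + apply (IH (Derive g)); auto. intros x; now apply Derive_ext.
Qed.

Lemma sob_last a b r M g : sob a b r M g -> RInt (fun x => Derive_n g r x ^ 2) a b <= M.
Proof.
revert g; induction r as [|r IH]; intros g; simpl; [tauto|]. intros [_ [_ H]].
rewrite (RInt_ext_R _ (fun x => Derive_n (Derive g) r x ^ 2)); auto.
intros x. rewrite <- Derive_n_shift. reflexivity.
Qed.

Lemma sob_le_S a b r M g : a <= b -> sob a b (S r) M g -> sob a b r (M + (b - a) * M ^ 2) g.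
Proof.
intros Hab. assert (HM : M <= M + (b - a) * M ^ 2).
{ assert (0 <= (b - a) * M ^ 2) by nonneg. lra. }
revert g; induction r as [|r IH]; intros g [H1 [H2 H3]].
- assert (Cg : cont g) by now apply cont_ex_derive. split; auto.
  assert (H4 : RInt (fun x => g x ^ 2) a b <= (b - a) * M ^ 2).
  { rewrite <- RInt_const_R. apply RInt_le_cont; [auto|cont_tac|apply cont_const|].
    intros x Hx. apply sqr_le_of_abs, H2; lra. }
  assert (0 <= M); [|lra]. specialize (H2 a ltac:(lra)). assert (I := Rabs_pos (g a)). lra.
- split; [auto|split].
  + intros x Hx. specialize (H2 x Hx). lra.
  + apply IH, H3.
Qed.

Lemma sob_const a b r c : a <= b -> sob a b r (Rabs c + (b - a) * c ^ 2) (fun _ => c).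
Proof.
intros Hab. assert (H0 : 0 <= (b - a) * c ^ 2) by nonneg.
assert (Hc := Rabs_pos c).
assert (Hz : forall r, sob a b r (Rabs c + (b - a) * c ^ 2) (fun _ => 0)).
{ induction r0 as [|r0 IH]; simpl.
  - split; [apply cont_const|]. rewrite (RInt_ext_R _ (fun _ => 0)), RInt_const_R by (intros; ring). lra.
  - split; [intros; apply ex_derive_const|split].
    + intros; rewrite Rabs_R0; lra.
    + apply (sob_ext _ _ _ _ (fun _ => 0)); auto. intros; symmetry; apply Derive_const. }
destruct r as [|r]; simpl.
- split; [apply cont_const|]. rewrite RInt_const_R. simpl in *. lra.
- split; [intros; apply ex_derive_const|split].
  + intros; lra.
  + apply (sob_ext _ _ _ _ (fun _ => 0)); auto. intros; symmetry; apply Derive_const.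
Qed.

Lemma sob_plus a b r M N g h : a <= b -> 0 <= M -> 0 <= N -> sob a b r M g -> sob a b r N h ->
  sob a b r (2 * (M + N)) (fun x => g x + h x).
Proof.
intros Hab HM HN. revert g h; induction r as [|r IH]; intros g h; simpl.
- intros [C1 H1] [C2 H2]; split; [cont_tac|].
  apply Rle_trans with (RInt (fun x => 2 * g x ^ 2 + 2 * h x ^ 2) a b).
  + apply RInt_le_cont; [auto|cont_tac|cont_tac|]. intros x _.
    assert (I := pow2_ge_0 (g x - h x)). simpl in *. lra.
  + rewrite RInt_plus_cont, !RInt_scal_cont by cont_tac. simpl in *. lra.
- intros [D1 [B1 S1]] [D2 [B2 S2]]. split; [|split].
  + intros x. apply (ex_derive_plus g h); auto.
  + intros x Hx. specialize (B1 x Hx). specialize (B2 x Hx).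
    assert (I := Rabs_triang (g x) (h x)). lra.
  + apply (sob_ext _ _ _ _ (fun x => Derive g x + Derive h x)); auto.
    intros x. symmetry. now apply Derive_plus.
Qed.

Lemma sob_scal a b r M g c : a <= b -> 0 <= M -> sob a b r M g ->
  sob a b r ((Rabs c + c ^ 2) * M) (fun x => c * g x).
Proof.
intros Hab HM. assert (Hc := Rabs_pos c). assert (Hc2 := pow2_ge_0 c).
assert (0 <= Rabs c * M) by nonneg.
assert (0 <= c ^ 2 * M) by nonneg.
revert g; induction r as [|r IH]; intros g; simpl.
- intros [C1 H1]; split; [cont_tac|].
  rewrite (RInt_ext_R _ (fun x => c ^ 2 * g x ^ 2)) by (intros; ring).
  rewrite RInt_scal_cont by cont_tac.
  assert (c ^ 2 * RInt (fun x => g x ^ 2) a b <= c ^ 2 * M) by now apply Rmult_le_compat_l.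
  simpl in *. lra.
- intros [D1 [B1 S1]]. split; [|split].
  + intros x. apply (ex_derive_scal g); auto.
  + intros x Hx. rewrite Rabs_mult. specialize (B1 x Hx).
    assert (Rabs c * Rabs (g x) <= Rabs c * M) by now apply Rmult_le_compat_l. simpl in *. lra.
  + apply (sob_ext _ _ _ _ (fun x => c * Derive g x)); auto.
    intros x. symmetry. apply Derive_scal.
Qed.

(** In the product rule at most one factor is differentiated r times, and the other one
    is then bounded. *)
Lemma sob_mult a b : a <= b -> forall r M N, 0 <= M -> 0 <= N -> exists K, 0 <= K /\
  forall g h, sob a b (S r) M g -> sob a b (S r) N h -> sob a b (S r) K (fun x => g x * h x).
Proof.
intros Hab. induction r as [|r IH]; intros M N HM HN.
- exists (M * N + 2 * N ^ 2 * M + 2 * M ^ 2 * N).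
  assert (P0 : 0 <= M * N) by nonneg.
  assert (P1 : 0 <= N ^ 2 * M) by nonneg.
  assert (P2 : 0 <= M ^ 2 * N) by nonneg.
  split; [lra|]. intros g h [D1 [B1 [C1 L1]]] [D2 [B2 [C2 L2]]].
  assert (Cg : cont g) by now apply cont_ex_derive.
  assert (Ch : cont h) by now apply cont_ex_derive.
  split; [|split; [|apply (sob_ext _ _ _ _ (fun x => Derive g x * h x + g x * Derive h x)); [|split]]].
  + intros x. apply (ex_derive_mult g h); auto.
  + intros x Hx. rewrite Rabs_mult.
    assert (Rabs (g x) * Rabs (h x) <= M * N) by (apply Rmult_le_compat; auto using Rabs_pos). lra.
  + intros x. symmetry. now apply Derive_mult.
  + cont_tac.
  + apply Rle_trans with (RInt (fun x => 2 * N ^ 2 * Derive g x ^ 2 + 2 * M ^ 2 * Derive h x ^ 2) a b).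
    * apply RInt_le_cont; [auto|cont_tac|cont_tac|]. intros x Hx.
      assert (Q1 := sqr_le_of_abs _ _ (B1 x ltac:(lra))).
      assert (Q2 := sqr_le_of_abs _ _ (B2 x ltac:(lra))).
      assert (I := pow2_ge_0 (Derive g x * h x - g x * Derive h x)).
      assert (J1 : Derive g x ^ 2 * h x ^ 2 <= Derive g x ^ 2 * N ^ 2)
        by (apply Rmult_le_compat_l; auto; apply pow2_ge_0).
      assert (J2 : Derive h x ^ 2 * g x ^ 2 <= Derive h x ^ 2 * M ^ 2)
        by (apply Rmult_le_compat_l; auto; apply pow2_ge_0).
      lra.
    * rewrite RInt_plus_cont, !RInt_scal_cont by cont_tac.
      assert (2 * N ^ 2 * RInt (fun x => Derive g x ^ 2) a b <= 2 * N ^ 2 * M)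
        by (apply Rmult_le_compat_l; auto; assert (I := pow2_ge_0 N); lra).
      assert (2 * M ^ 2 * RInt (fun x => Derive h x ^ 2) a b <= 2 * M ^ 2 * N)
        by (apply Rmult_le_compat_l; auto; assert (I := pow2_ge_0 M); lra).
      lra.
- set (M' := M + (b - a) * M ^ 2). set (N' := N + (b - a) * N ^ 2).
  assert (HM' : 0 <= M').
  { assert (0 <= (b - a) * M ^ 2) by nonneg. unfold M'; lra. }
  assert (HN' : 0 <= N').
  { assert (0 <= (b - a) * N ^ 2) by nonneg. unfold N'; lra. }
  destruct (IH M N' HM HN') as [K1 [HK1 H1]]. destruct (IH M' N HM' HN) as [K2 [HK2 H2]].
  assert (P0 : 0 <= M * N) by nonneg.
  exists (M * N + 2 * (K1 + K2)). split; [lra|]. intros g h Hg Hh.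
  assert (Wg := sob_le_S _ _ _ _ _ Hab Hg). assert (Wh := sob_le_S _ _ _ _ _ Hab Hh).
  destruct Hg as [D1 [B1 S1]]. destruct Hh as [D2 [B2 S2]].
  split; [|split; [|apply (sob_ext _ _ _ _ (fun x => Derive g x * h x + g x * Derive h x))]].
  + intros x. apply (ex_derive_mult g h); auto.
  + intros x Hx. rewrite Rabs_mult.
    assert (Rabs (g x) * Rabs (h x) <= M * N) by (apply Rmult_le_compat; auto using Rabs_pos). lra.
  + intros x. symmetry. now apply Derive_mult.
  + apply (sob_mono _ _ _ (2 * (K1 + K2))); [lra|].
    apply (sob_plus a b (S r) K1 K2 (fun x => Derive g x * h x) (fun x => g x * Derive h x)); auto.
Qed.

Lemma sob_pow a b r M n : a <= b -> 0 <= M -> exists K, 0 <= K /\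
  forall g, sob a b (S r) M g -> sob a b (S r) K (fun x => g x ^ n).
Proof.
intros Hab HM. induction n as [|n [K [HK H]]].
- exists (Rabs 1 + (b - a) * 1 ^ 2). split.
  + assert (I := Rabs_pos 1). simpl; lra.
  + intros g _. apply (sob_const a b (S r) 1 Hab).
- destruct (sob_mult a b Hab r M K HM HK) as [K' [HK' H']]. exists K'. split; auto.
  intros g Hg. apply (H' g (fun x => g x ^ n)); auto.
Qed.

(** The equation is tested with w; the boundary terms cancel by periodicity. *)
Lemma helmholtz_energy a b w g : a <= b -> smooth 2 w -> cont g -> w a = w b ->
  Derive w a = Derive w b -> (forall x, w x - Derive (Derive w) x = g x) ->
  RInt (fun x => w x ^ 2) a b + RInt (fun x => Derive w x ^ 2) a b <= RInt (fun x => g x ^ 2) a b.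
Proof.
intros Hab [D1 [D2 C2]] Cg E0 E1 E. simpl in C2.
assert (Cw : cont w) by now apply cont_ex_derive.
assert (Cw1 : cont (Derive w)) by now apply cont_ex_derive.
assert (IBP := RInt_by_parts (Derive w) w a b D2 D1 C2 Cw1).
rewrite <- E0, <- E1, Rminus_diag_eq in IBP by reflexivity.
set (I0 := RInt (fun x => w x ^ 2) a b). set (I1 := RInt (fun x => Derive w x ^ 2) a b).
set (I2 := RInt (fun x => g x ^ 2) a b).
assert (H1 : RInt (fun x => Derive w x * Derive w x) a b = I1) by (apply RInt_ext_R; intros; ring).
assert (H2 : RInt (fun x => Derive (Derive w) x * w x) a b = I0 - RInt (fun x => g x * w x) a b).
{ unfold I0. rewrite <- RInt_minus_cont by cont_tac. apply RInt_ext_R; intros x.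
  rewrite <- E. ring. }
assert (H3 : RInt (fun x => g x * w x) a b <= / 2 * I2 + / 2 * I0).
{ unfold I2, I0. rewrite <- !RInt_scal_cont, <- RInt_plus_cont by cont_tac.
  apply RInt_le_cont; [auto|cont_tac|cont_tac|]. intros x _.
  assert (I := pow2_ge_0 (g x - w x)). lra. }
assert (H4 : 0 <= I1) by (apply RInt_sqr_nonneg; [lra|cont_tac]).
lra.
Qed.

Lemma sqr_bound_abs x y : x ^ 2 <= y -> Rabs x <= y + 1.
Proof.
intros H. rewrite <- pow2_abs in H. assert (I := pow2_ge_0 (Rabs x - 1)).
assert (J := pow2_ge_0 (Rabs x)). nra.
Qed.

(** Once w has as many derivatives as g, so has w'' = w - g, and the gain of two
    derivatives follows by induction; the energy estimate starts it. *)
Lemma sob_helmholtz a b : a < b -> forall r M, 0 <= M -> exists K, 0 <= K /\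
  forall w g, smooth 2 w -> sob a b r M g -> w a = w b -> Derive w a = Derive w b ->
  (forall x, w x - Derive (Derive w) x = g x) -> sob a b (S (S r)) K w.
Proof.
intros Hab. set (Cs := 2 / (b - a) + 2 * (b - a)).
assert (HCs : 0 < Cs).
{ assert (0 < 2 / (b - a)) by (apply Rdiv_lt_0_compat; lra). unfold Cs; lra. }
induction r as [|r IH]; intros M HM.
- assert (HCM : 0 <= Cs * (M + 2 * (M + M))) by nonneg.
  exists (Cs * (M + 2 * (M + M)) + 1 + 2 * (M + M)). split; [lra|].
  intros w g Sw [Cg Lg] E0 E1 E.
  assert (Hen := helmholtz_energy a b w g ltac:(lra) Sw Cg E0 E1 E).
  destruct Sw as [D1 [D2 C2]]. simpl in C2.
  assert (Cw : cont w) by now apply cont_ex_derive.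
  assert (Cw1 : cont (Derive w)) by now apply cont_ex_derive.
  set (I0 := RInt (fun x => w x ^ 2) a b) in *. set (I1 := RInt (fun x => Derive w x ^ 2) a b) in *.
  assert (P0 : 0 <= I0) by (apply RInt_sqr_nonneg; [lra|cont_tac]).
  assert (P1 : 0 <= I1) by (apply RInt_sqr_nonneg; [lra|cont_tac]).
  assert (H2 : RInt (fun x => Derive (Derive w) x ^ 2) a b <= 2 * (M + M)).
  { apply Rle_trans with (RInt (fun x => 2 * w x ^ 2 + 2 * g x ^ 2) a b).
    - apply RInt_le_cont; [lra|cont_tac|cont_tac|]. intros x _.
      replace (Derive (Derive w) x) with (w x - g x) by (rewrite <- E; ring).
      assert (I := pow2_ge_0 (w x + g x)). lra.
    - rewrite RInt_plus_cont, !RInt_scal_cont by cont_tac. fold I0. lra. }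
  split; [auto|split; [|split; [auto|split; [|split; [auto|]]]]].
  + intros x Hx. assert (H := sup_le_energy a b w x Hab (conj D1 Cw1) Hx).
    fold Cs I0 I1 in H. apply sqr_bound_abs in H.
    assert (Cs * (I0 + I1) <= Cs * (M + 2 * (M + M))) by (apply Rmult_le_compat_l; lra). lra.
  + intros x Hx. assert (H := sup_le_energy a b (Derive w) x Hab (conj D2 C2) Hx).
    fold Cs I1 in H. apply sqr_bound_abs in H.
    assert (Cs * (I1 + RInt (fun y => Derive (Derive w) y ^ 2) a b) <= Cs * (M + 2 * (M + M)))
      by (apply Rmult_le_compat_l; lra). lra.
  + lra.
- set (M' := M + (b - a) * M ^ 2).
  assert (HM' : 0 <= M').
  { assert (0 <= (b - a) * M ^ 2) by nonneg. unfold M'; lra. }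
  destruct (IH M' HM') as [K [HK H]].
  set (K' := K + (b - a) * K ^ 2).
  assert (HK' : 0 <= K').
  { assert (0 <= (b - a) * K ^ 2) by nonneg. unfold K'; lra. }
  assert (Hc : 0 <= (Rabs (-1) + (-1) ^ 2) * M).
  { apply Rmult_le_pos; auto. assert (I := Rabs_pos (-1)). simpl; lra. }
  exists (K + 2 * (K' + (Rabs (-1) + (-1) ^ 2) * M)). split; [lra|].
  intros w g Sw Sg E0 E1 E.
  assert (W2 := H w g Sw (sob_le_S _ _ _ _ _ (Rlt_le _ _ Hab) Sg) E0 E1 E).
  assert (W1 := sob_le_S _ _ _ _ _ (Rlt_le _ _ Hab) W2). fold K' in W1.
  destruct W2 as [D1 [B1 [D2 [B2 _]]]].
  split; [auto|split; [|split; [auto|split]]].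
  + intros x Hx. specialize (B1 x Hx). lra.
  + intros x Hx. specialize (B2 x Hx). lra.
  + apply (sob_mono _ _ _ (2 * (K' + (Rabs (-1) + (-1) ^ 2) * M))); [lra|].
    apply (sob_ext _ _ _ _ (fun x => w x + (-1) * g x)).
    * intros x. rewrite <- E. ring.
    * apply sob_plus; auto; [lra|]. apply sob_scal; auto; lra.
Qed.

(** D' is close to a difference quotient of D over the distance e. *)
Lemma derivative_interpolation a b D m B e x : a < b -> smooth 2 D -> 0 < e <= (b - a) / 2 ->
  (forall y, a <= y <= b -> Rabs (D y) <= m) ->
  (forall y, a <= y <= b -> Rabs (Derive (Derive D) y) <= B) ->
  a <= x <= b -> Rabs (Derive D x) <= 2 * m / e + B * e.
Proof.
intros Hab [D1 [D2 _]] He Hm HB Hx.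
assert (Hy : exists y, a <= y <= b /\ Rabs (y - x) = e).
{ destruct (Rle_dec (x + e) b).
  - exists (x + e). split; [lra|]. replace (x + e - x) with e by ring. apply Rabs_pos_eq; lra.
  - exists (x - e). split; [lra|]. replace (x - e - x) with (- e) by ring.
    rewrite Rabs_Ropp. apply Rabs_pos_eq; lra. }
destruct Hy as [y [Hy Ey]].
destruct (mean_value D (Derive D) x y (fun z => Derive_correct D z (D1 z))) as [z [Hz E]].
assert (Hzab : a <= z <= b).
{ unfold Rmin, Rmax in Hz. destruct (Rle_dec x y); lra. }
destruct (between_abs _ _ _ Hz) as [Hzx _]. rewrite Ey in Hzx.
assert (H1 : Rabs (Derive D z) <= 2 * m / e).
{ apply (Rmult_le_reg_r e); [lra|]. unfold Rdiv. rewrite Rmult_assoc, Rinv_l, Rmult_1_r by lra.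
  rewrite <- Ey, <- Rabs_mult, <- E. unfold Rminus. eapply Rle_trans; [apply Rabs_triang|].
  rewrite Rabs_Ropp. assert (I1 := Hm x Hx). assert (I2 := Hm y Hy). lra. }
assert (H2 : Rabs (Derive D x - Derive D z) <= B * e).
{ destruct (mean_value (Derive D) (Derive (Derive D)) z x (fun z => Derive_correct _ z (D2 z)))
    as [v [Hv Ev]].
  rewrite Ev, Rabs_mult. apply Rmult_le_compat; auto using Rabs_pos.
  - apply HB. unfold Rmin, Rmax in Hv. destruct (Rle_dec z x); lra.
  - rewrite Rabs_minus_sym. auto. }
replace (Derive D x) with (Derive D z + (Derive D x - Derive D z)) by ring.
eapply Rle_trans; [apply Rabs_triang|lra].
Qed.

Definition power_speed (p : nat) (y : R) : R := y ^ pred p.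
Definition power_primitive (p : nat) (y : R) : R := / (INR p * INR (S p)) * y ^ S p.

Lemma is_derive_pow_R n (y : R) : is_derive (fun y => y ^ n) y (INR n * y ^ pred n).
Proof.
apply is_derive_Reals, derivable_pt_lim_pow.
Qed.

Lemma power_flux_derive p y : (1 <= p)%nat -> is_derive (power_flux p) y (power_speed p y).
Proof.
intros Hp. assert (Hp0 : INR p <> 0) by (apply not_0_INR; lia).
evar_last; [apply (is_derive_scal (fun y => y ^ p)), is_derive_pow_R|].
unfold power_speed. simpl. field; auto.
Qed.

Lemma power_flux_data p r : (2 <= p)%nat -> 0 <= r -> exists L L2,
  flux_data (power_flux p) (power_speed p) (power_primitive p) r L L2.
Proof.
intros Hp Hr. assert (Hp0 : INR p <> 0) by (apply not_0_INR; lia).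
assert (Hp1 : INR (S p) <> 0) by (apply not_0_INR; lia).
assert (C1 : cont (power_speed p)) by (apply cont_pow, cont_id).
assert (C2 : cont (fun y => INR (pred p) * y ^ pred (pred p))) by cont_tac.
destruct (cont_bounded _ (- r) r ltac:(lra) C1) as [L [HL BL]].
destruct (cont_bounded _ (- r) r ltac:(lra) C2) as [L2 [HL2 BL2]].
exists L, L2. split; auto.
- intros y. unfold power_primitive, power_flux.
  evar_last; [apply (is_derive_scal (fun y => y ^ S p)), is_derive_pow_R|].
  change (pred (S p)) with p. field; auto.
- intros y. apply power_flux_derive; lia.
- intros y Hy. apply BL. now apply Rabs_le_between.
- intros y z Hy Hz. destruct (mean_value (power_speed p) _ z y (is_derive_pow_R (pred p))) as [v [Hv E]].
  rewrite E, Rabs_mult. apply Rmult_le_compat_r; [apply Rabs_pos|]. apply BL2.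
  apply Rabs_le_between. now apply (between_bound _ _ _ r Hv).
Qed.

Lemma power_flux_monotone p x y : Nat.Odd p -> x <= y -> power_flux p x <= power_flux p y.
Proof.
intros [q ->] Hxy. apply (deriv_nonneg_le _ (power_speed (2 * q + 1))); auto.
- intros z. apply power_flux_derive; lia.
- intros z _. unfold power_speed. replace (pred (2 * q + 1)) with (2 * q)%nat by lia.
  rewrite pow_mult. apply pow_le, pow2_ge_0.
Qed.

Lemma sob_of_bounds a b M r : forall g,
  (forall n x, (n <= r)%nat -> ex_derive_n g n x /\ continuous (Derive_n g n) x) ->
  (forall n x, (n < r)%nat -> a <= x <= b -> Rabs (Derive_n g n x) <= M) ->
  RInt (fun x => Derive_n g r x ^ 2) a b <= M -> sob a b r M g.
Proof.
induction r as [|r IH]; intros g Hd Hs HL.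
- split; auto. intros x. now apply (Hd 0%nat x).
- split; [|split].
  + intros x. now apply (Hd 1%nat x ltac:(lia)).
  + intros x Hx. now apply (Hs 0%nat x ltac:(lia)).
  + apply IH.
    * intros n x Hn. destruct (Hd (S n) x ltac:(lia)) as [H1 H2]. split.
      -- destruct n as [|n]; [exact I|]. simpl in *.
         apply (ex_derive_ext (Derive_n g (S n))); auto. intros; apply Derive_n_shift.
      -- apply (continuous_ext (Derive_n g (S n))); auto. intros; apply Derive_n_shift.
    * intros n x Hn Hx. rewrite <- Derive_n_shift. apply Hs; auto; lia.
    * rewrite <- (RInt_ext_R (fun x => Derive_n g (S r) x ^ 2)); auto.
      intros x. now rewrite Derive_n_shift.
Qed.

Lemma sobolev_norm_term a b n w K i : (i <= n)%nat -> sobolev_norm a b n w <= K ->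
  (forall i, (i <= n)%nat -> cont (Derive_n w i)) -> a <= b ->
  RInt (fun x => Derive_n w i x ^ 2) a b <= K ^ 2.
Proof.
intros Hi HK Hc Hab. unfold sobolev_norm in HK.
set (Sm := sum_n (fun i => RInt (fun x => (Derive_n w i x) ^ 2) a b) n) in HK.
assert (Hpos : forall i, (i < S n)%nat -> 0 <= RInt (fun x => (Derive_n w i x) ^ 2) a b).
{ intros j Hj. assert (C := Hc j ltac:(lia)).
  apply RInt_nonneg_cont; [auto|cont_tac|intros; apply pow2_ge_0]. }
assert (HS : Sm = bigsum (S n) (fun i => RInt (fun x => (Derive_n w i x) ^ 2) a b))
  by apply sum_n_bigsum.
assert (HS0 : 0 <= Sm) by (rewrite HS; now apply bigsum_nonneg).
assert (H1 := bigsum_term_le (S n) _ i Hpos ltac:(lia)). cbv beta in H1. rewrite <- HS in H1.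
assert (H2 := sqrt_sqrt Sm HS0). assert (H3 := sqrt_pos Sm).
assert (sqrt Sm * sqrt Sm <= K * K) by (apply Rmult_le_compat; lra).
replace (K ^ 2) with (K * K) by ring. lra.
Qed.

Definition time_derivative (u : R -> R -> R) (t : R) : R -> R := fun x => Derive (fun s => u s x) t.

(** All norms of the exact solution that enter the error bound, controlled by the
    Sobolev bound K alone: lower derivatives by the Sobolev inequality, the nonlocal term
    by elliptic regularity, the time derivative through the equation. *)
Lemma exact_regularity p k a b K : (2 <= p)%nat -> a < b -> exists M, 0 <= M /\
  forall T u, smooth_bounded a b T (k + 2) u -> fornberg_whitham a b T (power_flux p) u ->
  (forall t, 0 <= t <= T -> sobolev_norm a b (k + 2) (u t) <= K) ->
  (forall t, 0 <= t <= T -> sob a b (S (S k)) M (u t)) /\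
  (forall t, 0 < t < T -> sob a b (S k) M (time_derivative u t) /\ exists w,
     sob a b (S (S k)) M w /\ exact_slice a b (power_flux p) (u t) (time_derivative u t) w).
Proof.
intros Hp Hab. set (Cs := 2 / (b - a) + 2 * (b - a)).
assert (HCs : 0 < Cs).
{ assert (0 < 2 / (b - a)) by (apply Rdiv_lt_0_compat; lra). unfold Cs; lra. }
assert (HK2 := pow2_ge_0 K).
assert (HCK : 0 <= Cs * (K ^ 2 + K ^ 2)) by nonneg.
set (Mu := K ^ 2 + Cs * (K ^ 2 + K ^ 2) + 1). assert (HMu : 0 <= Mu) by (unfold Mu; lra).
set (Mu' := Mu + (b - a) * Mu ^ 2).
assert (HMM : Mu <= Mu').
{ assert (0 <= (b - a) * Mu ^ 2) by nonneg. unfold Mu'; lra. }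
destruct (sob_helmholtz a b Hab (S k) Mu HMu) as [Mw [HMw Hw]].
set (Mw1 := Mw + (b - a) * Mw ^ 2).
assert (HMw1 : Mw <= Mw1).
{ assert (0 <= (b - a) * Mw ^ 2) by nonneg. unfold Mw1; lra. }
set (Mw2 := Mw1 + (b - a) * Mw1 ^ 2).
assert (HMw2 : Mw1 <= Mw2).
{ assert (0 <= (b - a) * Mw1 ^ 2) by nonneg. unfold Mw2; lra. }
destruct (sob_pow a b (S k) Mu p ltac:(lra) HMu) as [Mp [HMp Hpow]].
set (Mf := (Rabs (/ INR p) + (/ INR p) ^ 2) * Mp).
assert (HMf : 0 <= Mf).
{ apply Rmult_le_pos; auto. assert (I1 := Rabs_pos (/ INR p)). assert (I2 := pow2_ge_0 (/ INR p)). lra. }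
set (Ms := 2 * (Mf + Mw2)). set (M1 := (Rabs (-1) + (-1) ^ 2) * Ms).
assert (HM1 : 0 <= M1).
{ apply Rmult_le_pos; [|unfold Ms; lra]. assert (I1 := Rabs_pos (-1)). simpl; lra. }
exists (Mu' + Mw1 + M1). split; [lra|]. intros T u Hsm Hfw HK.
destruct Hsm as [Hper [Hdiff [_ [_ _]]]].
assert (Su : forall t, 0 <= t <= T -> sob a b (S (S k)) Mu (u t)).
{ intros t Ht. assert (Hc : forall i, (i <= k + 2)%nat -> cont (Derive_n (u t) i))
    by (intros i Hi x; now apply Hdiff).
  assert (HL : forall i, (i <= k + 2)%nat -> RInt (fun x => Derive_n (u t) i x ^ 2) a b <= K ^ 2).
  { intros i Hi. apply (sobolev_norm_term a b (k + 2)); auto; lra. }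
  apply sob_of_bounds.
  - intros n x Hn. apply Hdiff; auto; lia.
  - intros n x Hn Hx.
    assert (Sn : smooth 1 (Derive_n (u t) n)).
    { split; [intros y; apply (Hdiff t (S n) y Ht ltac:(lia))|apply (Hc (S n)); lia]. }
    assert (H := sup_le_energy a b _ x Hab Sn Hx). fold Cs in H. apply sqr_bound_abs in H.
    assert (H1 := HL n ltac:(lia)). assert (H2 := HL (S n) ltac:(lia)). simpl Derive_n in H2.
    assert (Cs * (RInt (fun y => Derive_n (u t) n y ^ 2) a b
       + RInt (fun y => Derive (Derive_n (u t) n) y ^ 2) a b) <= Cs * (K ^ 2 + K ^ 2))
      by (apply Rmult_le_compat_l; lra). unfold Mu; lra.
  - assert (H := HL (S (S k)) ltac:(lia)). unfold Mu; lra. }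
split.
- intros t Ht. apply (sob_mono _ _ _ Mu); [lra|auto].
- intros t Ht. assert (Hut := Su t ltac:(lra)).
  destruct (Hfw t Ht) as [w [[Hwper [Hwd Hwe]] Hev]].
  destruct Hut as [Du [Bu Sdu]].
  assert (Sw : smooth 2 w).
  { assert (D1 : forall x, ex_derive w x) by (intros x; apply (Hwd 1%nat x); lia).
    assert (D2 : forall x, ex_derive (Derive w) x) by (intros x; apply (Hwd 2%nat x); lia).
    split; [auto|split; [auto|]]. simpl.
    assert (Cdu : cont (Derive (u t))) by (apply (smooth_cont (S k)), (sob_smooth a b _ Mu), Sdu).
    assert (Cw : cont w) by now apply cont_ex_derive.
    apply (cont_ext (fun x => w x - Derive (u t) x)); [|cont_tac].
    intros x. rewrite <- (Hwe x). simpl. change (Derive (fun x => w x) x) with (Derive w x).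
    unfold Derive_n. ring_simplify. reflexivity. }
  assert (Hpa : forall g, periodic (b - a) g -> g a = g b).
  { intros g Hg. rewrite <- (Hg a). f_equal; ring. }
  assert (Hpd : forall g, periodic (b - a) g -> (forall x, ex_derive g x) -> periodic (b - a) (Derive g)).
  { intros g Hg Dg x. symmetry. apply is_derive_unique.
    apply (is_derive_ext (fun y => g (y + (b - a)))); [intros y; apply Hg|].
    evar_last; [apply (is_derive_comp g (fun y => y + (b - a)))|].
    - apply Derive_correct, Dg.
    - auto_derive; auto.
    - unfold scal; simpl; unfold mult; simpl; ring. }
  assert (E0 : w a = w b) by now apply Hpa.
  assert (E1 : Derive w a = Derive w b) by (apply Hpa, Hpd; auto; apply Sw).
  assert (Ew : forall x, w x - Derive (Derive w) x = Derive (u t) x) by (intros x; apply (Hwe x)).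
  assert (W3 := Hw w (Derive (u t)) Sw Sdu E0 E1 Ew).
  assert (W2 := sob_le_S _ _ _ _ _ (Rlt_le _ _ Hab) W3). fold Mw1 in W2.
  assert (W1 := sob_le_S _ _ _ _ _ (Rlt_le _ _ Hab) W2). fold Mw2 in W1.
  assert (Sfu : sob a b (S (S k)) Mf (fun y => power_flux p (u t y))).
  { apply (sob_scal a b (S (S k)) Mp (fun y => u t y ^ p)); auto; [lra|].
    apply (Hpow (u t)). split; [auto|split; auto]. }
  destruct Sfu as [_ [_ Sdfu]].
  assert (E1t : forall x, time_derivative u t x = -1 * (Derive (fun y => power_flux p (u t y)) x + w x)).
  { intros x. assert (H := Hev x). unfold time_derivative. lra. }
  assert (S1 : sob a b (S k) M1 (time_derivative u t)).
  { apply (sob_ext _ _ _ _ (fun x => -1 * (Derive (fun y => power_flux p (u t y)) x + w x)));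
      [intros x; now rewrite E1t|].
    apply sob_scal; [lra|unfold Ms; lra|]. apply sob_plus; auto; lra. }
  split; [apply (sob_mono _ _ _ M1); auto; lra|].
  exists w. split; [apply (sob_mono _ _ _ Mw1); auto; lra|].
  split; auto.
  + split; [auto|]. apply (smooth_cont (S k)), (sob_smooth a b _ Mu), Sdu.
  + apply (smooth_cont (S k)), (sob_smooth a b _ M1), S1.
  + apply Hpa, Hper; lra.
Qed.

(** The time derivative of the exact solution, given only at each point, is uniform in
    space: u is uniformly Lipschitz in time, hence u_x is equicontinuous in time by
    interpolation and so is the nonlocal term by the energy estimate, and then u_t is by
    the equation. *)
Lemma time_regularity p k a b T M u : (2 <= p)%nat -> a < b -> 0 < T -> 0 <= M ->
  smooth_bounded a b T (k + 2) u ->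
  (forall t, 0 <= t <= T -> sob a b (S (S k)) M (u t)) ->
  (forall t, 0 < t < T -> sob a b (S k) M (time_derivative u t) /\ exists w,
     sob a b (S (S k)) M w /\ exact_slice a b (power_flux p) (u t) (time_derivative u t) w) ->
  (forall s, cont (u (clamp T s))) /\
  (forall t, unif_cont a b (fun s => u (clamp T s)) t) /\
  (forall t, 0 < t < T -> unif_deriv a b (fun s => u (clamp T s)) t (time_derivative u t)).
Proof.
intros Hp Hab HT HM [_ [Hdiff [[B HB] [Htc Htd]]]] Hu Hu1.
assert (Ccl : forall x, cont (fun s => u (clamp T s) x)).
{ intros x. apply (clamp_cont T (fun t => u t x)); [lra|apply Htc]. }
assert (Hlip : forall s t x, 0 <= s <= T -> 0 <= t <= T -> a <= x <= b ->
   Rabs (u s x - u t x) <= M * Rabs (s - t)).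
{ assert (Hlip' : forall s t x, 0 <= s -> s <= t -> t <= T -> a <= x <= b ->
     Rabs (u t x - u s x) <= M * Rabs (t - s)).
  { intros s t x Hs Hst Ht Hx.
    destruct (mean_value_open (fun s => u (clamp T s) x) (fun s => time_derivative u s x)
      (fun l => Rabs l <= M) s t Hst (Ccl x)) as [l [Hl E]].
    - rewrite Rabs_R0; auto.
    - intros z Hz. split.
      + apply (clamp_derive T (fun s => u s x)); [lra|]. apply Derive_correct, Htd; lra.
      + destruct (Hu1 z ltac:(lra)) as [[_ [Bz _]] _]. now apply Bz.
    - cbv beta in E. rewrite !clamp_id in E by lra. rewrite E, Rabs_mult.
      apply Rmult_le_compat_r; auto using Rabs_pos. }
  intros s t x Hs Ht Hx. destruct (Rle_dec s t).
  - rewrite Rabs_minus_sym, (Rabs_minus_sym s t). apply Hlip'; lra.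
  - apply Hlip'; lra. }
assert (HB0 : 0 <= B).
{ assert (H := HB 0 0%nat a ltac:(lra) ltac:(lia)). assert (I := Rabs_pos (Derive_n (u 0) 0 a)). lra. }
destruct (power_flux_data p M Hp HM) as [L [L2 Hf]].
assert (HL := flux_L Hf). assert (HL2 := flux_L2 Hf).
set (Cs := 2 / (b - a) + 2 * (b - a)).
assert (HCs : 0 < Cs).
{ assert (0 < 2 / (b - a)) by (apply Rdiv_lt_0_compat; lra). unfold Cs; lra. }
set (Q := L + sqrt (Cs * (b - a))).
assert (HQ : 0 <= Q) by (assert (I := sqrt_pos (Cs * (b - a))); unfold Q; lra).
assert (Hpair : forall s t y x, 0 < s < T -> 0 < t < T -> 0 <= y ->
   (forall x, a <= x <= b -> Rabs (Derive (u s) x - Derive (u t) x) <= y) -> a <= x <= b ->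
   Rabs (time_derivative u s x - time_derivative u t x) <= Q * y + L2 * M * M * Rabs (s - t)).
{ intros s t y x Hs Ht Hy0 Hy Hx.
  destruct (Hu1 s Hs) as [_ [ws [_ Es]]]. destruct (Hu1 t Ht) as [_ [wt [_ Et]]].
  destruct (Hu s ltac:(lra)) as [Ds [Bs [_ [Bs1 _]]]]. destruct (Hu t ltac:(lra)) as [Dt [Bt [_ [Bt1 _]]]].
  destruct Es as [Sus Sws _ _ Ps Ps1 Els Evs]. destruct Et as [Sut Swt _ _ Pt Pt1 Elt Evt].
  assert (Hder : forall g, (forall x, ex_derive g x) -> Derive (fun y => power_flux p (g y)) x
     = Derive g x * power_speed p (g x)).
  { intros g Dg. apply is_derive_unique. apply (is_derive_comp (power_flux p) g).
    - apply (flux_derive Hf).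
    - apply Derive_correct, Dg. }
  assert (Evs' := Evs x). assert (Evt' := Evt x). rewrite Hder in Evs', Evt' by auto.
  set (W := fun x => ws x - wt x).
  destruct Sws as [D1s [D2s C2s]]. destruct Swt as [D1t [D2t C2t]]. simpl in C2s, C2t.
  assert (DW : forall x, Derive W x = Derive ws x - Derive wt x)
    by (intros z; now apply Derive_minus).
  assert (DW2 : forall x, Derive (Derive W) x = Derive (Derive ws) x - Derive (Derive wt) x).
  { intros z. rewrite (Derive_ext _ _ z DW). now apply Derive_minus. }
  assert (SW : smooth 2 W).
  { split; [intros z; now apply (ex_derive_minus ws wt)|split].
    - intros z. apply (ex_derive_ext (fun x => Derive ws x - Derive wt x)); [auto|].
      now apply (ex_derive_minus (Derive ws) (Derive wt)).
    - apply (cont_ext (fun x => Derive (Derive ws) x - Derive (Derive wt) x)); [auto|cont_tac]. }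
  destruct Sus as [_ Cus]. destruct Sut as [_ Cut]. simpl in Cus, Cut.
  assert (Hen := helmholtz_energy a b W (fun x => Derive (u s) x - Derive (u t) x) ltac:(lra) SW
    ltac:(cont_tac)).
  cbv beta in Hen. rewrite !DW in Hen. unfold W in Hen at 1 2. rewrite Ps, Pt, Ps1, Pt1 in Hen.
  specialize (Hen eq_refl eq_refl).
  assert (HWe : forall x, W x - Derive (Derive W) x = Derive (u s) x - Derive (u t) x).
  { intros z. rewrite DW2, <- Els, <- Elt. unfold W; ring. }
  specialize (Hen HWe).
  assert (Hg : RInt (fun x => (Derive (u s) x - Derive (u t) x) ^ 2) a b <= (b - a) * y ^ 2).
  { rewrite <- RInt_const_R. apply RInt_le_cont; [lra|cont_tac|apply cont_const|].
    intros z Hz. apply sqr_le_of_abs, Hy; lra. }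
  assert (HW : Rabs (W x) <= sqrt (Cs * (b - a)) * y).
  { rewrite <- (sqrt_pow2 y) at 1 by auto. rewrite <- sqrt_mult; [|apply Rmult_le_pos; lra|apply pow2_ge_0].
    rewrite <- sqrt_Rsqr_abs. apply sqrt_le_1_alt.
    assert (SW1 : smooth 1 W).
    { destruct SW as [DW1 [DW2' _]]. split; [auto|]. simpl. now apply cont_ex_derive. }
    assert (H := sup_le_energy a b W x Hab SW1 Hx). fold Cs in H. unfold Rsqr.
    replace (W x * W x) with (W x ^ 2) by ring. eapply Rle_trans; [apply H|].
    rewrite Rmult_assoc. apply Rmult_le_compat_l; lra. }
  assert (HA : Rabs (Derive (u s) x * (power_speed p (u s x))
       - Derive (u t) x * (power_speed p (u t x))) <= L * y + L2 * M * M * Rabs (s - t)).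
  { replace (Derive (u s) x * (power_speed p (u s x)) - Derive (u t) x * (power_speed p (u t x)))
      with ((Derive (u s) x - Derive (u t) x) * power_speed p (u s x)
        + Derive (u t) x * (power_speed p (u s x) - power_speed p (u t x))) by ring.
    eapply Rle_trans; [apply Rabs_triang|]. rewrite !Rabs_mult. apply Rplus_le_compat.
    - rewrite Rmult_comm. apply Rmult_le_compat; auto using Rabs_pos.
      apply (flux_bound Hf); auto.
    - replace (L2 * M * M * Rabs (s - t)) with (M * (L2 * (M * Rabs (s - t)))) by ring.
      apply Rmult_le_compat; auto using Rabs_pos.
      eapply Rle_trans; [apply (flux_lip Hf); auto|].
      apply Rmult_le_compat_l; auto. apply Hlip; lra. }
  replace (time_derivative u s x - time_derivative u t x) with
    (- (Derive (u s) x * (power_speed p (u s x)) - Derive (u t) x * (power_speed p (u t x))) + - W x)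
    by (unfold W; lra).
  eapply Rle_trans; [apply Rabs_triang|]. rewrite !Rabs_Ropp. unfold Q. lra. }
assert (Hux : forall s t e x, 0 <= s <= T -> 0 <= t <= T -> 0 < e <= (b - a) / 2 -> a <= x <= b ->
   Rabs (Derive (u s) x - Derive (u t) x) <= 2 * (M * Rabs (s - t)) / e + 2 * B * e).
{ intros s t e x Hs Ht He Hx.
  destruct (sob_smooth _ _ _ _ _ (Hu s Hs)) as [D1s [D2s S2s]].
  destruct (sob_smooth _ _ _ _ _ (Hu t Ht)) as [D1t [D2t S2t]].
  assert (C2s := smooth_cont _ _ S2s). assert (C2t := smooth_cont _ _ S2t).
  set (D := fun x => u s x - u t x).
  assert (DD : forall x, Derive D x = Derive (u s) x - Derive (u t) x)
    by (intros z; now apply Derive_minus).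
  assert (DD2 : forall x, Derive (Derive D) x = Derive (Derive (u s)) x - Derive (Derive (u t)) x).
  { intros z. rewrite (Derive_ext _ _ z DD). now apply Derive_minus. }
  rewrite <- DD. apply (derivative_interpolation a b D); auto.
  - split; [intros z; now apply (ex_derive_minus (u s) (u t))|split].
    + intros z. apply (ex_derive_ext (fun x => Derive (u s) x - Derive (u t) x)); [auto|].
      now apply (ex_derive_minus (Derive (u s)) (Derive (u t))).
    + apply (cont_ext (fun x => Derive (Derive (u s)) x - Derive (Derive (u t)) x)); [auto|cont_tac].
  - intros y Hy. apply Hlip; auto.
  - intros y Hy. rewrite DD2. unfold Rminus. eapply Rle_trans; [apply Rabs_triang|].
    rewrite Rabs_Ropp.
    assert (H1 : Rabs (Derive (Derive (u s)) y) <= B) by exact (HB s 2%nat y Hs ltac:(lia)).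
    assert (H2 : Rabs (Derive (Derive (u t)) y) <= B) by exact (HB t 2%nat y Ht ltac:(lia)).
    lra. }
split; [|split].
- intros s. apply (smooth_cont (S (S k))), (sob_smooth a b _ M), Hu, clamp_range; lra.
- intros t e He. exists (e / (M + 1)). split; [apply Rdiv_lt_0_compat; lra|].
  intros s Hs x Hx. eapply Rle_trans; [apply Hlip; auto; apply clamp_range; lra|].
  assert (H := clamp_lip T s t ltac:(lra)).
  apply Rle_trans with ((M + 1) * (e / (M + 1))); [|apply Req_le; field; lra].
  apply Rmult_le_compat; auto using Rabs_pos; lra.
- intros t Ht e He.
  set (d1 := Rmin ((b - a) / 2) (e / (2 * (Q + 1) * (2 * B + 1)))).
  assert (HQB : 0 < 2 * (Q + 1) * (2 * B + 1)) by (apply Rmult_lt_0_compat; lra).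
  assert (Hd1 : 0 < d1).
  { apply Rmin_glb_lt; [lra|]. now apply Rdiv_lt_0_compat. }
  assert (Hd1b : d1 <= (b - a) / 2) by apply Rmin_l.
  assert (Hd1e : Q * (2 * B * d1) <= e / 2).
  { apply Rle_trans with ((Q + 1) * ((2 * B + 1) * (e / (2 * (Q + 1) * (2 * B + 1))))).
    - apply Rmult_le_compat; try lra; [apply Rmult_le_pos; lra|].
      apply Rmult_le_compat; try lra. apply Rmin_r.
    - apply Req_le. field; lra. }
  set (Z := Q * (2 * M / d1) + L2 * M * M).
  assert (HZ : 0 <= Z).
  { assert (0 <= 2 * M / d1) by (apply Rdiv_le_0_compat; lra).
    assert (0 <= Q * (2 * M / d1)) by nonneg.
    assert (0 <= L2 * M * M) by nonneg. unfold Z; lra. }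
  set (d2 := Rmin (Rmin t (T - t)) (e / (2 * (Z + 1)))).
  assert (Hd2 : 0 < d2).
  { apply Rmin_glb_lt; [apply Rmin_glb_lt; lra|]. apply Rdiv_lt_0_compat; lra. }
  exists d2. split; auto. intros s Hs x Hx.
  assert (Hd2a : d2 <= t) by (eapply Rle_trans; [apply Rmin_l|apply Rmin_l]).
  assert (Hd2b : d2 <= T - t) by (eapply Rle_trans; [apply Rmin_l|apply Rmin_r]).
  assert (Hd2c : d2 <= e / (2 * (Z + 1))) by apply Rmin_r.
  assert (Hs' := Rabs_def2 _ _ Hs).
  rewrite !clamp_id by lra.
  destruct (mean_value_open (fun r => u (clamp T r) x - (r - t) * time_derivative u t x)
    (fun r => time_derivative u r x - time_derivative u t x) (fun l => Rabs l <= e)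
    (Rmin s t) (Rmax s t)) as [l [Hl E]].
  + unfold Rmin, Rmax; destruct (Rle_dec s t); lra.
  + assert (C := Ccl x).
    apply (cont_minus (fun r => u (clamp T r) x) (fun r => (r - t) * time_derivative u t x)); cont_tac.
  + cbv beta; rewrite Rabs_R0; lra.
  + intros z Hz.
    assert (Hzt : 0 < z < T) by (unfold Rmin, Rmax in Hz; destruct (Rle_dec s t); lra).
    assert (Hzd : Rabs (z - t) <= d2).
    { apply Rabs_le. unfold Rmin, Rmax in Hz. destruct (Rle_dec s t); lra. }
    split.
    * apply (is_derive_minus (fun r => u (clamp T r) x) (fun r => (r - t) * time_derivative u t x)).
      -- apply (clamp_derive T (fun s => u s x)); auto. apply Derive_correct, Htd; auto.
      -- auto_derive; auto. ring.
    * assert (Hab0 := Rabs_pos (z - t)).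
      assert (Hy0 : 0 <= 2 * (M * Rabs (z - t)) / d1 + 2 * B * d1).
      { assert (0 <= 2 * (M * Rabs (z - t)) / d1).
        { apply Rdiv_le_0_compat; auto. assert (0 <= M * Rabs (z - t)) by nonneg. lra. }
        assert (0 <= 2 * B * d1) by nonneg. lra. }
      eapply Rle_trans; [apply (Hpair z t _ x Hzt Ht Hy0); auto|].
      { intros y Hy. apply Hux; auto; lra. }
      replace (Q * (2 * (M * Rabs (z - t)) / d1 + 2 * B * d1) + L2 * M * M * Rabs (z - t))
        with (Z * Rabs (z - t) + Q * (2 * B * d1)) by (unfold Z; field; lra).
      assert (Z * Rabs (z - t) <= (Z + 1) * (e / (2 * (Z + 1)))).
      { apply Rmult_le_compat; auto; lra. }
      replace ((Z + 1) * (e / (2 * (Z + 1)))) with (e / 2) in * by (field; lra). lra.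
  + cbv beta in E. rewrite !clamp_id in E by (unfold Rmin, Rmax; destruct (Rle_dec s t); lra).
    assert (E' : Rabs (u s x - u t x - (s - t) * time_derivative u t x) = Rabs (l * (s - t))).
    { unfold Rmin, Rmax in E. destruct (Rle_dec s t).
      - rewrite <- Rabs_Ropp, <- (Rabs_Ropp (l * (s - t))). f_equal. lra.
      - f_equal. lra. }
    rewrite E', Rabs_mult. apply Rmult_le_compat_r; auto using Rabs_pos.
Qed.

(** * The error estimate for a scheme with weight kappa *)

(** What the linear flux with parameter th costs in consistency, when the functions are
    projected with interpolation at the end e of the cells. *)
Definition residual_bound (k : nat) (sigma th e : R) (kap : R -> R) (Cr : R) : Prop :=
  forall a b (m : mesh a b) eta Sq phi, hmax m / hmin m <= sigma -> 0 <= Sq ->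
    mean_free m k eta -> cell_bounded m eta Sq ->
    (forall j, (j < ncell m)%nat -> eta j (node m j + (node m (S j) - node m j) * e) = 0) ->
    Vh m k phi -> Rabs (ddx m th eta phi) <= / 16 * ip m phi phi + Cr * (kap (hmax m) * Sq).

(** What the nonlinear flux costs at a node. The projection of u interpolates at the right
    end of each cell, so that only the trace from the right carries an error ep. *)
Definition node_bound (f F : R -> R) (fhat : R -> R -> R) (r A : R) (kap : R -> R) (Cn : R) : Prop :=
  forall h u xm xp ep, 0 < h <= 1 -> Rabs u <= r - 2 -> Rabs xm <= 1 -> Rabs xp <= 1 ->
    Rabs ep <= 1 -> Rabs ep <= A * h ->
    node_term F (u + xm) (u + xp) (fhat (u + xm) (u + xp - ep))
    <= Cn * (kap h * ep ^ 2 + h * (xm ^ 2 + xp ^ 2)).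

Definition cellwise {a b} (m : mesh a b) (P : R -> R -> (R -> R) -> R -> R) (g : R -> R)
  : nat -> R -> R := fun j => P (node m j) (node m (S j)) g.

Lemma cellwise_Vh {a b} (m : mesh a b) k e C P g : radau k e C P -> cont g ->
  Vh m k (cellwise m P g).
Proof.
intros HP Hg j Hj. apply (radau_poly HP); auto. now apply (node_incr _ _ m).
Qed.

Lemma cellwise_mean_free {a b} (m : mesh a b) k e C P g : radau k e C P -> cont g ->
  mean_free m k (interp_error g (cellwise m P g)).
Proof.
intros HP Hg phi Hphi j Hj. apply (radau_orth HP); auto.
- now apply (node_incr _ _ m).
- apply is_poly_derive, Hphi, Hj.
Qed.

Lemma cellwise_end {a b} (m : mesh a b) k e C P g j : radau k e C P -> cont g ->
  (j < ncell m)%nat ->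
  interp_error g (cellwise m P g) j (node m j + (node m (S j) - node m j) * e) = 0.
Proof.
intros HP Hg Hj. unfold interp_error, cellwise.
rewrite (radau_end HP); auto; [ring|]. now apply (node_incr _ _ m).
Qed.

Lemma cell_bounded_mono {a b} (m : mesh a b) eta Sq S' : Sq <= S' -> cell_bounded m eta Sq ->
  cell_bounded m eta S'.
Proof. intros H [s [H1 H2]]. exists s; split; auto; lra. Qed.

Lemma cellwise_bounded {a b} (m : mesh a b) k e C P M g : a <= b -> 0 < C -> radau k e C P ->
  sob a b (S k) M g ->
  cell_bounded m (interp_error g (cellwise m P g)) (C * M * hmax m ^ (2 * k + 1)).
Proof.
intros Hab HC HP Hg. assert (Sg := sob_smooth _ _ _ _ _ Hg).
assert (CD := smooth_Derive_n _ _ Sg).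
exists (fun j => C * hmax m ^ (2 * k + 1) * cell_int m j (fun y => Derive_n g (S k) y ^ 2)).
assert (Hh := hmax_pos m).
assert (Hp : 0 < hmax m ^ (2 * k + 1)) by now apply pow_lt.
split.
- intros j x Hj Hx. assert (Hc := node_incr _ _ m j Hj).
  eapply Rle_trans; [apply (radau_approx HP); auto|].
  apply Rmult_le_compat_r.
  + apply RInt_nonneg_cont; [lra|cont_tac|intros; apply pow2_ge_0].
  + apply Rmult_le_compat_l; [lra|]. apply pow_incr. split; [lra|]. now apply (width_le_hmax m).
- rewrite bigsum_scal, sum_cell_int by cont_tac.
  assert (HL := sob_last _ _ _ _ _ Hg).
  replace (C * M * hmax m ^ (2 * k + 1)) with (C * hmax m ^ (2 * k + 1) * M) by ring.
  apply Rmult_le_compat_l; auto. apply Rlt_le, Rmult_lt_0_compat; lra.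
Qed.

Lemma cellwise_small {a b} (m : mesh a b) k e C P M g j x : (1 <= k)%nat -> a <= b -> 0 < C ->
  radau k e C P -> sob a b (S k) M g -> hmax m <= 1 -> (j < ncell m)%nat ->
  node m j <= x <= node m (S j) ->
  Rabs (interp_error g (cellwise m P g) j x) <= sqrt (C * M) * width m j.
Proof.
intros Hk Hab HC HP Hg Hh1 Hj Hx. assert (Sg := sob_smooth _ _ _ _ _ Hg).
assert (CD := smooth_Derive_n _ _ Sg). assert (Hc := node_incr _ _ m j Hj).
assert (Hw := width_pos m j Hj). assert (Hw1 := width_le_hmax m j Hj).
set (D := fun y => Derive_n g (S k) y ^ 2).
assert (CD2 : cont D) by (unfold D; cont_tac).
assert (Hpos : forall c d, c <= d -> 0 <= RInt D c d).
{ intros c d Hcd. apply RInt_nonneg_cont; auto. intros; apply pow2_ge_0. }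
assert (HM : RInt D (node m j) (node m (S j)) <= M).
{ assert (HL := sob_last _ _ _ _ _ Hg).
  destruct (node_range m j ltac:(lia)) as [N1 N2].
  destruct (node_range m (S j) ltac:(lia)) as [N3 N4].
  assert (E1 := RInt_Chasles_cont D a (node m j) b CD2).
  assert (E2 := RInt_Chasles_cont D (node m j) (node m (S j)) b CD2).
  assert (P1 := Hpos a (node m j) N1). assert (P2 := Hpos (node m (S j)) b N4).
  fold D in HL. lra. }
assert (H := radau_approx HP _ _ g x Hc Sg Hx). fold D in H. fold (width m j) in H.
assert (Hp : width m j ^ (2 * k + 1) <= width m j ^ 2).
{ replace (2 * k + 1)%nat with (2 + (2 * k - 1))%nat by lia. rewrite pow_add.
  rewrite <- (Rmult_1_r (width m j ^ 2)) at 2. apply Rmult_le_compat_l; [apply pow2_ge_0|].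
  rewrite <- (pow1 (2 * k - 1)). apply pow_incr; lra. }
assert (HM0 : 0 <= M) by (assert (I := Hpos (node m j) (node m (S j)) ltac:(lra)); lra).
rewrite <- (sqrt_pow2 (width m j)) by lra.
rewrite <- sqrt_mult; [|apply Rmult_le_pos; lra|apply pow2_ge_0].
rewrite <- sqrt_Rsqr_abs. apply sqrt_le_1_alt. unfold Rsqr.
unfold interp_error, cellwise. eapply Rle_trans; [apply Req_le|eapply Rle_trans; [apply H|]]; [ring|].
replace (C * M * width m j ^ 2) with (C * width m j ^ 2 * M) by ring.
apply Rmult_le_compat; auto.
- apply Rmult_le_pos; [lra|]. apply pow_le; lra.
- apply Hpos; lra.
- apply Rmult_le_compat_l; lra.
Qed.

Lemma L2_error_sqr {a b} (m : mesh a b) w v : cont w -> pw_cont m v ->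
  0 <= L2_error m w v /\
  L2_error m w v ^ 2 = bigsum (ncell m) (fun j => cell_int m j (fun x => (w x - v j x) ^ 2)).
Proof.
intros Hw Hv. unfold L2_error. split; [apply sqrt_pos|].
assert (Hn := ncell_pos _ _ m). rewrite sum_n_bigsum, Nat.succ_pred_pos by auto.
rewrite pow2_sqrt; auto. apply bigsum_nonneg; intros j Hj. specialize (Hv j Hj).
apply RInt_nonneg_cont; [now apply cell_le|cont_tac|intros; apply pow2_ge_0].
Qed.

Lemma sum_sqr_le {a b} (m : mesh a b) (p q s : nat -> R -> R) :
  pw_cont m p -> pw_cont m q -> pw_cont m s ->
  (forall j x, (j < ncell m)%nat -> p j x = q j x - s j x) ->
  ip m p p <= 2 * ip m q q + 2 * ip m s s.
Proof.
intros Hp Hq Hs E. unfold ip. rewrite <- !bigsum_scal, <- bigsum_plus.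
apply bigsum_le; intros j Hj. specialize (Hp j Hj). specialize (Hq j Hj). specialize (Hs j Hj).
unfold cell_int. rewrite <- !RInt_scal_cont, <- RInt_plus_cont by cont_tac.
apply RInt_le_cont; [now apply cell_le|cont_tac|cont_tac|]. intros x _. rewrite E by auto.
assert (I := pow2_ge_0 (q j x + s j x)). lra.
Qed.

(** At node 0 the left trace lies at the other end of the domain, where u takes the same
    value. *)
Lemma trace_split {a b} (m : mesh a b) (u : R -> R) (uh pu : nat -> R -> R) i : u a = u b ->
  (i < ncell m)%nat ->
  trace_minus m uh i = u (node m i) + trace_minus m (fun j x => uh j x - pu j x) i
     - trace_minus m (interp_error u pu) i /\
  trace_plus m uh i = u (node m i) + trace_plus m (fun j x => uh j x - pu j x) i
     - trace_plus m (interp_error u pu) i.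
Proof.
intros Hu Hi. split.
- destruct i as [|i]; unfold trace_minus, interp_error.
  + rewrite (node_first _ _ m), (node_last _ _ m), Hu. ring.
  + ring.
- rewrite !trace_plus_lt by auto. unfold interp_error. ring.
Qed.

(** The abstract estimate. The energy of xi = numerical - projected solution obeys a linear
    differential inequality while xi is at most 1, which by the inverse inequality holds
    below the energy threshold dl of order h; the resulting bound is of order h^2 and so
    never reaches the threshold if h is small. *)
Lemma scheme_estimate p k a b T sigma K C0 (Fl : fluxes) th ew (kap : R -> R) :
  (2 <= p)%nat -> (1 <= k)%nat -> a < b -> 0 < T ->
  (forall x y, qhat Fl x y = lin th x y) -> (forall x y, uhat Fl x y = lin th x y) ->
  (forall x y, vhat Fl x y = lin (1 - th) x y) -> ew = 0 \/ ew = 1 ->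
  (forall h, 0 < h <= 1 -> 0 <= kap h /\ (kap h + h) * h ^ (2 * k + 1) <= 2 * h ^ 2) ->
  (forall s, 0 < s -> exists Cr, 0 <= Cr /\ residual_bound k s th 1 kap Cr /\
     residual_bound k s (1 - th) ew kap Cr) ->
  (forall f1 F r L L2 A, flux_data (power_flux p) f1 F r L L2 -> 0 <= A ->
     exists Cn, 0 <= Cn /\ node_bound (power_flux p) F (fhat Fl) r A kap Cn) ->
  exists C h0, 0 < C /\ 0 < h0 <= 1 /\
  forall u, smooth_bounded a b T (k + 2) u -> fornberg_whitham a b T (power_flux p) u ->
  (forall t, 0 <= t <= T -> sobolev_norm a b (k + 2) (u t) <= K) ->
  forall (m : mesh a b) uh vh qh, hmax m <= h0 -> hmax m / hmin m <= sigma ->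
    L2_error m (u 0) (uh 0) <= C0 * hmax m ^ (k + 1) ->
    ldg_solution m k T (power_flux p) Fl uh vh qh ->
    forall t, 0 <= t <= T ->
      L2_error m (u t) (uh t) ^ 2 <= C * ((kap (hmax m) + hmax m) * hmax m ^ (2 * k + 1)).
Proof.
intros Hp Hk Hab HT Eq Eu Ev Hew Hkap Hres Hnode.
set (sg := Rmax sigma 1). assert (Hsg : 0 < sg) by (assert (I := Rmax_r sigma 1); unfold sg; lra).
destruct (exact_regularity p k a b K Hp Hab) as [M [HM Hreg]].
destruct (power_flux_data p (M + 2) Hp ltac:(lra)) as [L [L2 Hf]].
assert (HL2 := flux_L2 Hf).
destruct (inverse_cell k) as [Ci [HCi Hinv]].
destruct (radau_exists k 1 Hk ltac:(auto)) as [Cu [P [HCu HP]]].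
destruct (radau_exists k ew Hk Hew) as [Cw [Pw [HCw HPw]]].
set (M' := M + (b - a) * M ^ 2).
assert (HMM : M <= M').
{ assert (0 <= (b - a) * M ^ 2) by nonneg. unfold M'; lra. }
set (A := sqrt (Cu * M')). assert (HA : 0 <= A) by apply sqrt_pos.
destruct (Hnode _ _ _ _ _ A Hf HA) as [Cn [HCn Hnb]].
destruct (Hres sg Hsg) as [Cr [HCr [Hr1 Hr2]]].
destruct (energy_rate k (M + 2) M L L2 A Ci sg Cn Cr HA HM HL2 HCi Hsg HCn HCr Hinv) as [Ce [HCe Hrate]].
set (CS := (Cu + Cw) * M').
assert (HCS : 0 <= CS) by nonneg.
(* CE collects the initial error, twice the projection error and the source term W of
   Gronwall's inequality, X is the growth factor; the first part of h0 keeps eta at most 1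
   and the second one keeps the final bound below the threshold. *)
set (CE := 2 * C0 ^ 2 + 3 * CS).
assert (HCE : 0 <= CE) by (assert (I := pow2_ge_0 C0); unfold CE; lra).
set (X := exp (2 * Ce * T)).
assert (HX : 1 <= X).
{ unfold X. rewrite <- exp_0. apply Rlt_le, exp_increasing.
  apply Rmult_lt_0_compat; lra. }
assert (HCEX : 0 <= CE * X) by nonneg.
assert (HsC : 0 < Ci * sg) by now apply Rmult_lt_0_compat.
assert (HBp : 0 <= CE * X * (Ci * sg)) by nonneg.
set (h0 := / (1 + A + 4 * (CE * X * (Ci * sg)))).
assert (Hden : 1 <= 1 + A + 4 * (CE * X * (Ci * sg))) by lra.
exists (2 * (CE * X) + 2 * CS + 1), h0.
split; [lra|]. split.
{ unfold h0. split; [apply Rinv_0_lt_compat; lra|]. rewrite <- Rinv_1. apply Rinv_le_contravar; lra. }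
intros u Husm Hfw HK m uh vh qh Hhh Hsig Hinit Hldg.
destruct (Hreg T u Husm Hfw HK) as [Hu Hu1].
destruct (time_regularity p k a b T M u Hp Hab HT HM Husm Hu Hu1) as [Cucl [Hucont Huder]].
destruct Hldg as [HV [Hcont [Hder Heq]]].
set (h := hmax m) in *. assert (Hh : 0 < h) by apply hmax_pos.
assert (Hsig' : h / hmin m <= sg) by (assert (I := Rmax_l sigma 1); unfold sg; lra).
assert (Hh0 : h * (1 + A + 4 * (CE * X * (Ci * sg))) <= 1).
{ apply (Rmult_le_compat_r (1 + A + 4 * (CE * X * (Ci * sg)))) in Hhh; [|lra].
  unfold h0 in Hhh. rewrite Rinv_l in Hhh; lra. }
assert (HhA : 0 <= h * A) by nonneg.
assert (HhB : 0 <= h * (4 * (CE * X * (Ci * sg)))) by nonneg.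
assert (Hh1 : h <= 1) by lra.
assert (HAh : A * h <= 1) by lra.
destruct (Hkap h ltac:(lra)) as [Hk0 Hk2].
set (Sq := CS * h ^ (2 * k + 1)).
assert (Hhp : 0 < h ^ (2 * k + 1)) by now apply pow_lt.
assert (HS : 0 <= Sq) by nonneg.
set (W := (kap h + h) * Sq). assert (HW : 0 <= W) by nonneg.
set (Z := (kap h + h) * h ^ (2 * k + 1)).
assert (HZ : 0 <= Z) by nonneg.
assert (HZW : W = CS * Z) by (unfold W, Sq, Z; ring).
assert (HhZ : h * h ^ (2 * k + 1) <= Z) by (apply Rmult_le_compat_r; lra).
assert (HhS : h * Sq <= CS * Z).
{ unfold Sq. replace (h * (CS * h ^ (2 * k + 1))) with (CS * (h * h ^ (2 * k + 1))) by ring.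
  now apply Rmult_le_compat_l. }
set (pu := fun s => cellwise m P (u (clamp T s))).
set (xi := fun s j x => uh (clamp T s) j x - pu s j x).
set (E := fun s => ip m (xi s) (xi s)).
assert (HTp : 0 <= T) by lra.
assert (Vpu : forall s, Vh m k (pu s)) by (intros s; now apply (cellwise_Vh m k 1 Cu)).
assert (Vuh : forall s, Vh m k (uh (clamp T s))) by (intros s; apply HV, clamp_range; auto).
assert (Vxi : forall s, Vh m k (xi s)) by (intros s; now apply Vh_minus).
assert (Hsobu : forall s, sob a b (S k) M' (u (clamp T s))).
{ intros s. apply sob_le_S; [lra|]. apply Hu, clamp_range; auto. }
assert (Beta : forall s, cell_bounded m (interp_error (u (clamp T s)) (pu s)) Sq).
{ intros s. apply (cell_bounded_mono m _ (Cu * M' * h ^ (2 * k + 1))).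
  - unfold Sq, CS. apply Rmult_le_compat_r; [lra|]. apply Rmult_le_compat_r; lra.
  - apply (cellwise_bounded m k 1); auto; lra. }
assert (Keta : forall s, pw_cont m (interp_error (u (clamp T s)) (pu s)))
  by (intros s; now apply (interp_error_cont m k)).
assert (Etaip : forall s, ip m (interp_error (u (clamp T s)) (pu s))
    (interp_error (u (clamp T s)) (pu s)) <= CS * Z).
{ intros s. eapply Rle_trans; [apply (cell_bounded_ip m _ Sq (Beta s) (Keta s))|]. exact HhS. }
assert (Hcell : forall j x, (j < ncell m)%nat -> node m j <= x <= node m (S j) -> a <= x <= b)
  by (intros j x Hj; now apply (cell_in_domain m j)).
assert (CE0 : cont E).
{ unfold E, ip. apply (cont_bigsum (ncell m) (fun j s => cell_int m j (fun x => xi s j x * xi s j x))).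
  intros j Hj. assert (Hc := node_incr _ _ m j Hj).
  apply (energy_cont k (fun s => xi s j)); [intros s; now apply Vxi|]. intros x.
  apply (cont_minus (fun s => uh (clamp T s) j x) (fun s => pu s j x)).
  - apply (clamp_cont T (fun t => uh t j x)); auto.
  - intros s. apply (radau_cont HP _ _ (fun s => u (clamp T s))); auto.
    intros e He. destruct (Hucont s e He) as [dl [Hdl H]]. exists dl. split; auto.
    intros s' Hs' y Hy. apply H; auto. now apply (Hcell j). }
set (dxi := fun t j x => Derive (fun s => uh s j x) t - cellwise m P (time_derivative u t) j x).
assert (Cut : forall t, 0 < t < T -> cont (time_derivative u t)).
{ intros t Ht. destruct (Hu1 t Ht) as [H _]. apply (smooth_cont (S k)), (sob_smooth _ _ _ _ _ H). }
assert (Dxi : forall t j x, 0 < t < T -> (j < ncell m)%nat -> is_derive (fun s => xi s j x) t (dxi t j x)).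
{ intros t j x Ht Hj. assert (Hc := node_incr _ _ m j Hj).
  apply (is_derive_minus (fun s => uh (clamp T s) j x) (fun s => pu s j x)).
  - apply (clamp_derive T (fun s => uh s j x)); auto. apply Derive_correct, Hder; auto.
  - apply (radau_deriv HP _ _ (fun s => u (clamp T s))); auto.
    intros e He. destruct (Huder t Ht e He) as [dl [Hdl H]]. exists dl. split; auto.
    intros s' Hs' y Hy. apply H; auto. now apply (Hcell j). }
assert (DE : forall t, 0 < t < T -> is_derive E t (2 * ip m (dxi t) (xi t))).
{ intros t Ht. unfold E, ip. rewrite <- bigsum_scal.
  apply (is_derive_bigsum (ncell m) (fun j s => cell_int m j (fun x => xi s j x * xi s j x))).
  intros j Hj. apply (energy_derive k (fun s => xi s j)).
  - intros s; now apply Vxi.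
  - intros x. now apply Dxi. }
set (dl := h / (Ci * sg)).
assert (Hdl : 0 < dl) by now apply Rdiv_lt_0_compat.
assert (Rate : forall t, 0 < t < T -> E t < dl -> 2 * ip m (dxi t) (xi t) <= 2 * Ce * (E t + W)).
{ intros t Ht HEt. rewrite Rmult_assoc. apply Rmult_le_compat_l; [lra|].
  assert (Hct : clamp T t = t) by (apply clamp_id; lra).
  destruct (Hu1 t Ht) as [Su1 [w [Sw Hslice]]].
  assert (Sut := Hu t ltac:(lra)).
  assert (Cu1 := Cut t Ht). assert (Cw0 : cont w) by (apply (smooth_cont (S (S k))), (sob_smooth _ _ _ _ _ Sw)).
  assert (Sw' := Sw). destruct Sw' as [_ [_ Sw1]].
  assert (Cw1 : cont (Derive w)) by (apply (smooth_cont (S k)), (sob_smooth _ _ _ _ _ Sw1)).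
  destruct (HV t ltac:(lra)) as [_ [Vv Vq]].
  assert (Hsum := ldg_sum m k (power_flux p) Fl th _ _ _ _ Eq Eu Ev (Heq t Ht)).
  assert (Eu0 : u a = u a) by reflexivity.
  assert (Hxisup : forall j x, (j < ncell m)%nat -> node m j <= x <= node m (S j) ->
     Rabs (xi t j x) <= 1).
  { intros j x Hj Hx. assert (Hc := node_incr _ _ m j Hj).
    destruct (Hinv _ _ (xi t j) x Hc (Vxi t j Hj) Hx) as [H1 _].
    assert (H2 : RInt (fun x => xi t j x ^ 2) (node m j) (node m (S j)) <= E t).
    { rewrite (RInt_ext_R _ (fun x => xi t j x * xi t j x)) by (intros; ring).
      apply (bigsum_term_le (ncell m) (fun j => cell_int m j (fun x => xi t j x * xi t j x))); auto.
      intros i Hi. assert (Cx := Vh_cont _ _ _ (Vxi t) i Hi).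
      apply RInt_nonneg_cont; [now apply cell_le|cont_tac|intros; apply Rle_0_sqr]. }
    assert (Hwid := hmax_le_width m sg j Hsig' Hj). fold h in Hwid.
    fold (width m j) in H1.
    assert (H3 : Ci * RInt (fun x => xi t j x ^ 2) (node m j) (node m (S j)) <= Ci * dl)
      by (apply Rmult_le_compat_l; lra).
    assert (H4 : h * xi t j x ^ 2 <= h * 1).
    { apply Rle_trans with (sg * (width m j * xi t j x ^ 2)).
      - rewrite <- Rmult_assoc. apply Rmult_le_compat_r; auto. apply pow2_ge_0.
      - replace (h * 1) with (sg * (Ci * dl)) by (unfold dl; field; split; lra).
        apply Rmult_le_compat_l; lra. }
    apply Rmult_le_reg_l in H4; auto.
    rewrite <- (sqrt_1), <- sqrt_Rsqr_abs. apply sqrt_le_1_alt. unfold Rsqr. lra. }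
  assert (Hetasup : forall j x, (j < ncell m)%nat -> node m j <= x <= node m (S j) ->
     Rabs (interp_error (u t) (pu t) j x) <= A * width m j).
  { intros j x Hj Hx. unfold pu. rewrite Hct.
    apply (cellwise_small m k 1); auto; [lra|]. specialize (Hsobu t). now rewrite Hct in Hsobu. }
  assert (Hetah : forall j x, (j < ncell m)%nat -> node m j <= x <= node m (S j) ->
     Rabs (interp_error (u t) (pu t) j x) <= A * h).
  { intros j x Hj Hx. eapply Rle_trans; [apply (Hetasup j x Hj Hx)|].
    apply Rmult_le_compat_l; auto. now apply (width_le_hmax m). }
  assert (Hubd : forall x, a <= x <= b -> Rabs (u t x) <= M + 2 - 2 /\ Rabs (Derive (u t) x) <= M).
  { destruct Sut as [_ [B1 [_ [B2 _]]]]. intros x Hx. split; auto. specialize (B1 x Hx); lra. }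
  assert (Beta' := Beta t). rewrite Hct in Beta'.
  assert (Ceta := Cucl t). rewrite Hct in Ceta.
  assert (Mf : mean_free m k (interp_error (u t) (pu t))).
  { unfold pu. rewrite Hct. now apply (cellwise_mean_free m k 1 Cu). }
  assert (Bw : cell_bounded m (interp_error w (cellwise m Pw w)) Sq).
  { apply (cell_bounded_mono m _ (Cw * M' * h ^ (2 * k + 1))).
    - unfold Sq, CS. apply Rmult_le_compat_r; [lra|]. apply Rmult_le_compat_r; lra.
    - apply (cellwise_bounded m k ew); auto; [lra|]. apply sob_le_S; auto; lra. }
  assert (Bq : cell_bounded m (interp_error (Derive w) (cellwise m P (Derive w))) Sq).
  { apply (cell_bounded_mono m _ (Cu * M' * h ^ (2 * k + 1))).
    - unfold Sq, CS. apply Rmult_le_compat_r; [lra|]. apply Rmult_le_compat_r; lra.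
    - apply (cellwise_bounded m k 1); auto; [lra|]. apply (sob_mono _ _ _ M); auto. }
  assert (B1 : cell_bounded m (interp_error (time_derivative u t) (cellwise m P (time_derivative u t))) Sq).
  { apply (cell_bounded_mono m _ (Cu * M' * h ^ (2 * k + 1))).
    - unfold Sq, CS. apply Rmult_le_compat_r; [lra|]. apply Rmult_le_compat_r; lra.
    - apply (cellwise_bounded m k 1); auto; [lra|]. apply (sob_mono _ _ _ M); auto. }
  assert (Vut : Vh m k (fun j x => Derive (fun s => uh s j x) t)).
  { intros j Hj. apply (poly_time_deriv k (fun s => uh (clamp T s) j) _ t).
    - intros s; now apply Vuh.
    - intros x. apply (clamp_derive T (fun s => uh s j x)); auto. apply Derive_correct, Hder; auto. }
  assert (Hx := Hrate a b m (power_flux p) _ _ (fhat Fl) th (kap h) Sq (u t) (time_derivative u t) w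
    (fun j x => Derive (fun s => uh s j x) t) (uh t) (vh t) (qh t) (pu t)
    (cellwise m P (time_derivative u t)) (cellwise m Pw w) (cellwise m P (Derive w))
    Hf Hsig' Hk0 HS Hslice Hubd Vut (proj1 (HV t ltac:(lra))) Vv Vq (Vpu t)
    (cellwise_Vh m k 1 Cu P _ HP Cu1) (cellwise_Vh m k ew Cw Pw _ HPw Cw0)
    (cellwise_Vh m k 1 Cu P _ HP Cw1) Hsum Beta' B1 Bw Bq Mf).
  cbv zeta in Hx.
  assert (Exi : xi t = fun j x => uh t j x - pu t j x) by (unfold xi; now rewrite Hct).
  rewrite <- Exi in Hx. apply Hx; clear Hx.
  - intros phi Hphi. split; [|split].
    + apply (Hr1 a b m); auto. intros j Hj. unfold pu. rewrite Hct. now apply (cellwise_end m k 1 Cu).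
    + apply (Hr1 a b m); auto; [now apply (cellwise_mean_free m k 1 Cu)|].
      intros j Hj. now apply (cellwise_end m k 1 Cu).
    + apply (Hr2 a b m); auto; [now apply (cellwise_mean_free m k ew Cw)|].
      intros j Hj. now apply (cellwise_end m k ew Cw).
  - intros j x Hj Hx. assert (H1 := Hetah j x Hj Hx). split; [now apply Hxisup|split; [lra|now apply Hetasup]].
  - intros i Hi. destruct (trace_split m (u t) (uh t) (pu t) i (slice_u_per _ _ _ _ _ _ Hslice) Hi)
      as [T1 T2].
    unfold at_nodes. rewrite T1, T2. rewrite <- Exi.
    assert (Hz : trace_minus m (interp_error (u t) (pu t)) i = 0).
    { assert (Hz : forall j, (j < ncell m)%nat -> trace_minus m (interp_error (u t) (pu t)) (S j) = 0).
      { intros j Hj. rewrite trace_minus_S.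
        assert (H := cellwise_end m k 1 Cu P (u t) j HP Ceta Hj).
        replace (node m j + (node m (S j) - node m j) * 1) with (node m (S j)) in H by ring.
        unfold pu. now rewrite Hct. }
      destruct i as [|i]; [|apply Hz; lia]. rewrite <- trace_minus_periodic.
      assert (Hn := ncell_pos _ _ m). destruct (ncell m) as [|n]; [lia|]. apply Hz; lia. }
    rewrite Hz, Rminus_0_r.
    destruct (trace_bound m (xi t) (fun y => Rabs y <= 1) i Hxisup Hi) as [Q1 Q2].
    destruct (trace_bound m _ (fun y => Rabs y <= A * h) i Hetah Hi) as [_ Q3].
    eapply Rle_trans; [apply (Hnb h); auto; try lra|].
    + apply Hubd, node_range; lia.
    + apply Req_le. fold h. ring. }
assert (HE0 : E 0 + W <= CE * Z).
{ assert (Hc0 : clamp T 0 = 0) by (apply clamp_id; lra).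
  assert (Kuh := Vh_cont _ _ _ (Vuh 0)). assert (Cu0 := Cucl 0). rewrite Hc0 in Kuh, Cu0.
  destruct (L2_error_sqr m (u 0) (uh 0) Cu0 Kuh) as [HL0 HLs].
  assert (H1 : E 0 <= 2 * ip m (interp_error (u 0) (pu 0)) (interp_error (u 0) (pu 0))
     + 2 * ip m (fun j x => u 0 x - uh 0 j x) (fun j x => u 0 x - uh 0 j x)).
  { unfold E. apply (sum_sqr_le m (xi 0) (interp_error (u 0) (pu 0)) (fun j x => u 0 x - uh 0 j x)).
    - apply (Vh_cont m k), Vxi.
    - assert (H := Keta 0). now rewrite Hc0 in H.
    - intros j Hj. assert (H := Kuh j Hj). cont_tac.
    - intros j x Hj. unfold xi, interp_error. rewrite Hc0. ring. }
  assert (H2 : ip m (fun j x => u 0 x - uh 0 j x) (fun j x => u 0 x - uh 0 j x) = L2_error m (u 0) (uh 0) ^ 2).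
  { rewrite HLs. apply bigsum_ext; intros j Hj. apply RInt_ext_R; intros; ring. }
  assert (H3 : L2_error m (u 0) (uh 0) ^ 2 <= C0 ^ 2 * Z).
  { apply Rle_trans with ((C0 * h ^ (k + 1)) ^ 2); [apply pow_incr; auto|].
    replace ((C0 * h ^ (k + 1)) ^ 2) with (C0 ^ 2 * (h * h ^ (2 * k + 1))).
    - apply Rmult_le_compat_l; auto. apply pow2_ge_0.
    - rewrite Rpow_mult_distr, <- pow_mult. change (h * h ^ (2 * k + 1)) with (h ^ S (2 * k + 1)).
      f_equal. f_equal. lia. }
  assert (H4 := Etaip 0). rewrite Hc0 in H4. unfold CE. lra. }
assert (HEW0 : 0 <= E 0 + W).
{ assert (H : 0 <= E 0) by exact (ip_pos m (xi 0) (Vh_cont m k (xi 0) (Vxi 0))). lra. }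
(* The final bound stays below the threshold dl of the differential inequality. *)
assert (Hthr : CE * Z * X < dl).
{ apply Rle_lt_trans with (CE * X * (2 * h ^ 2)).
  - replace (CE * Z * X) with (CE * X * Z) by ring. now apply Rmult_le_compat_l.
  - apply (Rmult_lt_reg_r (Ci * sg)); auto. unfold dl.
    replace (h / (Ci * sg) * (Ci * sg)) with h by (field; split; lra).
    replace (CE * X * (2 * h ^ 2) * (Ci * sg)) with (h * (2 * (CE * X * (Ci * sg)) * h)) by ring.
    rewrite <- (Rmult_1_r h) at 3. apply Rmult_lt_compat_l; auto.
    replace (2 * (CE * X * (Ci * sg)) * h) with (/ 2 * (h * (4 * (CE * X * (Ci * sg))))) by field.
    lra. }
assert (HZX : CE * Z <= CE * Z * X).
{ rewrite <- (Rmult_1_r (CE * Z)) at 1. apply Rmult_le_compat_l; auto. now apply Rmult_le_pos. }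
assert (HEX : (E 0 + W) * X <= CE * Z * X) by (apply Rmult_le_compat_r; lra).
assert (Hfin := gronwall_barrier E (fun t => 2 * ip m (dxi t) (xi t)) T (2 * Ce) W dl HTp CE0 DE Rate
   ltac:(lra) HEW0 ltac:(lra)). fold X in Hfin. specialize (Hfin ltac:(lra)).
intros t Ht. specialize (Hfin t Ht).
assert (Hct : clamp T t = t) by (apply clamp_id; lra).
assert (Kuh := Vh_cont _ _ _ (Vuh t)). assert (Cut0 := Cucl t). rewrite Hct in Kuh, Cut0.
destruct (L2_error_sqr m (u t) (uh t) Cut0 Kuh) as [HL0 HLs]. rewrite HLs.
assert (H1 : ip m (fun j x => u t x - uh t j x) (fun j x => u t x - uh t j x)
   <= 2 * ip m (interp_error (u t) (pu t)) (interp_error (u t) (pu t)) + 2 * E t).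
{ unfold E. apply (sum_sqr_le m (fun j x => u t x - uh t j x) (interp_error (u t) (pu t)) (xi t)).
  - intros j Hj. assert (H := Kuh j Hj). cont_tac.
  - assert (H := Keta t). now rewrite Hct in H.
  - apply (Vh_cont m k), Vxi.
  - intros j x Hj. unfold xi, interp_error. rewrite Hct. ring. }
assert (H2 : ip m (fun j x => u t x - uh t j x) (fun j x => u t x - uh t j x)
  = bigsum (ncell m) (fun j => cell_int m j (fun x => (u t x - uh t j x) ^ 2))).
{ apply bigsum_ext; intros j Hj. apply RInt_ext_R; intros; ring. }
assert (H3 := Etaip t). rewrite Hct in H3. fold h. fold Z. lra.
Qed.

(** * The three schemes *)

Lemma ddx_matched {a b} (m : mesh a b) k th eta phi : mean_free m k eta -> Vh m k phi ->
  (forall i, (i < ncell m)%nat -> at_nodes m (lin th) eta i = 0) -> ddx m th eta phi = 0.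
Proof.
intros Hm Hp H. rewrite (ddx_mean_free m k) by auto. apply bigsum_zero; intros i Hi.
rewrite H by auto; ring.
Qed.

(** A flux that reads only the trace interpolated by the projection sees no error. *)
Lemma residual_upwind k s (kap : R -> R) : (forall h, 0 < h -> 0 <= kap h) ->
  residual_bound k s 1 1 kap 0 /\ residual_bound k s (1 - 1) 0 kap 0.
Proof.
intros Hk.
assert (Hz : forall a b (m : mesh a b) th eta Sq phi, mean_free m k eta -> Vh m k phi -> 0 <= Sq ->
   (forall i, (i < ncell m)%nat -> at_nodes m (lin th) eta i = 0) ->
   Rabs (ddx m th eta phi) <= / 16 * ip m phi phi + 0 * (kap (hmax m) * Sq)).
{ intros a b m th eta Sq phi Hm Hp HS H. rewrite (ddx_matched m k) by auto. rewrite Rabs_R0.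
  assert (I := ip_pos m phi (Vh_cont _ _ _ Hp)). lra. }
split; intros a b m eta Sq phi _ HS Hm _ He Hp; apply Hz; auto; intros i Hi; unfold at_nodes, lin.
- assert (Ht : forall j, (j < ncell m)%nat -> trace_minus m eta (S j) = 0).
  { intros j Hj. rewrite trace_minus_S. assert (H := He j Hj).
    now replace (node m j + (node m (S j) - node m j) * 1) with (node m (S j)) in H by ring. }
  assert (H0 : trace_minus m eta i = 0).
  { destruct i as [|i]; [|apply Ht; lia]. rewrite <- trace_minus_periodic.
    assert (Hn := ncell_pos _ _ m). destruct (ncell m) as [|n]; [lia|]. apply Ht; lia. }
  rewrite H0; ring.
- rewrite trace_plus_lt by auto. assert (H := He i Hi).
  replace (node m i + (node m (S i) - node m i) * 0) with (node m i) in H by ring.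
  rewrite H; ring.
Qed.

(** Central fluxes average both traces, so one of them always carries an error. *)
Lemma residual_central k s : 0 < s -> exists Cr, 0 <= Cr /\
  residual_bound k s (/ 2) 1 (fun h => / h) Cr /\ residual_bound k s (1 - / 2) 1 (fun h => / h) Cr.
Proof.
intros Hs. destruct (inverse_cell k) as [Ci [HCi Hinv]].
exists (4 * s * Ci / / 16). split.
{ assert (0 < s * Ci) by now apply Rmult_lt_0_compat. apply Rdiv_le_0_compat; lra. }
split; intros a b m eta Sq phi Hsig HS Hm HB _ Hp;
  apply (ddx_residual m k); auto; lra.
Qed.

Lemma pow_le_sqr h n : 0 < h <= 1 -> (2 <= n)%nat -> h ^ n <= h ^ 2.
Proof.
intros Hh Hn. replace n with (2 + (n - 2))%nat by lia. rewrite pow_add.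
rewrite <- (Rmult_1_r (h ^ 2)) at 2. apply Rmult_le_compat_l; [apply pow2_ge_0|].
rewrite <- (pow1 (n - 2)). apply pow_incr; lra.
Qed.

Definition estimate_holds (p k : nat) (a b T sigma K C0 : R) (Fl : fluxes)
    (rate : R -> R) (C h0 : R) : Prop :=
  forall u, smooth_bounded a b T (k + 2) u -> fornberg_whitham a b T (power_flux p) u ->
  (forall t, 0 <= t <= T -> sobolev_norm a b (k + 2) (u t) <= K) ->
  forall (m : mesh a b) uh vh qh, hmax m <= h0 -> hmax m / hmin m <= sigma ->
    L2_error m (u 0) (uh 0) <= C0 * hmax m ^ (k + 1) ->
    ldg_solution m k T (power_flux p) Fl uh vh qh ->
    forall t, 0 <= t <= T -> L2_error m (u t) (uh t) <= C * rate (hmax m).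

Lemma le_of_sqr_le e C y : 0 <= e -> 0 < C -> 0 <= y -> e ^ 2 <= C * y ^ 2 -> e <= (C + 1) * y.
Proof.
intros He HC Hy H. apply Rsqr_incr_0; [|auto|apply Rmult_le_pos; lra]. unfold Rsqr.
assert (I := pow2_ge_0 y). assert (0 <= C * y ^ 2) by nonneg.
assert (0 <= C ^ 2 * y ^ 2) by nonneg. lra.
Qed.

Lemma estimate_of_square p k a b T sigma K C0 Fl (kap rate : R -> R) B C h0 : 0 < C -> 0 < B ->
  0 < h0 <= 1 -> (forall h, 0 < h <= 1 -> 0 <= rate h /\ (kap h + h) * h ^ (2 * k + 1) <= B * rate h ^ 2) ->
  (forall u, smooth_bounded a b T (k + 2) u -> fornberg_whitham a b T (power_flux p) u ->
  (forall t, 0 <= t <= T -> sobolev_norm a b (k + 2) (u t) <= K) ->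
  forall (m : mesh a b) uh vh qh, hmax m <= h0 -> hmax m / hmin m <= sigma ->
    L2_error m (u 0) (uh 0) <= C0 * hmax m ^ (k + 1) ->
    ldg_solution m k T (power_flux p) Fl uh vh qh ->
    forall t, 0 <= t <= T ->
      L2_error m (u t) (uh t) ^ 2 <= C * ((kap (hmax m) + hmax m) * hmax m ^ (2 * k + 1))) ->
  estimate_holds p k a b T sigma K C0 Fl rate (C * B + 1) h0.
Proof.
intros HC HB Hh0 Hr H u Hu Hf HK m uh vh qh Hh Hs Hi Hl t Ht.
assert (Hhp := hmax_pos m). destruct (Hr (hmax m) ltac:(lra)) as [Hr0 Hr1].
apply le_of_sqr_le; auto.
- apply sqrt_pos.
- now apply Rmult_lt_0_compat.
- eapply Rle_trans; [apply (H u Hu Hf HK m uh vh qh Hh Hs Hi Hl t Ht)|].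
  rewrite Rmult_assoc. apply Rmult_le_compat_l; lra.
Qed.

(** For odd p the flux is nondecreasing, so that every term at the nodes vanishes or has
    the right sign. *)
Lemma estimate_upwind p k a b T sigma K C0 : (2 <= p)%nat -> (1 <= k)%nat -> a < b -> 0 < T ->
  Nat.Odd p -> exists C h0, 0 < C /\ 0 < h0 /\
  estimate_holds p k a b T sigma K C0 (schemeD1 (power_flux p)) (fun h => h ^ (k + 1)) C h0.
Proof.
intros Hp Hk Hab HT Hodd.
destruct (scheme_estimate p k a b T sigma K C0 (schemeD1 (power_flux p)) 1 0 (fun _ => 0))
  as [C [h0 [HC [Hh0 H]]]]; auto.
- intros; simpl; unfold lin; ring.
- intros; simpl; unfold lin; ring.
- intros; simpl; unfold lin; ring.
- intros h Hh. split; [lra|]. rewrite Rplus_0_l.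
  change (h * h ^ (2 * k + 1)) with (h ^ S (2 * k + 1)).
  assert (I := pow_le_sqr h (S (2 * k + 1)) Hh ltac:(lia)). assert (J := pow2_ge_0 h). lra.
- intros s Hs. exists 0. split; [lra|]. apply residual_upwind. intros; lra.
- intros f1 F r L L2 A Hf HA. exists 0. split; [lra|]. intros h u xm xp ep _ _ _ _ _ _.
  rewrite Rmult_0_l. apply (node_upwind _ f1 F r L L2); auto.
  intros; now apply power_flux_monotone.
- exists (C * 1 + 1), h0. split; [lra|]. split; [lra|].
  apply (estimate_of_square p k a b T sigma K C0 _ (fun _ => 0)); auto; [lra|].
  intros h Hh. split; [apply pow_le; lra|]. apply Req_le. rewrite <- pow_mult.
  replace ((k + 1) * 2)%nat with (S (2 * k + 1)) by lia. simpl; ring.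
Qed.

(** In general f' may change sign and the one trace error left costs half a power of h,
    thanks to dissipation. *)
Lemma estimate_godunov p k a b T sigma K C0 : (2 <= p)%nat -> (1 <= k)%nat -> a < b -> 0 < T ->
  exists C h0, 0 < C /\ 0 < h0 /\
  estimate_holds p k a b T sigma K C0 (schemeD1 (power_flux p))
    (fun h => Rpower h (INR k + / 2)) C h0.
Proof.
intros Hp Hk Hab HT.
assert (Hk2 : forall h, 0 < h <= 1 -> (1 + h) * h ^ (2 * k + 1) <= 2 * h ^ (2 * k + 1)).
{ intros h Hh. apply Rmult_le_compat_r; [apply pow_le|]; lra. }
destruct (scheme_estimate p k a b T sigma K C0 (schemeD1 (power_flux p)) 1 0 (fun _ => 1))
  as [C [h0 [HC [Hh0 H]]]]; auto.
- intros; simpl; unfold lin; ring.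
- intros; simpl; unfold lin; ring.
- intros; simpl; unfold lin; ring.
- intros h Hh. split; [lra|]. specialize (Hk2 h Hh).
  assert (I := pow_le_sqr h (2 * k + 1) Hh ltac:(lia)). lra.
- intros s Hs. exists 0. split; [lra|]. apply residual_upwind. intros; lra.
- intros f1 F r L L2 A Hf HA.
  assert (HL := flux_L Hf). assert (HL2 := flux_L2 Hf).
  exists (2 * L + 16 * L2 * (1 + A)). split.
  { assert (0 <= L2 * (1 + A)) by nonneg. lra. }
  intros h u xm xp ep Hh Hu Hm Hpp He HeA. rewrite Rmult_1_l.
  apply (node_godunov _ f1 F r L L2 A); auto; lra.
- exists (C * 2 + 1), h0. split; [lra|]. split; [lra|].
  apply (estimate_of_square p k a b T sigma K C0 _ (fun _ => 1)); auto; [lra|].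
  intros h Hh. split; [apply Rlt_le, exp_pos|].
  replace (Rpower h (INR k + / 2) ^ 2) with (h ^ (2 * k + 1)); [auto|].
  rewrite <- (Rpower_pow 2), Rpower_mult, <- Rpower_pow by (try apply exp_pos; lra).
  f_equal. rewrite plus_INR, mult_INR. simpl. field.
Qed.

(** Neither matching nor dissipation: a full power of h is lost. *)
Lemma estimate_conservative p k a b T sigma K C0 : (2 <= p)%nat -> (1 <= k)%nat -> a < b -> 0 < T ->
  exists C h0, 0 < C /\ 0 < h0 /\
  estimate_holds p k a b T sigma K C0 (schemeC1 (power_flux p)) (fun h => h ^ k) C h0.
Proof.
intros Hp Hk Hab HT.
assert (Hk2 : forall h, 0 < h <= 1 -> (/ h + h) * h ^ (2 * k + 1) <= 2 * h ^ (2 * k)).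
{ intros h Hh. rewrite pow_add, pow_1.
  replace ((/ h + h) * (h ^ (2 * k) * h)) with ((1 + h ^ 2) * h ^ (2 * k)) by (field; lra).
  apply Rmult_le_compat_r; [apply pow_le; lra|]. assert (h ^ 2 <= 1 ^ 2) by (apply pow_incr; lra). lra. }
destruct (scheme_estimate p k a b T sigma K C0 (schemeC1 (power_flux p)) (/ 2) 1 (fun h => / h))
  as [C [h0 [HC [Hh0 H]]]]; auto.
- intros; simpl; unfold lin, average; field.
- intros; simpl; unfold lin, average; field.
- intros; simpl; unfold lin, average; field.
- intros h Hh. split; [apply Rlt_le, Rinv_0_lt_compat; lra|]. specialize (Hk2 h Hh).
  assert (I := pow_le_sqr h (2 * k) Hh ltac:(lia)). lra.
- apply residual_central.
- intros f1 F r L L2 A Hf HA.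
  assert (HL := flux_L Hf). assert (HL2 := flux_L2 Hf).
  exists (5 * (L + 6 * L2)). split; [lra|].
  intros h u xm xp ep Hh Hu Hm Hpp He HeA.
  assert (I := node_conservative _ f1 F r L L2 h u xm xp 0 ep Hf Hh Hu Hm Hpp
    ltac:(rewrite Rabs_R0; lra) He).
  rewrite Rminus_0_r in I. replace (0 ^ 2 + ep ^ 2) with (ep ^ 2) in I by ring. exact I.
- exists (C * 2 + 1), h0. split; [lra|]. split; [lra|].
  apply (estimate_of_square p k a b T sigma K C0 _ (fun h => / h)); auto; [lra|].
  intros h Hh. split; [apply pow_le; lra|]. rewrite <- pow_mult, (Nat.mul_comm k 2). auto.
Qed.

Lemma estimate_mono p k a b T sigma K C0 Fl rate C C' h0 h0' :
  (forall h, 0 < h -> 0 <= rate h) -> C <= C' -> h0' <= h0 ->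
  estimate_holds p k a b T sigma K C0 Fl rate C h0 ->
  estimate_holds p k a b T sigma K C0 Fl rate C' h0'.
Proof.
intros Hr HC Hh H u Hu Hf HK m uh vh qh Hm Hs Hi Hl t Ht.
eapply Rle_trans; [apply (H u Hu Hf HK m uh vh qh ltac:(lra) Hs Hi Hl t Ht)|].
apply Rmult_le_compat_r; auto. apply Hr, hmax_pos.
Qed.

Theorem theorem2p4 (p k : nat) (a b T sigma K M C0 : R) :
  (2 <= p)%nat -> a < b -> 0 < T ->
  exists C : R, 0 < C /\
  forall u : R -> R -> R,
    smooth_bounded a b T (k + 2) u ->
    fornberg_whitham a b T (power_flux p) u ->
    (forall t, 0 <= t <= T -> sobolev_norm a b (k + 2) (u t) <= K) ->
    (forall t x i, 0 <= t <= T -> (1 <= i <= 2)%nat ->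
       Rabs (Derive_n (power_flux p) i (u t x)) <= M) ->
  exists h0 : R, 0 < h0 /\
  forall (m : mesh a b) (uh vh qh : R -> nat -> R -> R),
    hmax m <= h0 ->
    hmax m / hmin m <= sigma ->
    L2_error m (u 0) (uh 0) <= C0 * hmax m ^ (k + 1) ->
    ((1 <= k)%nat ->
     ldg_solution m k T (power_flux p) (schemeD1 (power_flux p)) uh vh qh ->
     forall t, 0 <= t <= T ->
       (Nat.Odd p -> L2_error m (u t) (uh t) <= C * hmax m ^ (k + 1)) /\
       (Nat.Even p ->
          L2_error m (u t) (uh t) <= C * Rpower (hmax m) (INR k + / 2))) /\
    ((2 <= k)%nat ->
     ldg_solution m k T (power_flux p) (schemeC1 (power_flux p)) uh vh qh ->
     forall t, 0 <= t <= T ->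
       L2_error m (u t) (uh t) <= C * hmax m ^ k).
Proof.
intros Hp Hab HT.
destruct (le_lt_dec 1 k) as [Hk|Hk].
2:{ exists 1. split; [lra|]. intros u _ _ _ _. exists 1. split; [lra|]. intros. split; intros; lia. }
assert (H1 : exists C h0, 0 < C /\ 0 < h0 /\ (Nat.Odd p ->
  estimate_holds p k a b T sigma K C0 (schemeD1 (power_flux p)) (fun h => h ^ (k + 1)) C h0)).
{ destruct (Nat.Even_or_Odd p) as [He|Ho].
  - exists 1, 1. split; [lra|split; [lra|]]. intros Ho. destruct (Nat.Even_Odd_False p He Ho).
  - destruct (estimate_upwind p k a b T sigma K C0 Hp Hk Hab HT Ho) as [C [h0 [HC [Hh H]]]].
    exists C, h0. auto. }
destruct H1 as [C1 [h1 [HC1 [Hh1 H1]]]].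
destruct (estimate_godunov p k a b T sigma K C0 Hp Hk Hab HT) as [C2 [h2 [HC2 [Hh2 H2]]]].
destruct (estimate_conservative p k a b T sigma K C0 Hp Hk Hab HT) as [C3 [h3 [HC3 [Hh3 H3]]]].
assert (Hpow : forall n h, 0 < h -> 0 <= h ^ n) by (intros; apply pow_le; lra).
exists (C1 + C2 + C3). split; [lra|]. intros u Hu Hf HK _.
set (h0 := Rmin h1 (Rmin h2 h3)).
assert (I1 : h0 <= h1) by apply Rmin_l.
assert (I2 : h0 <= h2) by (eapply Rle_trans; [apply Rmin_r|apply Rmin_l]).
assert (I3 : h0 <= h3) by (eapply Rle_trans; [apply Rmin_r|apply Rmin_r]).
exists h0. split; [repeat apply Rmin_glb_lt; auto|].
intros m uh vh qh Hh Hs Hi. split.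
- intros _ Hl t Ht. split.
  + intros Ho. apply (estimate_mono p k a b T sigma K C0 _ _ C1 (C1 + C2 + C3) h1 h0 (Hpow _)
      ltac:(lra) I1 (H1 Ho) u Hu Hf HK m uh vh qh); auto.
  + intros _. apply (estimate_mono p k a b T sigma K C0 _ _ C2 (C1 + C2 + C3) h2 h0
      (fun h _ => Rlt_le _ _ (exp_pos _)) ltac:(lra) I2 H2 u Hu Hf HK m uh vh qh); auto.
- intros _ Hl t Ht.
  apply (estimate_mono p k a b T sigma K C0 _ _ C3 (C1 + C2 + C3) h3 h0 (Hpow _)
    ltac:(lra) I3 H3 u Hu Hf HK m uh vh qh); auto.
Qed.
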